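(* Let $\mathcal{A}$ be a Hom-finite Krull-Schmidt $k$-category for which there is a positive integer $n\ge 2$ such that each indecomposable complex in $\mathbf{C}^b(\mathcal{A})$ is a shift of an indecomposable complex in $\mathbf{C}_{[1,n]}(\mathcal{A})$. Assume that $\mathcal{A}$ is a dualizing $k$-category such that $\operatorname{mod}\mathcal{A}$ has finite global dimension, and let $m\geq 2$. Then each almost split sequence in $\mathbf{C}_{\equiv m}(\mathcal{A})$ is the image under $\mathcal{F}_m$ of the shift of an almost split sequence in $\mathbf{C}_{[1,n]}(\mathcal{A})$.
   Context: $k$ is a commutative ring. $\operatorname{Mod}\mathcal{A}$ is the category of contravariant $k$-linear functors $\mathcal{A}\to\operatorname{Mod}k$, and $\operatorname{mod}\mathcal{A}$ is the full subcategory of finitely presented functors. $\mathcal{A}$ is dualizing (Auslander-Reiten) if the finitely presented and the finitely copresented objects of $\operatorname{Mod}\mathcal{A}$ coincide (finitely copresented: kernel of a morphism between functors of the form $D\mathcal{A}(X,-)$, with $D$ the standard duality of $k$-modules); then $\operatorname{mod}\mathcal{A}$ is abelian with enough projectives. $\mathbf{C}^b(\mathcal{A})$ is the category of bounded cochain complexes over $\mathcal{A}$; $\mathbf{C}_{[1,n]}(\mathcal{A})$ is the full subcategory of complexes with $X^i=0$ for $i\notin[1,n]$. The shift $X[t]$ has $X[t]^i=X^{i+t}$ and differential $(-1)^td_X^{i+t}$. $\mathbf{C}_{\equiv m}(\mathcal{A})$ is the category of $m$-periodic complexes: complexes $X=(X^i,d_X^i)_{i\in\mathbb{Z}}$ with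 $X^i=X^j$, $d_X^i=d_X^j$ whenever $i\equiv j\pmod m$; morphisms are chain maps $(f^i)$ with $f^i=f^j$ whenever $i\equiv j\pmod m$. The compression functor $\mathcal{F}_m:\mathbf{C}^b(\mathcal{A})\to\mathbf{C}_{\equiv m}(\mathcal{A})$ is given by $\mathcal{F}_m(X)^i=\bigoplus_{t\in\mathbb{Z}}X^{i+tm}$ with diagonal differential with components $d_X^{i+tm}$, and $\mathcal{F}_m(f)^i$ is diagonal with components $f^{i+tm}$. All these categories carry the exact structure whose conflations $X\to Y\to Z$ are split exact in each degree. An almost split sequence is a conflation $X\xrightarrow{f}Y\xrightarrow{g}Z$ with $f$ minimal left almost split and $g$ minimal right almost split in the category considered. Sequences are considered up to isomorphism. *)

(* Defs.v *)
From HB Require Import structures.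
From mathcomp Require Import all_boot all_order all_algebra.
From mathcomp Require Import boolp.
From mathcomp Require Import zify.

Set Implicit Arguments.
Unset Strict Implicit.
Unset Printing Implicit Defensive.

Import Order.TTheory GRing.Theory Num.Theory.
Local Open Scope ring_scope.

Record kcat (k : comPzRingType) := KCat {
  ob :> Type;
  hom : ob -> ob -> lmodType k;
  idm : forall X : ob, hom X X;
  comp : forall X Y Z : ob, hom Y Z -> hom X Y -> hom X Z;
  comp1m : forall X Y (f : hom X Y), comp (idm Y) f = f;
  compm1 : forall X Y (f : hom X Y), comp f (idm X) = f;
  compA : forall X Y Z W (h : hom Z W) (g : hom Y Z) (f : hom X Y),
    comp h (comp g f) = comp (comp h g) f;
  comp_linl : forall X Y Z (a : k) (g g' : hom Y Z) (f : hom X Y),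
    comp (a *: g + g') f = a *: comp g f + comp g' f;
  comp_linr : forall X Y Z (a : k) (g : hom Y Z) (f f' : hom X Y),
    comp g (a *: f + f') = a *: comp g f + comp g f'
}.

Arguments hom {k C} _ _ : rename.
Arguments idm {k C} X : rename.
Arguments comp {k C X Y Z} _ _ : rename.

Declare Scope kcat_scope.
Delimit Scope kcat_scope with K.
Local Open Scope kcat_scope.
Notation "g \oc f" := (comp g f) (at level 40, left associativity) : kcat_scope.

Record kfunctor (k : comPzRingType) (C D : kcat k) := KFunctor {
  fob :> C -> D;
  fmap : forall X Y : C, hom X Y -> hom (fob X) (fob Y);
  fmap1 : forall X : C, fmap (idm X) = idm (fob X);
  fmapM : forall (X Y Z : C) (g : hom Y Z) (f : hom X Y),
    fmap (g \oc f) = fmap g \oc fmap f;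
  fmap_lin : forall (X Y : C) (a : k) (f g : hom X Y),
    fmap (a *: f + g) = a *: fmap f + fmap g
}.

Arguments fmap {k C D} Phi {X Y} _ : rename.

Section KCatTheory.
Variables (k : comPzRingType) (C : kcat k).
Implicit Types X Y Z : C.

Lemma comp0l X Y Z (f : hom X Y) : (0 : hom Y Z) \oc f = 0.
Proof.
have := comp_linl (-1) (0 : hom Y Z) 0 f.
by rewrite scaler0 addr0 scaleN1r addNr.
Qed.

Lemma comp0r X Y Z (g : hom Y Z) : g \oc (0 : hom X Y) = 0.
Proof.
have := comp_linr (-1) g (0 : hom X Y) 0.
by rewrite scaler0 addr0 scaleN1r addNr.
Qed.

Lemma compDl X Y Z (g g' : hom Y Z) (f : hom X Y) :
  (g + g') \oc f = g \oc f + g' \oc f.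
Proof. by have := comp_linl 1 g g' f; rewrite !scale1r. Qed.

Lemma compDr X Y Z (g : hom Y Z) (f f' : hom X Y) :
  g \oc (f + f') = g \oc f + g \oc f'.
Proof. by have := comp_linr 1 g f f'; rewrite !scale1r. Qed.

Lemma compZl X Y Z a (g : hom Y Z) (f : hom X Y) :
  (a *: g) \oc f = a *: (g \oc f).
Proof. by have := comp_linl a g 0 f; rewrite comp0l !addr0. Qed.

Lemma compZr X Y Z a (g : hom Y Z) (f : hom X Y) :
  g \oc (a *: f) = a *: (g \oc f).
Proof. by have := comp_linr a g f 0; rewrite comp0r !addr0. Qed.

Lemma comp_suml X Y Z (I : Type) (r : seq I) (g : I -> hom Y Z) (f : hom X Y) :
  (\sum_(i <- r) g i) \oc f = \sum_(i <- r) (g i \oc f).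
Proof.
by elim: r => [|i r IH]; rewrite ?big_nil ?comp0l // !big_cons compDl IH.
Qed.

Lemma comp_sumr X Y Z (I : Type) (r : seq I) (g : hom Y Z) (f : I -> hom X Y) :
  g \oc (\sum_(i <- r) f i) = \sum_(i <- r) (g \oc f i).
Proof.
by elim: r => [|i r IH]; rewrite ?big_nil ?comp0r // !big_cons compDr IH.
Qed.

Definition is_iso X Y (f : hom X Y) : Prop :=
  exists g : hom Y X, g \oc f = idm X /\ f \oc g = idm Y.

Definition isomorphic X Y : Prop := exists f : hom X Y, is_iso f.

Definition is_zero X : Prop := idm X = 0.

Lemma zero_domE X Y (f : hom X Y) : is_zero X -> f = 0.
Proof. by move=> zX; rewrite -[f]compm1 zX comp0r. Qed.

Lemma zero_codE X Y (f : hom X Y) : is_zero Y -> f = 0.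
Proof. by move=> zY; rewrite -[f]comp1m zY comp0l. Qed.

(* The data of a direct sum (biproduct) of a family [F].  The index type may be
   infinite: [ds_sum] forces [F i] to be zero for [i] outside [ds_supp], so for
   finite [I] these are the usual biproducts. *)
Record dsum (I : eqType) (F : I -> C) (S : C) := DSum {
  ds_supp : seq I;
  ds_in : forall i, hom (F i) S;
  ds_pr : forall i, hom S (F i);
  ds_uniq : uniq ds_supp;
  ds_prin : forall i, ds_pr i \oc ds_in i = idm (F i);
  ds_prin0 : forall i j, i != j -> ds_pr j \oc ds_in i = 0;
  ds_sum : \sum_(i <- ds_supp) (ds_in i \oc ds_pr i) = idm S
}.

(* [r = 0] gives the zero object. *)
Definition additive_cat : Prop :=
  forall (r : nat) (F : 'I_r -> C), exists S : C, inhabited (dsum F S).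

Definition indecomposable X : Prop :=
  ~ is_zero X /\
  forall F : bool -> C, dsum F X -> exists b : bool, is_zero (F b).

(* [End(X)] is a local ring: it is nonzero and its non-units are closed under
   addition. *)
Definition local_end X : Prop :=
  ~ is_zero X /\
  forall f g : hom X X, ~ is_iso f -> ~ is_iso g -> ~ is_iso (f + g).

Definition krull_schmidt : Prop :=
  additive_cat /\
  forall X : C, exists (r : nat) (F : 'I_r -> C),
    (forall i, local_end (F i)) /\ inhabited (dsum F X).

Definition fin_supp (I : eqType) (F : I -> C) : Prop :=
  exists s : seq I, forall i, i \notin s -> is_zero (F i).

Section Delta.
Variables (I : eqType) (F : I -> C).

Definition delta i j : hom (F i) (F j) :=
  match i =P j with
  | ReflectT e => ecast j (hom (F i) (F j)) e (idm (F i))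
  | ReflectF _ => 0
  end.

Lemma delta_id i : delta i i = idm (F i).
Proof. by rewrite /delta; case: eqP => // e; rewrite eq_axiomK. Qed.

Lemma delta_neq i j : i != j -> delta i j = 0.
Proof. by rewrite /delta; case: eqP. Qed.

Lemma delta_comp i j l :
  delta j l \oc delta i j = if i == j then delta i l else 0.
Proof.
by case: eqVneq => [->|/delta_neq->]; rewrite ?delta_id ?compm1 ?comp0r.
Qed.
End Delta.

Lemma dsum_ex (I : eqType) (F : I -> C) :
  additive_cat -> fin_supp F -> exists S : C, inhabited (dsum F S).
Proof.
move=> addC [s0 s0P]; pose s := undup s0.
have s_uniq : uniq s := undup_uniq _.
have sP i : i \notin s -> is_zero (F i) by rewrite mem_undup; exact: s0P.
have [S [D]] := addC (size s) (fun l => F (tnth (in_tuple s) l)).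
exists S; constructor.
pose t l := tnth (in_tuple s) l.
have t_inj : injective t.
  move=> l l'; rewrite /t !(tnth_nth (t l)) => /eqP.
  by rewrite nth_uniq // => /eqP; apply: val_inj.
have prin (l l' : 'I_(size s)) :
    ds_pr D l' \oc ds_in D l = delta F (t l) (t l').
  case: (eqVneq l l') => [->|nll'].
    by rewrite (ds_prin D) delta_id.
  by rewrite (ds_prin0 D) // delta_neq // (inj_eq t_inj).
pose inn i : hom (F i) S := \sum_l (ds_in D l \oc delta F i (t l)).
pose prr i : hom S (F i) := \sum_l (delta F (t l) i \oc ds_pr D l).
have prinn i j : prr j \oc inn i = \sum_l (delta F (t l) j \oc delta F i (t l)).
  rewrite /prr comp_suml; apply: eq_bigr => l _.
  rewrite /inn -compA comp_sumr (bigD1 l) //= big1 ?addr0.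
    by rewrite [ds_pr D l \oc _]compA prin delta_id comp1m.
  move=> l' nl; rewrite compA prin delta_neq ?comp0l //.
  by rewrite (inj_eq t_inj).
apply: (@DSum _ _ _ s inn prr) => //.
- move=> i; rewrite prinn.
  case: (boolP (i \in s)) => [si|/sP zi]; last first.
    by rewrite [RHS]zi; exact: zero_domE.
  have lt_i : (index i s < size s)%N by rewrite index_mem.
  have ti : t (Ordinal lt_i) = i by rewrite /t (tnth_nth i) /= nth_index.
  rewrite (bigD1 (Ordinal lt_i)) //= big1 ?addr0.
    by rewrite ti !delta_id comp1m.
  move=> l nl; rewrite delta_comp; case: eqP => // itl.
  by case/eqP: nl; apply: t_inj; rewrite ti.
- move=> i j nij; rewrite prinn big1 // => l _.
  by rewrite delta_comp delta_neq // if_same.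
- rewrite -(ds_sum D).
  transitivity (\sum_l (inn (t l) \oc prr (t l))).
    by rewrite [LHS](big_tnth _ _ s).
  have innt l : inn (t l) = ds_in D l.
    rewrite /inn (bigD1 l) //= delta_id compm1 big1 ?addr0 // => l' nl.
    by rewrite delta_neq ?comp0r // (inj_eq t_inj) eq_sym.
  have prrt l : prr (t l) = ds_pr D l.
    rewrite /prr (bigD1 l) //= delta_id comp1m big1 ?addr0 // => l' nl.
    by rewrite delta_neq ?comp0l // (inj_eq t_inj).
  have supp l : l \notin ds_supp D -> ds_in D l = 0.
    move=> nl; rewrite -[ds_in D l]comp1m -(ds_sum D) comp_suml.
    rewrite big_seq big1 // => l' l'D; rewrite -compA (ds_prin0 D) ?comp0r //.
    by apply: contraNneq nl => ->.
  under eq_bigr => l _ do rewrite innt prrt.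
  rewrite (bigID (mem (ds_supp D))) /= [X in _ + X]big1 ?addr0; last first.
    by move=> l /supp->; rewrite comp0l.
  by rewrite -big_uniq ?(ds_uniq D).
Qed.

Section DSumMap.
Variables (I J : eqType) (F : I -> C) (G : J -> C) (S T : C).
Variables (DF : dsum F S) (DG : dsum G T).

Definition dsum_map (M : forall i j, hom (F i) (G j)) : hom S T :=
  \sum_(i <- ds_supp DF) \sum_(j <- ds_supp DG)
    (ds_in DG j \oc M i j \oc ds_pr DF i).
End DSumMap.

Lemma ds_supp_zero (I : eqType) (F : I -> C) (S : C) (D : dsum F S) i :
  i \notin ds_supp D -> is_zero (F i).
Proof.
move=> ni; have in0 : ds_in D i = 0.
  rewrite -[ds_in D i]comp1m -(ds_sum D) comp_suml.
  rewrite big_seq big1 // => j jD; rewrite -compA (ds_prin0 D) ?comp0r //.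
  by apply: contraNneq ni => ->.
by rewrite /is_zero -(ds_prin D) in0 comp0r.
Qed.

Lemma dsum_map_comp (I J K : eqType) (F : I -> C) (G : J -> C) (H : K -> C)
    (S T U : C) (DF : dsum F S) (DG : dsum G T) (DH : dsum H U)
    (M : forall i j, hom (F i) (G j)) (N : forall j l, hom (G j) (H l)) :
  dsum_map DG DH N \oc dsum_map DF DG M =
  dsum_map DF DH (fun i l => \sum_(j <- ds_supp DG) (N j l \oc M i j)).
Proof.
rewrite /dsum_map comp_sumr; apply: eq_bigr => i _.
rewrite comp_suml.
transitivity (\sum_(j <- ds_supp DG) \sum_(l <- ds_supp DH)
   (ds_in DH l \oc (N j l \oc M i j) \oc ds_pr DF i)); last first.
  rewrite exchange_big; apply: eq_bigr => l _ /=.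
  by rewrite comp_sumr comp_suml.
apply: eq_big_seq => j js; rewrite comp_suml; apply: eq_bigr => l _.
rewrite comp_sumr (bigD1_seq j) ?ds_uniq //= big1_seq ?addr0.
  rewrite !compA -[X in X \oc _ \oc _]compA ds_prin compm1.
  by rewrite -!compA.
move=> j' /andP[nj _]; rewrite !compA -[X in X \oc _ \oc _]compA.
by rewrite ds_prin0 // comp0r !comp0l.
Qed.

Lemma dsum_map_id (I : eqType) (F : I -> C) (S : C) (D : dsum F S) :
  dsum_map D D (delta F) = idm S.
Proof.
rewrite -(ds_sum D); apply: eq_big_seq => i iD.
rewrite (bigD1_seq i) ?ds_uniq //= big1_seq ?addr0 ?delta_id ?compm1 //.
by move=> j /andP[nj _]; rewrite delta_neq ?comp0r ?comp0l // eq_sym.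
Qed.

Lemma eq_dsum_map (I J : eqType) (F : I -> C) (G : J -> C) (S T : C)
    (DF : dsum F S) (DG : dsum G T) (M N : forall i j, hom (F i) (G j)) :
  (forall i j, i \in ds_supp DF -> j \in ds_supp DG -> M i j = N i j) ->
  dsum_map DF DG M = dsum_map DF DG N.
Proof.
by move=> MN; apply: eq_big_seq => i iF; apply: eq_big_seq => j jG; rewrite MN.
Qed.

Lemma dsum_map_lin (I J : eqType) (F : I -> C) (G : J -> C) (S T : C)
    (DF : dsum F S) (DG : dsum G T) a (M N : forall i j, hom (F i) (G j)) :
  dsum_map DF DG (fun i j => a *: M i j + N i j) =
  a *: dsum_map DF DG M + dsum_map DF DG N.
Proof.
rewrite /dsum_map scaler_sumr -big_split; apply: eq_bigr => i _ /=.
rewrite scaler_sumr -big_split; apply: eq_bigr => j _ /=.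
by rewrite comp_linr comp_linl.
Qed.

Lemma dsum_map0 (I J : eqType) (F : I -> C) (G : J -> C) (S T : C)
    (DF : dsum F S) (DG : dsum G T) (M : forall i j, hom (F i) (G j)) :
  (forall i j, M i j = 0) -> dsum_map DF DG M = 0.
Proof.
by move=> M0; rewrite /dsum_map !big1 // => i _; rewrite big1 // => j _;
   rewrite M0 comp0r comp0l.
Qed.

Section DSumDiag.
Variables (I : eqType) (F G : I -> C) (f : forall i, hom (F i) (G i)).

Definition diag_mx i j : hom (F i) (G j) := delta G i j \oc f i.

Lemma diag_mxE i j : diag_mx i j = f j \oc delta F i j.
Proof.
rewrite /diag_mx; case: (eqVneq i j) => [->|nij].
  by rewrite !delta_id comp1m compm1.
by rewrite !delta_neq // comp0l comp0r.
Qed.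

End DSumDiag.

Section DiagMul.
Variables (I J : eqType) (F G : I -> C) (H : J -> C).
Variables (S T U : C) (DF : dsum F S) (DG : dsum G T) (DH : dsum H U).

Lemma dsum_map_diagr (M : forall i j, hom (G i) (H j))
    (f : forall i, hom (F i) (G i)) :
  dsum_map DG DH M \oc dsum_map DF DG (diag_mx f) =
  dsum_map DF DH (fun i j => M i j \oc f i).
Proof.
rewrite dsum_map_comp; apply: eq_dsum_map => i j _ _.
case: (boolP (i \in ds_supp DG)) => iG.
  rewrite (bigD1_seq i) ?ds_uniq //= big1_seq ?addr0.
    by rewrite /diag_mx delta_id comp1m.
  by move=> l /andP[nl _]; rewrite /diag_mx delta_neq ?comp0l ?comp0r // eq_sym.
have -> : f i = 0 by apply: zero_codE; exact: ds_supp_zero iG.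
rewrite comp0r big1_seq // => l lG.
by rewrite /diag_mx delta_neq ?comp0l ?comp0r //; apply: contraNneq iG => ->.
Qed.
End DiagMul.

Section DiagMulL.
Variables (I J : eqType) (H : J -> C) (F G : I -> C).
Variables (S T U : C) (DF : dsum F S) (DG : dsum G T) (DH : dsum H U).

Lemma dsum_map_diagl (M : forall i j, hom (H i) (F j))
    (f : forall i, hom (F i) (G i)) :
  dsum_map DF DG (diag_mx f) \oc dsum_map DH DF M =
  dsum_map DH DG (fun i j => f j \oc M i j).
Proof.
rewrite dsum_map_comp; apply: eq_dsum_map => i j _ _.
case: (boolP (j \in ds_supp DF)) => jF.
  rewrite (bigD1_seq j) ?ds_uniq //= big1_seq ?addr0.
    by rewrite /diag_mx delta_id comp1m.
  by move=> l /andP[nl _]; rewrite /diag_mx delta_neq ?comp0l.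
have -> : f j = 0 by apply: zero_domE; exact: ds_supp_zero jF.
rewrite comp0l big1_seq // => l lF.
by rewrite /diag_mx delta_neq ?comp0l //; apply: contraNneq jF => <-.
Qed.
End DiagMulL.

Record sseq := SSeq {
  s_fst : C; s_mid : C; s_lst : C;
  s_f : hom s_fst s_mid;
  s_g : hom s_mid s_lst
}.

Definition sseq_iso (E E' : sseq) : Prop :=
  exists (a : hom (s_fst E) (s_fst E')) (b : hom (s_mid E) (s_mid E'))
         (c : hom (s_lst E) (s_lst E')),
    [/\ is_iso a, is_iso b, is_iso c,
        b \oc s_f E = s_f E' \oc a & c \oc s_g E = s_g E' \oc b].

Definition split_exact (E : sseq) : Prop :=
  s_g E \oc s_f E = 0 /\
  exists (r : hom (s_mid E) (s_fst E)) (s : hom (s_lst E) (s_mid E)),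
    [/\ r \oc s_f E = idm _, s_g E \oc s = idm _
      & s_f E \oc r + s \oc s_g E = idm _].

Definition section X Y (f : hom X Y) : Prop :=
  exists r : hom Y X, r \oc f = idm X.

Definition retraction X Y (f : hom X Y) : Prop :=
  exists s : hom Y X, f \oc s = idm Y.

Definition left_almost_split X Y (f : hom X Y) : Prop :=
  ~ section f /\
  forall (W : C) (h : hom X W), ~ section h -> exists u : hom Y W, u \oc f = h.

Definition left_minimal X Y (f : hom X Y) : Prop :=
  forall u : hom Y Y, u \oc f = f -> is_iso u.

Definition right_almost_split Y Z (g : hom Y Z) : Prop :=
  ~ retraction g /\
  forall (W : C) (h : hom W Z), ~ retraction h -> exists u : hom W Y, g \oc u = h.

Definition right_minimal Y Z (g : hom Y Z) : Prop :=
  forall u : hom Y Y, g \oc u = g -> is_iso u.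

Definition almost_split_sequence (conflation : sseq -> Prop) (E : sseq) : Prop :=
  [/\ conflation E,
      left_minimal (s_f E), left_almost_split (s_f E),
      right_minimal (s_g E) & right_almost_split (s_g E)].

End KCatTheory.

Section Subcategories.
Variables (k : comPzRingType) (C : kcat k).

Definition fullsub (P : C -> Prop) : kcat k.
Proof.
refine (@KCat k {X : C | P X} (fun X Y => hom (sval X) (sval Y))
          (fun X => idm (sval X))
          (fun X Y Z => @comp k C (sval X) (sval Y) (sval Z)) _ _ _ _ _).
- by move=> *; exact: comp1m.
- by move=> *; exact: compm1.
- by move=> *; exact: compA.
- by move=> *; exact: comp_linl.
- by move=> *; exact: comp_linr.
Defined.

Definition incl (P : C -> Prop) : kfunctor (fullsub P) C :=
  @KFunctor k (fullsub P) C (fun X => sval X) (fun X Y f => f)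
    (fun=> erefl) (fun _ _ _ _ _ => erefl) (fun _ _ _ _ _ => erefl).

Definition opcat : kcat k.
Proof.
refine (@KCat k C (fun X Y => hom Y X) (fun X => idm X)
          (fun X Y Z g f => @comp k C Z Y X f g) _ _ _ _ _).
- by move=> *; exact: compm1.
- by move=> *; exact: comp1m.
- by move=> *; rewrite compA.
- by move=> *; exact: comp_linr.
- by move=> *; exact: comp_linl.
Defined.

End Subcategories.

Definition map_sseq (k : comPzRingType) (C D : kcat k) (Phi : kfunctor C D)
    (E : sseq C) : sseq D :=
  SSeq (fmap Phi (s_f E)) (fmap Phi (s_g E)).

Section Modules.
Variable k : comPzRingType.

Definition lin (U V : lmodType k) : Type := {linear U -> V}.

Section LinModule.
Variables U V : lmodType k.

Definition lin_app (f : lin U V) : U -> V := (f : {linear U -> V}).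

Lemma linext (f g : lin U V) : lin_app f =1 lin_app g -> f = g.
Proof.
rewrite /lin_app; case: f g => [f [[fD] [fZ]]] [g [[gD] [gZ]]] /= /funext fg.
case: _ / fg in gD gZ *.
by rewrite (Prop_irrelevance fD gD) (Prop_irrelevance fZ gZ).
Qed.

Definition mklin_fun (f : U -> V) (h : linear f) : U -> V := f.
HB.instance Definition _ (f : U -> V) (h : linear f) :=
  GRing.isLinear.Build k U V _ (mklin_fun h) h.
Definition mklin (f : U -> V) (h : linear f) : lin U V :=
  (mklin_fun h : {linear U -> V}).

Lemma linearP_lin (f : lin U V) : linear (lin_app f).
Proof. exact: (@linearP k U V _ (f : {linear U -> V})). Qed.

Lemma lin0_subproof : linear ((fun=> 0) : U -> V).
Proof. by move=> a u v; rewrite scaler0 addr0. Qed.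
Lemma linN_subproof (f : lin U V) : linear (fun u => - lin_app f u).
Proof. by move=> a u v; rewrite linearP_lin opprD scalerN. Qed.
Lemma linD_subproof (f g : lin U V) : linear (fun u => lin_app f u + lin_app g u).
Proof. by move=> a u v; rewrite !linearP_lin scalerDr addrACA. Qed.
Lemma linZ_subproof (b : k) (f : lin U V) : linear (fun u => b *: lin_app f u).
Proof. by move=> a u v; rewrite !linearP_lin scalerDr !scalerA mulrC. Qed.

HB.instance Definition _ := gen_eqMixin (lin U V).
HB.instance Definition _ := gen_choiceMixin (lin U V).

Fact lin_addA : associative (fun f g : lin U V => mklin (linD_subproof f g)).
Proof. by move=> f g h; apply: linext => u; exact: addrA. Qed.
Fact lin_addC : commutative (fun f g : lin U V => mklin (linD_subproof f g)).
Proof. by move=> f g; apply: linext => u; exact: addrC. Qed.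
Fact lin_add0 : left_id (mklin lin0_subproof)
  (fun f g : lin U V => mklin (linD_subproof f g)).
Proof. by move=> f; apply: linext => u; exact: add0r. Qed.
Fact lin_addN : left_inverse (mklin lin0_subproof)
  (fun f : lin U V => mklin (linN_subproof f))
  (fun f g : lin U V => mklin (linD_subproof f g)).
Proof. by move=> f; apply: linext => u; exact: addNr. Qed.

HB.instance Definition _ :=
  GRing.isZmodule.Build (lin U V) lin_addA lin_addC lin_add0 lin_addN.

Fact lin_scaleA a b (f : lin U V) :
  mklin (linZ_subproof a (mklin (linZ_subproof b f))) =
  mklin (linZ_subproof (a * b) f).
Proof. by apply: linext => u; exact: scalerA. Qed.
Fact lin_scale1 : left_id 1 (fun a (f : lin U V) => mklin (linZ_subproof a f)).
Proof. by move=> f; apply: linext => u; exact: scale1r. Qed.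
Fact lin_scaleDr :
  right_distributive (fun a (f : lin U V) => mklin (linZ_subproof a f)) +%R.
Proof. by move=> a f g; apply: linext => u; exact: scalerDr. Qed.
Fact lin_scaleDl (f : lin U V) :
  {morph (fun a => mklin (linZ_subproof a f)) : a b / a + b}.
Proof. by move=> a b; apply: linext => u; exact: scalerDl. Qed.

HB.instance Definition _ := GRing.Zmodule_isLmodule.Build k (lin U V)
  lin_scaleA lin_scale1 lin_scaleDr lin_scaleDl.

End LinModule.

Definition lin_id (U : lmodType k) : lin U U := @idfun U : {linear U -> U}.
Definition lin_comp (U V W : lmodType k) (g : lin V W) (f : lin U V) : lin U W :=
  (g : {linear V -> W}) \o (f : {linear U -> V}).

Fact lin_comp_linl (U V W : lmodType k) (a : k) (g g' : lin V W) (f : lin U V) :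
  lin_comp (a *: g + g') f = a *: lin_comp g f + lin_comp g' f.
Proof. by apply: linext. Qed.

Fact lin_comp_linr (U V W : lmodType k) (a : k) (g : lin V W) (f f' : lin U V) :
  lin_comp g (a *: f + f') = a *: lin_comp g f + lin_comp g f'.
Proof. by apply: linext => u; exact: linearP_lin. Qed.

Definition Modk : kcat k.
Proof.
refine (@KCat k (lmodType k) (fun U V => lin U V) lin_id lin_comp
          _ _ _ lin_comp_linl lin_comp_linr).
- by move=> *; apply: linext.
- by move=> *; apply: linext.
- by move=> *; apply: linext.
Defined.

Definition submodule (V : lmodType k) (P : V -> Prop) : Prop :=
  P 0 /\ forall (a : k) (u v : V), P u -> P v -> P (a *: u + v).

(* [V] has a composition series [0 = P 0 < P 1 < ... < P n = V]. *)
Definition finite_length (V : lmodType k) : Prop :=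
  exists (n : nat) (P : nat -> V -> Prop),
  [/\ forall i, submodule (P i),
      forall v, P 0%N v <-> v = 0,
      forall v, P n v
    & forall i, (i < n)%N ->
      [/\ forall v, P i v -> P i.+1 v,
          exists v, P i.+1 v /\ ~ P i v
        & forall Q : V -> Prop, submodule Q ->
            (forall v, P i v -> Q v) -> (forall v, Q v -> P i.+1 v) ->
            (forall v, Q v <-> P i v) \/ (forall v, Q v <-> P i.+1 v)]].

Definition injective_module (J : lmodType k) : Prop :=
  forall (U V : lmodType k) (i : {linear U -> V}) (f : {linear U -> J}),
    injective i -> exists g : {linear V -> J}, forall u, g (i u) = f u.

Definition maximal_ideal (m : k -> Prop) : Prop :=
  [/\ submodule (m : k^o -> Prop), ~ m 1
    & forall n : k -> Prop, submodule (n : k^o -> Prop) ->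
        (forall a, m a -> n a) -> ~ n 1 -> forall a, n a -> m a].

(* [J] is an injective envelope of the direct sum of the simple modules [k/m],
   [m] a maximal ideal.  The copy of [k/m] in [J] is generated by [e m]; the sum
   of these submodules is automatically direct, as they are simple and pairwise
   nonisomorphic, and the last clause says that it is essential in [J].  For [k]
   artinian (or semilocal) this is the injective envelope of [k / rad k]. *)
Definition minimal_injective_cogenerator (J : lmodType k) : Prop :=
  injective_module J /\
  exists e : (k -> Prop) -> J,
    (forall m, maximal_ideal m -> forall a : k, a *: e m = 0 <-> m a) /\
    forall x : J, x <> 0 -> exists a : k, a *: x <> 0 /\
      exists (r : nat) (m : 'I_r -> k -> Prop) (c : 'I_r -> k),
        (forall i, maximal_ideal (m i)) /\ a *: x = \sum_i c i *: e (m i).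

End Modules.

Arguments lin_app {k U V} f.

Section ModA.
Variables (k : comPzRingType) (A : kcat k).

Definition hom_finite : Prop := forall X Y : A, finite_length (hom X Y).

Definition ModA : Type := kfunctor (opcat A) (Modk k).

Record nat_trans (F G : ModA) := NatTrans {
  nt : forall X : A, lin (F X) (G X);
  ntP : forall (X Y : A) (u : hom X Y) (y : F Y),
    lin_app (nt X) (lin_app (fmap F (u : @hom _ (opcat A) Y X)) y) =
    lin_app (fmap G (u : @hom _ (opcat A) Y X)) (lin_app (nt Y) y)
}.

Definition nt_app (F G : ModA) (eta : nat_trans F G) (X : A) (x : F X : lmodType k)
  : (G X : lmodType k) := lin_app (nt eta X) x.

Definition nt_mono (F G : ModA) (eta : nat_trans F G) : Prop :=
  forall X, injective (@nt_app F G eta X).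

Definition nt_epi (F G : ModA) (eta : nat_trans F G) : Prop :=
  forall X (y : (G X : lmodType k)), exists x, @nt_app F G eta X x = y.

Definition nt_exact (F G H : ModA) (eta : nat_trans F G) (theta : nat_trans G H)
    : Prop :=
  forall X (y : (G X : lmodType k)),
    nt_app theta y = 0 <-> exists x, @nt_app F G eta X x = y.

Definition yoneda_map (X Y Z : A) (u : hom Z Y) : lin (hom Y X) (hom Z X) :=
  mklin (fun a f g => comp_linl a f g u : (a *: f + g) \oc u = _).

Definition yoneda (X : A) : ModA.
Proof.
refine (@KFunctor k (opcat A) (Modk k) (fun Y : A => hom Y X)
          (fun (Y Z : A) (u : hom Z Y) => yoneda_map X u) _ _ _).
- by move=> Y; apply: linext => f; exact: compm1.
- by move=> Y Z W v u; apply: linext => f; exact: compA.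
- by move=> Y Z a u v; apply: linext => f; exact: comp_linr.
Defined.

Variable J : lmodType k.

(* [D A(X, -)], where [D = Hom_k(-, J)] *)
Definition dyoneda_map (X Y Z : A) (u : hom Z Y) :
  lin (lin (hom X Y) J) (lin (hom X Z) J).
Proof.
apply: (@mklin k (lin (hom X Y) J) (lin (hom X Z) J)
  (fun phi => lin_comp phi (mklin (fun a f g => comp_linr a u f g)))).
by move=> a phi psi; exact: lin_comp_linl.
Defined.

Definition dyoneda (X : A) : ModA.
Proof.
refine (@KFunctor k (opcat A) (Modk k) (fun Y : A => lin (hom X Y) J)
          (fun (Y Z : A) (u : hom Z Y) => dyoneda_map X u) _ _ _).
- move=> Y; apply: linext => phi; apply: linext => f.
  exact: (congr1 (lin_app phi) (comp1m (f : @hom k A X Y))).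
- move=> Y Z W v u; apply: linext => phi; apply: linext => f.
  exact: (congr1 (lin_app phi) (esym (compA (u : @hom k A Z Y)
            (v : @hom k A W Z) (f : @hom k A X W)))).
- move=> Y Z a u v; apply: linext => phi; apply: linext => f.
  transitivity (lin_app phi (a *: ((u : @hom k A Z Y) \oc (f : @hom k A X Z)) +
                  ((v : @hom k A Z Y) \oc (f : @hom k A X Z)))).
    exact: (congr1 (lin_app phi) (comp_linl _ _ _ _)).
  exact: linearP_lin.
Defined.

Definition finitely_presented (F : ModA) : Prop :=
  exists (X Y : A) (alpha : nat_trans (yoneda X) (yoneda Y))
         (pi : nat_trans (yoneda Y) F),
    nt_epi pi /\ nt_exact alpha pi.

Definition finitely_copresented (F : ModA) : Prop :=
  exists (X Y : A) (iota : nat_trans F (dyoneda X))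
         (beta : nat_trans (dyoneda X) (dyoneda Y)),
    nt_mono iota /\ nt_exact iota beta.

Definition dualizing : Prop :=
  forall F : ModA, finitely_presented F <-> finitely_copresented F.

(* Kernels and cokernels in [mod A] ([A] dualizing) are computed pointwise, so
   epimorphisms and exact sequences of [mod A] are the pointwise ones. *)
Definition mod_projective (P : ModA) : Prop :=
  finitely_presented P /\
  forall (F G : ModA) (p : nat_trans F G) (f : nat_trans P G),
    finitely_presented F -> finitely_presented G -> nt_epi p ->
    exists h : nat_trans P F,
      forall X x, nt_app p (@nt_app P F h X x) = nt_app f x.

(* [F] has a projective resolution in [mod A] of length at most [d]. *)
Fixpoint pd_le (d : nat) (F : ModA) : Prop :=
  match d with
  | 0%N => mod_projective F
  | d'.+1 => exists (K P : ModA) (i : nat_trans K P) (p : nat_trans P F),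
      [/\ pd_le d' K, mod_projective P, nt_mono i, nt_epi p & nt_exact i p]
  end.

Definition finite_global_dimension : Prop :=
  exists d : nat, forall F : ModA, finitely_presented F -> pd_le d F.

End ModA.

Section Complexes.
Variables (k : comPzRingType) (A : kcat k).

(* Complexes graded by a ring [I] (below, [int] or ['Z_m]), with differential of
   degree 1.  To avoid transporting along equalities of indices, the
   differential is a matrix [d i j : X i -> X j] which is zero unless
   [j = i + 1]. *)
Record cplx (I : nzRingType) := Cplx {
  cx :> I -> A;
  cd : forall i j : I, hom (cx i) (cx j);
  cd_shape : forall i j : I, j != i + 1 -> cd i j = 0;
  cd_cd : forall i j l : I, cd j l \oc cd i j = 0
}.

Arguments cd {I} c i j.

Record cmap (I : nzRingType) (X Y : cplx I) := CMap {
  cm :> forall i : I, hom (X i) (Y i);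
  cmP : forall i j : I, cd Y i j \oc cm i = cm j \oc cd X i j
}.

Section CMapModule.
Variables (I : nzRingType) (X Y : cplx I).
Implicit Types f g : cmap X Y.

Lemma cmext f g : (forall i, f i = g i) -> f = g.
Proof.
case: f g => [f fP] [g gP] /= fg0.
have {fg0}fg : f = g by exact: functional_extensionality_dep.
by case: _ / fg in gP *; rewrite (Prop_irrelevance fP gP).
Qed.

HB.instance Definition _ := gen_eqMixin (cmap X Y).
HB.instance Definition _ := gen_choiceMixin (cmap X Y).

Definition cmap0 : cmap X Y.
Proof. by exists (fun=> 0) => i j; rewrite comp0l comp0r. Defined.
Definition cmapD f g : cmap X Y.
Proof. by exists (fun i => f i + g i) => i j; rewrite compDl compDr !cmP. Defined.
Definition cmapZ (a : k) f : cmap X Y.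
Proof. by exists (fun i => a *: f i) => i j; rewrite compZl compZr cmP. Defined.
Definition cmapN f : cmap X Y.
Proof.
exists (fun i => - f i) => i j.
by rewrite -!scaleN1r compZl compZr cmP.
Defined.

Fact cmapDA : associative cmapD.
Proof. by move=> f g h; apply: cmext => i; exact: addrA. Qed.
Fact cmapDC : commutative cmapD.
Proof. by move=> f g; apply: cmext => i; exact: addrC. Qed.
Fact cmap0D : left_id cmap0 cmapD.
Proof. by move=> f; apply: cmext => i; exact: add0r. Qed.
Fact cmapND : left_inverse cmap0 cmapN cmapD.
Proof. by move=> f; apply: cmext => i; exact: addNr. Qed.

HB.instance Definition _ :=
  GRing.isZmodule.Build (cmap X Y) cmapDA cmapDC cmap0D cmapND.

Fact cmapZA a b f : cmapZ a (cmapZ b f) = cmapZ (a * b) f.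
Proof. by apply: cmext => i; exact: scalerA. Qed.
Fact cmapZ1 : left_id 1 cmapZ.
Proof. by move=> f; apply: cmext => i; exact: scale1r. Qed.
Fact cmapZDr : right_distributive cmapZ +%R.
Proof. by move=> a f g; apply: cmext => i; exact: scalerDr. Qed.
Fact cmapZDl f : {morph cmapZ^~ f : a b / a + b}.
Proof. by move=> a b; apply: cmext => i; exact: scalerDl. Qed.

HB.instance Definition _ := GRing.Zmodule_isLmodule.Build k (cmap X Y)
  cmapZA cmapZ1 cmapZDr cmapZDl.

End CMapModule.

Section ComplexCat.
Variable I : nzRingType.

Definition cmap_id (X : cplx I) : cmap X X.
Proof. by exists (fun i => idm (X i)) => i j; rewrite compm1 comp1m. Defined.

Definition cmap_comp (X Y Z : cplx I) (g : cmap Y Z) (f : cmap X Y) : cmap X Z.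
Proof.
exists (fun i => g i \oc f i) => i j.
by rewrite compA cmP -compA cmP compA.
Defined.

Definition CplxCat : kcat k.
Proof.
refine (@KCat k (cplx I) (fun X Y => cmap X Y) cmap_id cmap_comp _ _ _ _ _).
- by move=> *; apply: cmext => i; exact: comp1m.
- by move=> *; apply: cmext => i; exact: compm1.
- by move=> *; apply: cmext => i; exact: compA.
- by move=> *; apply: cmext => i; exact: comp_linl.
- by move=> *; apply: cmext => i; exact: comp_linr.
Defined.

Definition deg_sseq (i : I) (E : sseq CplxCat) : sseq A :=
  SSeq ((s_f E : cmap _ _) i) ((s_g E : cmap _ _) i).

Definition degreewise_split (E : sseq CplxCat) : Prop :=
  forall i : I, split_exact (deg_sseq i E).

End ComplexCat.

Definition bounded (X : cplx int) : Prop :=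
  exists a b : int, forall i : int, ~~ (a <= i <= b) -> is_zero (X i).

Definition Cb : kcat k := fullsub (C := CplxCat int) bounded.

Definition concentrated (n : nat) (X : Cb) : Prop :=
  forall i : int, ~~ (1 <= i <= n%:Z) -> is_zero (sval X i).

Definition C1n (n : nat) : kcat k := fullsub (concentrated n).

(* A family indexed by [int] that only depends on the residue class modulo [m] is
   a family indexed by ['Z_m] (used for [1 < m] only). *)
Definition Cper (m : nat) : kcat k := CplxCat 'Z_m.

Definition Cb_conflation (E : sseq Cb) : Prop :=
  degreewise_split (map_sseq (incl (C := CplxCat int) bounded) E).

Definition C1n_conflation (n : nat) (E : sseq (C1n n)) : Prop :=
  Cb_conflation (map_sseq (incl (concentrated n)) E).

Definition Cper_conflation (m : nat) (E : sseq (Cper m)) : Prop :=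
  degreewise_split E.

Section Shift.
Variable t : int.

Definition shift_cplx (X : cplx int) : cplx int.
Proof.
exists (fun i => X (i + t))
       (fun i j => (-1) ^+ `|t|%N *: cd X (i + t) (j + t)) => [i j nij|i j l].
  by rewrite cd_shape ?scaler0 // addrAC (inj_eq (addIr t)).
by rewrite compZl compZr cd_cd !scaler0.
Defined.

Definition shift_map (X Y : cplx int) (f : cmap X Y) :
  cmap (shift_cplx X) (shift_cplx Y).
Proof. by exists (fun i => f (i + t)) => i j /=; rewrite compZl compZr cmP. Defined.

Lemma shift_bounded (X : cplx int) : bounded X -> bounded (shift_cplx X).
Proof.
move=> [a [b abX]]; exists (a - t), (b - t) => i ni; apply: abX.
by apply: contraNN ni; lia.
Qed.

Definition shift : kfunctor Cb Cb.
Proof.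
refine (@KFunctor k Cb Cb
  (fun X => exist bounded (shift_cplx (sval X)) (shift_bounded (proj2_sig X)))
  (fun X Y f => shift_map f) _ _ _).
- by move=> X; apply: cmext.
- by move=> X Y Z g f; apply: cmext.
- by move=> X Y a f g; apply: cmext.
Defined.

End Shift.

Section Compression.
Variables (m : nat) (m_gt1 : (1 < m)%N) (addA : additive_cat A).

(* [X^(c + tm)], where [c] is the representative of its class in [0, m) *)
Definition cidx (c : 'Z_m) (t : int) : int := (c : nat)%:Z + t * m%:Z.

Lemma compr_fin_supp (X : Cb) (c : 'Z_m) :
  fin_supp (fun t : int => sval X (cidx c t)).
Proof.
have [a [b abX]] := proj2_sig X.
pose N := (`|a| + `|b| + c)%N.
exists ([seq i%:Z | i <- iota 0 N.+1] ++ [seq - i%:Z | i <- iota 0 N.+1]) => t.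
rewrite mem_cat negb_or => /andP[tp tn]; apply: abX.
have tN : (N < `|t|)%N.
  rewrite ltnNge; apply/negP => tN.
  have [t0|t0] := lerP 0 t.
    by case/mapP: tp; exists `|t|%N; rewrite ?mem_iota ?ltnS //; lia.
  by case/mapP: tn; exists `|t|%N; rewrite ?mem_iota ?ltnS //; lia.
rewrite /cidx; apply/negP => /andP[lea leb].
have : (absz t <= absz ((t : int) * m%:Z)%R)%N
  by rewrite abszM leq_pmulr //=; lia.
by move: (t * m%:Z) lea leb => s; rewrite /N in tN *; lia.
Qed.

Definition compr_ob (X : Cb) (c : 'Z_m) : A :=
  projT1 (cid (dsum_ex addA (compr_fin_supp X c))).

Definition compr_dsum (X : Cb) (c : 'Z_m) :
    dsum (fun t : int => sval X (cidx c t)) (compr_ob X c) :=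
  projT1 (cid (let: exI := projT2 (cid (dsum_ex addA (compr_fin_supp X c))) in
    match exI return exists _ : dsum _ (compr_ob X c), True with
    | inhabits D => ex_intro _ D I
    end)).

Lemma cidx_succ (c c' : 'Z_m) (s t : int) :
  cidx c' t = cidx c s + 1 -> c' = c + 1.
Proof.
rewrite /cidx => /(congr1 (fun z : int => z%:~R : 'Z_m)).
rewrite !(intrD, intrM) -!pmulrn.
have -> : (m%:R : 'Z_m) = 0 by exact: pchar_Zp.
by rewrite !mulr0 !addr0 !natr_Zp.
Qed.

(* The component [X^(c + sm) -> X^(c' + tm)] of the differential is that of [X];
   it is zero unless [c' + tm = c + sm + 1]. *)
Definition compr_cplx (X : Cb) : cplx 'Z_m.
Proof.
exists (compr_ob X)
  (fun c c' => dsum_map (compr_dsum X c) (compr_dsum X c')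
                 (fun s t => cd (sval X) (cidx c s) (cidx c' t)))
  => [c c' ncc'|c c' c''].
  apply: dsum_map0 => s t; apply: cd_shape; apply: contraNneq ncc'.
  by move/cidx_succ->.
rewrite dsum_map_comp; apply: dsum_map0 => s t.
by rewrite big1 // => u _; exact: cd_cd.
Defined.

Definition compr_map (X Y : Cb) (f : cmap (sval X) (sval Y)) :
  cmap (compr_cplx X) (compr_cplx Y).
Proof.
exists (fun c => dsum_map (compr_dsum X c) (compr_dsum Y c)
                   (diag_mx (fun t => f (cidx c t)))) => c c' /=.
rewrite dsum_map_diagr dsum_map_diagl; apply: eq_dsum_map => s t _ _.
exact: cmP.
Defined.

Definition compression : kfunctor Cb (Cper m).
Proof.
refine (@KFunctor k Cb (Cper m) compr_cplx compr_map _ _ _).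
- move=> X; apply: cmext => c /=; rewrite -(dsum_map_id (compr_dsum X c)).
  by apply: eq_dsum_map => s t _ _; rewrite /diag_mx compm1.
- move=> X Y Z g f; apply: cmext => c /=; rewrite dsum_map_diagl.
  by apply: eq_dsum_map => s t _ _; rewrite !diag_mxE compA.
- move=> X Y a f g; apply: cmext => c /=; rewrite -dsum_map_lin.
  by apply: eq_dsum_map => s t _ _; rewrite /diag_mx comp_linr.
Defined.

End Compression.

End Complexes.

(* Main.v *)
Require Import Defs.
From HB Require Import structures.
From mathcomp Require Import all_boot all_order all_algebra.
From mathcomp Require Import boolp zify.
Import Defs.

(** The statement is about classes of extensions. A conflation of complexes with end
    terms [X] and [Z] splits in each degree, and is determined by its class, a cocycle
    of degree 1 from [Z] to [X] modulo coboundaries ([cone_ex], [x_cls_morph_ex]). It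
    is almost split when [X] and [Z] are local and the class is not a coboundary, but
    becomes one when it is pulled back along a map to [Z] that is not a retraction, or
    pushed forward along a map from [X] that is not a section ([almost_split_class]).

    Objects. Compression has a two-sided adjoint, the unrolling of an [m]-periodic
    complex to a complex graded by the integers ([compression_lift],
    [compression_colift]). Indecomposable bounded complexes are shifts of complexes in
    the degrees from 1 to [n], so they live in at most [n] consecutive degrees, and a
    summand of a large finite piece of an unrolled complex that stays away from the
    cuts is a summand of the unrolled complex itself. Hence every local periodic
    complex is the compression of an indecomposable bounded complex
    ([compression_dense]). This uses that an endomorphism of the compression of [B]
    which is the identity on [B] is invertible ([compression_endo_iso]): different
    shifts of [B] are not isomorphic, so its matrix is unipotent modulo the radical.

    Sequences. Let the end terms of an almost split sequence of periodic complexes be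
    the compressions of [X1] and [Z0]. Its class has components from [Z0] to the shifts
    of [X1] by multiples of [m]. One of them, from [Z0] to some [X0], is not a
    coboundary ([nonzero_component]), and it is an almost split class of bounded
    complexes ([cls_component_almost_split]). As an almost split class determines its
    starting term ([almost_split_class_section]), the other components are
    coboundaries. So the cone of this component, an almost split sequence of bounded
    complexes, has the given sequence as its compression ([component_extension],
    [compression_sequence_iso]).

    The window. It remains to see that [X0] and [Z0] live in a common interval of
    length [n], for then a shift moves the sequence to the degrees from 1 to [n]
    ([shift_into_window]). Each of them is short enough by itself. The top degree of
    [X0] is less than [n] above the bottom degree of [Z0] ([window_above]): the class
    has a representative in the top degree of [X0] only, and is therefore carried by
    the part of the middle term near that degree. The top degree [d] of [Z0] is less
    than [n] above the bottom degree of [X0] ([window_below]): the class factors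
    through the part near [d] of a truncated projective resolution [G] of the cokernel
    of the last differential of [Z0] ([truncated_resolution], [class_factor]), and the
    exactness of [G] would split the resulting extension of [G]. The finite global
    dimension enters here, by providing the weak kernels that [G] is made of
    ([weak_kernels_of_gldim]): a projective resolution of the cokernel of a map between
    representable functors shows that the kernel of this map is finitely generated. *)

Set Implicit Arguments.
Unset Strict Implicit.
Unset Printing Implicit Defensive.

Import Order.TTheory GRing.Theory Num.Theory.
Local Open Scope ring_scope.
Local Open Scope kcat_scope.

(** * Isomorphisms, local objects and the radical *)

Section Generalities.
Variables (k : comPzRingType) (C : kcat k).
Implicit Types X Y Z : C.

Lemma compNl X Y Z (g : hom Y Z) (f : hom X Y) : (- g) \oc f = - (g \oc f).
Proof. by rewrite -!scaleN1r compZl. Qed.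

Lemma compNr X Y Z (g : hom Y Z) (f : hom X Y) : g \oc (- f) = - (g \oc f).
Proof. by rewrite -!scaleN1r compZr. Qed.

Lemma compBl X Y Z (g g' : hom Y Z) (f : hom X Y) :
  (g - g') \oc f = g \oc f - g' \oc f.
Proof. by rewrite compDl compNl. Qed.

Lemma compBr X Y Z (g : hom Y Z) (f f' : hom X Y) :
  g \oc (f - f') = g \oc f - g \oc f'.
Proof. by rewrite compDr compNr. Qed.

Lemma is_iso_id X : is_iso (idm X).
Proof. by exists (idm X); rewrite comp1m. Qed.

Lemma is_iso_comp X Y Z (g : hom Y Z) (f : hom X Y) :
  is_iso g -> is_iso f -> is_iso (g \oc f).
Proof.
case=> g' [g'g gg'] [f' [f'f ff']]; exists (f' \oc g'); split.
  by rewrite compA -(compA f') g'g compm1.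
by rewrite compA -(compA g) ff' compm1.
Qed.

Lemma section_retraction_iso X Y (f : hom X Y) :
  section f -> retraction f -> is_iso f.
Proof.
case=> g gf [h fh]; exists g; split=> //.
by rewrite -{1}(compm1 g) -fh (compA g) gf comp1m fh.
Qed.

Lemma is_iso_section X Y (f : hom X Y) : is_iso f -> section f.
Proof. by case=> g [gf _]; exists g. Qed.

Lemma is_iso_retraction X Y (f : hom X Y) : is_iso f -> retraction f.
Proof. by case=> g [_ fg]; exists g. Qed.

Lemma is_iso_compKl X Y Z (g : hom Y Z) (f : hom X Y) :
  is_iso g -> is_iso (g \oc f) -> is_iso f.
Proof.
case=> g' [g'g gg'] gfiso.
have -> : f = g' \oc (g \oc f) by rewrite compA g'g comp1m.
by apply: is_iso_comp gfiso; exists g.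
Qed.

Lemma is_iso_compKr X Y Z (g : hom Y Z) (f : hom X Y) :
  is_iso f -> is_iso (g \oc f) -> is_iso g.
Proof.
case=> f' [f'f ff'] gfiso.
have -> : g = (g \oc f) \oc f' by rewrite -compA ff' compm1.
by apply: is_iso_comp gfiso _; exists f.
Qed.

Lemma is_zero_retract X Y (i : hom Y X) (p : hom X Y) :
  p \oc i = idm Y -> is_zero X -> is_zero Y.
Proof. by move=> pi zX; rewrite /is_zero -pi (zero_codE i zX) comp0r. Qed.

Lemma is_zero_iso0 X Y (f : hom X Y) : is_iso f -> f = 0 -> is_zero X.
Proof. by case=> g [gf _] f0; rewrite /is_zero -gf f0 comp0r. Qed.

Lemma local_split1 X (a b : hom X X) :
  local_end X -> a + b = idm X -> is_iso a \/ is_iso b.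
Proof.
move=> [_ locX] ab1; case: (pselect (is_iso a)) => [|na]; first by left.
case: (pselect (is_iso b)) => [|nb]; first by right.
by have := locX _ _ na nb; rewrite ab1 => /(_ (is_iso_id X)).
Qed.

Lemma local_idempotent X (e : hom X X) :
  local_end X -> e \oc e = e -> e = 0 \/ e = idm X.
Proof.
move=> locX ee; have [] := @local_split1 X e (idm X - e) locX.
- by rewrite addrC subrK.
- case=> g [ge _]; right.
  by rewrite -[LHS]comp1m -ge -compA ee.
- case=> g [ge _]; left.
  by rewrite -[LHS]comp1m -ge -compA compBl comp1m ee subrr comp0r.
Qed.

Lemma local_retraction X (c : hom X X) : local_end X -> retraction c -> is_iso c.
Proof.
move=> locX [s cs].
have [|sc0|sc1] := local_idempotent (e := s \oc c) locX.
- by rewrite compA -(compA s) cs compm1.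
- case: locX.1; rewrite /is_zero -cs -[c]comp1m -cs -(compA c s c) sc0.
  by rewrite comp0r comp0l.
- by exists s.
Qed.

Lemma local_section X (c : hom X X) : local_end X -> section c -> is_iso c.
Proof.
move=> locX [s sc].
have [|cs0|cs1] := local_idempotent (e := c \oc s) locX.
- by rewrite compA -(compA c) sc compm1.
- case: locX.1; rewrite /is_zero -sc -[s]comp1m -sc -(compA s c s) cs0.
  by rewrite comp0r comp0l.
- by exists s.
Qed.

(** If [w] inverts [1 - g f] then [1 + f w g] inverts [1 - f g]. *)
Lemma jacobson_swap X Y (f : hom X Y) (g : hom Y X) :
  is_iso (idm X - g \oc f) -> is_iso (idm Y - f \oc g).
Proof.
case=> w [wl wr].
have wgf : w \oc g \oc f = w - idm X.
  by rewrite -wl compBr compm1 compA opprB addrC subrK.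
have gfw : g \oc f \oc w = w - idm X.
  by rewrite -wr compBl comp1m opprB addrC subrK.
exists (idm Y + f \oc w \oc g); split.
- rewrite compDl comp1m compBr compm1.
  rewrite !compA -(compA f w g) -(compA f (w \oc g) f) wgf compBr compm1 compBl.
  by rewrite !compA subKr subrK.
- rewrite compDr compm1 compBl comp1m.
  rewrite !compA -(compA f g f) -(compA f (g \oc f) w) gfw compBr compm1 compBl.
  by rewrite subKr subrK.
Qed.

(** The Jacobson radical of the category. *)
Definition radical X Y (f : hom X Y) : Prop :=
  forall g : hom Y X, is_iso (idm X - g \oc f).

Lemma radical0 X Y : radical (0 : hom X Y).
Proof. by move=> g; rewrite comp0r subr0; exact: is_iso_id. Qed.

Lemma radicalD X Y (f f' : hom X Y) : radical f -> radical f' -> radical (f + f').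
Proof.
move=> rf rf' g; have [w [wl wr]] := rf g.
have -> : idm X - g \oc (f + f') =
    (idm X - g \oc f) \oc (idm X - (w \oc g) \oc f').
  by rewrite compBr compm1 !compA wr comp1m compDr opprD addrA.
exact: is_iso_comp (rf g) (rf' _).
Qed.

Lemma radical_sum X Y (T : eqType) (r : seq T) (f : T -> hom X Y) :
  (forall t, t \in r -> radical (f t)) -> radical (\sum_(t <- r) f t).
Proof.
elim: r => [|t r IH] rf; first by rewrite big_nil; exact: radical0.
rewrite big_cons; apply: radicalD; first by apply: rf; rewrite mem_head.
by apply: IH => u ur; apply: rf; rewrite inE ur orbT.
Qed.

Lemma radical_compl X Y Z (h : hom Y Z) (f : hom X Y) :
  radical f -> radical (h \oc f).
Proof. by move=> rf g; rewrite compA; exact: rf. Qed.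

Lemma radicalN X Y (f : hom X Y) : radical f -> radical (- f).
Proof. by rewrite -[f in - f]comp1m -compNl; exact: radical_compl. Qed.

Lemma radical_compr X Y Z (f : hom Y Z) (h : hom X Y) :
  radical f -> radical (f \oc h).
Proof.
by move=> rf g; rewrite compA; apply: jacobson_swap; rewrite compA; exact: rf.
Qed.

Lemma local_radical X Y (f : hom X Y) :
  local_end X -> (forall g : hom Y X, ~ is_iso (g \oc f)) -> radical f.
Proof.
move=> locX nf g; have [||//] := @local_split1 X (g \oc f) (idm X - g \oc f) locX.
  by rewrite addrC subrK.
by move/nf.
Qed.

(** The difference of [phi] and the identity is a sum of maps that factor through
    entries in the radical. *)
Lemma unipotent_iso (I : eqType) (F : I -> C) (S : C) (D : dsum F S)
    (phi : hom S S) :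
  (forall i, ds_pr D i \oc phi \oc ds_in D i = idm (F i)) ->
  (forall i j, i != j -> radical (ds_pr D j \oc phi \oc ds_in D i)) ->
  is_iso phi.
Proof.
move=> phi1 phir.
have rphi : radical (idm S - phi).
  suff -> : idm S - phi = \sum_(i <- ds_supp D) \sum_(j <- ds_supp D)
      ds_in D j \oc (ds_pr D j \oc (idm S - phi) \oc ds_in D i) \oc ds_pr D i.
    apply: radical_sum => i _; apply: radical_sum => j _.
    apply: radical_compr; apply: radical_compl.
    rewrite compBr compm1 compBl; have [->|nij] := eqVneq i j.
      by rewrite ds_prin phi1 subrr; exact: radical0.
    by rewrite ds_prin0 // sub0r; apply: radicalN; exact: phir.
  transitivity (idm S \oc (idm S - phi) \oc idm S); first by rewrite comp1m compm1.
  rewrite -{1 3}(ds_sum D) comp_sumr; apply: eq_bigr => i _.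
  by rewrite !comp_suml; apply: eq_bigr => j _; rewrite !compA.
have := rphi (idm S); rewrite comp1m opprB addrC subrK.
exact.
Qed.

End Generalities.

(** * Biproducts and decompositions into local objects *)

Section Biproducts.
Variables (k : comPzRingType) (C : kcat k).
Implicit Types X Y Z S L : C.

Lemma ds_sum_fin (I : finType) (F : I -> C) S (D : dsum F S) :
  \sum_i (ds_in D i \oc ds_pr D i) = idm S.
Proof.
rewrite -(ds_sum D) (bigID (mem (ds_supp D))) /= [X in _ + X]big1 ?addr0.
  by rewrite -big_uniq ?(ds_uniq D).
by move=> i /ds_supp_zero/(zero_codE (ds_pr D i))->; rewrite comp0r.
Qed.

Record biprod X1 X2 X := Biprod {
  bi1 : hom X1 X; bi2 : hom X2 X;
  bp1 : hom X X1; bp2 : hom X X2;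
  bp1i1 : bp1 \oc bi1 = idm X1;
  bp2i2 : bp2 \oc bi2 = idm X2;
  bsum : bi1 \oc bp1 + bi2 \oc bp2 = idm X
}.

Lemma bp1i2 X1 X2 X (B : biprod X1 X2 X) : bp1 B \oc bi2 B = 0.
Proof.
have : bp1 B \oc idm X \oc bi2 B = bp1 B \oc bi2 B by rewrite compm1.
rewrite -(bsum B) compDr compDl !compA bp1i1 comp1m -2!compA bp2i2 compm1.
by move/eqP; rewrite -subr_eq0 addrK => /eqP.
Qed.

Lemma bp2i1 X1 X2 X (B : biprod X1 X2 X) : bp2 B \oc bi1 B = 0.
Proof.
have : bp2 B \oc idm X \oc bi1 B = bp2 B \oc bi1 B by rewrite compm1.
rewrite -(bsum B) compDr compDl !compA bp2i2 comp1m -2!compA bp1i1 compm1.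
by move/eqP; rewrite -subr_eq0 addrK => /eqP.
Qed.

Definition biprodC X1 X2 X (B : biprod X1 X2 X) : biprod X2 X1 X.
Proof.
apply: (@Biprod _ _ _ (bi2 B) (bi1 B) (bp2 B) (bp1 B)).
- exact: bp2i2.
- exact: bp1i1.
- by rewrite addrC bsum.
Defined.

Lemma biprod_ex : additive_cat C ->
  forall X1 X2, exists S, inhabited (biprod X1 X2 S).
Proof.
move=> addC X1 X2; pose F b := if b then X1 else X2.
have [|S [D]] := @dsum_ex _ _ _ F addC; first by exists [:: true; false] => - [].
exists S; constructor.
apply: (@Biprod _ _ _ (ds_in D true) (ds_in D false) (ds_pr D true) (ds_pr D false)).
- exact: ds_prin.
- exact: ds_prin.
- by rewrite -(ds_sum_fin D) big_bool.
Qed.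

Lemma zero_object_ex : additive_cat C -> exists O : C, is_zero O.
Proof.
move=> addC.
have [O [D]] := addC 0%N (fun i => match i with Ordinal _ h => False_rect C (notF h) end).
by exists O; rewrite /is_zero -(ds_sum_fin D) big_ord0.
Qed.

Lemma biprod_of_dsum (F : bool -> C) S (D : dsum F S) :
  biprod (F true) (F false) S.
Proof.
apply: (@Biprod _ _ _ (ds_in D true) (ds_in D false) (ds_pr D true) (ds_pr D false)).
- exact: ds_prin.
- exact: ds_prin.
- by rewrite -(ds_sum_fin D) big_bool.
Qed.

Lemma biprod_iso X1 X2 X Y (f : hom X Y) :
  is_iso f -> biprod X1 X2 X -> inhabited (biprod X1 X2 Y).
Proof.
case=> g [gf fg] B; constructor.
apply: (@Biprod _ _ _ (f \oc bi1 B) (f \oc bi2 B) (bp1 B \oc g) (bp2 B \oc g)).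
- by rewrite compA -(compA _ g) gf compm1 bp1i1.
- by rewrite compA -(compA _ g) gf compm1 bp2i2.
- by rewrite -fg -{3}(compm1 f) -(bsum B) compDr compDl !compA.
Qed.

(** The decompositions of [krull_schmidt] in inductive form, one local summand being
    split off at a time. *)
Inductive local_sum : nat -> C -> Prop :=
| LocalSum0 S : is_zero S -> local_sum 0 S
| LocalSumS L S' S r :
    local_end L -> biprod L S' S -> local_sum r S' -> local_sum r.+1 S.

Lemma local_sum_iso r X Y (f : hom X Y) :
  is_iso f -> local_sum r X -> local_sum r Y.
Proof.
move=> fiso rX; case: rX f fiso => [S zS|L S' S s locL B sS'] f fiso.
  case: fiso => g [gf fg]; apply: LocalSum0.
  by rewrite /is_zero -fg (zero_domE f zS) comp0l.
by have [B'] := biprod_iso fiso B; exact: LocalSumS locL B' sS'.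
Qed.

Lemma local_sum_gt0 r S : local_sum r S -> ~ is_zero S -> (0 < r)%N.
Proof. by case. Qed.

Lemma krull_schmidt_local_sum : krull_schmidt C -> forall X, exists r, local_sum r X.
Proof.
move=> [addC KS] X; have [r [F [locF [D]]]] := KS X; exists r.
elim: r X F locF D => [|r IH] X F locF D.
  by apply: LocalSum0; rewrite /is_zero -(ds_sum_fin D) big_ord0.
have [S' [D']] := addC r (fun i => F (lift ord0 i)).
apply: (@LocalSumS (F ord0) S'); first exact: locF.
  2: by apply: (IH S' _ _ D') => i; exact: locF.
apply: (@Biprod _ _ _ (ds_in D ord0)
  (\sum_i ds_in D (lift ord0 i) \oc ds_pr D' i) (ds_pr D ord0)
  (\sum_i ds_in D' i \oc ds_pr D (lift ord0 i))).
- exact: ds_prin.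
- rewrite comp_suml -(ds_sum_fin D'); apply: eq_bigr => i _.
  rewrite comp_sumr (bigD1 i) //= big1 ?addr0.
    by rewrite compA -(compA _ (ds_pr D _)) ds_prin compm1.
  move=> j nij; rewrite compA -(compA _ (ds_pr D _)) ds_prin0 ?comp0r ?comp0l //.
- rewrite -(ds_sum_fin D) big_ord_recl; congr (_ + _).
  rewrite comp_suml; apply: eq_bigr => i _.
  rewrite comp_sumr (bigD1 i) //= big1 ?addr0.
    by rewrite compA -(compA _ (ds_pr D' _)) ds_prin compm1.
  move=> j nij; rewrite compA -(compA _ (ds_pr D' _)) ds_prin0 ?comp0r ?comp0l //.
Qed.

(** The ranks are recorded in order to make them additive on biproducts, which gives
    the measure for the induction in [bounded_ind]. *)
Definition splits_rank r S (e : hom S S) : Prop :=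
  exists (S1 S2 : C) (B : biprod S1 S2 S) (r1 r2 : nat),
    [/\ bi1 B \oc bp1 B = e, local_sum r1 S1, local_sum r2 S2 & (r1 + r2)%N = r].

Lemma splits_rankC r S (e : hom S S) :
  splits_rank r (idm S - e) -> splits_rank r e.
Proof.
case=> S1 [S2 [B [r1 [r2 [Be rS1 rS2 r12]]]]].
exists S2, S1, (biprodC B), r2, r1; split; rewrite ?(addnC r2) //=.
by rewrite -(subKr (idm S) e) -Be -(bsum B) addrC addKr.
Qed.

(** If the entry of [e] at the local summand [L] is invertible, then [e] maps [L]
    isomorphically onto a summand of its image. The complement of this summand in [S]
    is isomorphic to [S'], and carries the rest of [e]. *)
Lemma splits_rankS L S' S r (B : biprod L S' S) (e : hom S S) :
  additive_cat C -> local_end L -> e \oc e = e ->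
  (forall e' : hom S' S', e' \oc e' = e' -> splits_rank r e') ->
  is_iso (bp1 B \oc e \oc bi1 B) -> splits_rank r.+1 e.
Proof.
move=> addC locL ee IH [v [vu uv]].
pose i' := e \oc bi1 B; pose p' := v \oc bp1 B \oc e.
have ei' : e \oc i' = i' by rewrite /i' compA ee.
have p'e : p' \oc e = p' by rewrite /p' -compA ee.
have p'i' : p' \oc i' = idm L.
  by rewrite /p' /i' !compA -(compA _ e e) ee -!compA (compA (bp1 B)) vu.
have i'v : bp1 B \oc i' = bp1 B \oc e \oc bi1 B by rewrite /i' compA.
clearbody i' p'; pose p := i' \oc p'.
have ep : e \oc p = p by rewrite /p compA ei'.
have pe : p \oc e = p by rewrite /p -compA p'e.
have pp : p \oc p = p by rewrite /p compA -(compA i') p'i' compm1.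
(* the complement of the image of [i'] is again the summand [S'] of [S] *)
pose j := (idm S - p) \oc bi2 B.
pose q := bp2 B \oc (idm S - i' \oc v \oc bp1 B).
have qi' : q \oc i' = 0.
  by rewrite /q -compA compBl comp1m -!compA i'v vu compm1 subrr comp0r.
have qj : q \oc j = idm S'.
  rewrite /j compA compBr compm1 /p compA qi' comp0l subr0.
  rewrite /q -compA compBl comp1m -!compA bp1i2 !comp0r subr0; exact: bp2i2.
have jq : j \oc q = idm S - p.
  rewrite /j /q compA -(compA _ (bi2 B)).
  have -> : bi2 B \oc bp2 B = idm S - bi1 B \oc bp1 B by rewrite -(bsum B) addrC addKr.
  have bp1q : bp1 B \oc (idm S - i' \oc v \oc bp1 B) = 0.
    by rewrite compBr compm1 !compA i'v uv comp1m subrr.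
  rewrite -compA [X in _ \oc X]compBl comp1m -(compA (bi1 B)) bp1q comp0r subr0.
  rewrite compBr compm1 compBl comp1m /p !compA -(compA i' p' i') p'i' compm1.
  by rewrite subrr subr0.
have p'j : p' \oc j = 0.
  by rewrite /j compA compBr compm1 /p compA p'i' comp1m subrr comp0l.
have qp : q \oc p = 0 by rewrite /p compA qi' comp0l.
have pE : p = i' \oc p' by [].
clearbody j q p; pose e' := q \oc e \oc j.
have ejq : e \oc (j \oc q) = e - p by rewrite jq compBr compm1 ep.
have ee' : e' \oc e' = e'.
  rewrite /e' !compA -(compA _ j q) -(compA q e) ejq.
  rewrite compBr qp subr0 -(compA q e e) ee //.
have [S1 [S2 [B' [r1 [r2 [Be' rS1 rS2 r12]]]]]] := IH e' ee'.
have [T [BT]] := biprod_ex addC L S1.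
have je'q : j \oc e' \oc q = e - p.
  rewrite /e' !compA jq -!compA ejq compBl comp1m !compBr pe pp subrr subr0 //.
pose i1 := i' \oc bp1 BT + j \oc bi1 B' \oc bp2 BT.
pose p1 := bi1 BT \oc p' + bi2 BT \oc bp1 B' \oc q.
have i1p1 : i1 \oc p1 = e.
  rewrite /i1 /p1 !(compDl, compDr) !compA.
  rewrite -(compA i' (bp1 BT)) bp1i1 compm1 -(compA i' (bp1 BT)) bp1i2.
  rewrite -(compA (j \oc bi1 B') (bp2 BT)) bp2i1.
  rewrite -(compA (j \oc bi1 B') (bp2 BT)) bp2i2 compm1.
  rewrite !(comp0r, comp0l) addr0 add0r -(compA j) Be' je'q.
  by rewrite -pE addrC subrK.
exists T, S2; unshelve eexists (@Biprod _ _ _ i1 (j \oc bi2 B') p1 (bp2 B' \oc q) _ _ _).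
- rewrite /i1 /p1 !(compDl, compDr) !compA.
  rewrite -(compA (bi1 BT) p') p'i' compm1 -(compA (bi1 BT) p' j) p'j.
  rewrite -(compA _ q i') qi' -(compA _ q j) qj compm1.
  rewrite !(comp0r, comp0l) addr0 add0r -(compA (bi2 BT) (bp1 B')) bp1i1 compm1.
  exact: bsum.
- by rewrite compA -(compA _ q j) qj compm1 bp2i2.
- rewrite i1p1 compA -(compA j).
  have -> : bi2 B' \oc bp2 B' = idm S' - e' by rewrite -(bsum B') addrC -Be' addKr.
  rewrite compBr compm1 compBl jq je'q opprB [idm S - p + _]addrA.
  by rewrite subrK [LHS]addrC subrK.
- exists r1.+1, r2; split=> //; last by rewrite addSn r12.
  exact: LocalSumS locL BT rS1.
Qed.

(** At a local summand, the entry of [e] or that of [1 - e] is invertible. *)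
Lemma idempotent_splits_rank r S (e : hom S S) :
  additive_cat C -> local_sum r S -> e \oc e = e -> splits_rank r e.
Proof.
move=> addC rS; elim: rS e => {r S} [S zS|L S' S r locL B rS' IH] e ee.
  have S1 (f g : hom S S) : f = g by rewrite (zero_domE f zS) (zero_domE g zS).
  exists S, S, (@Biprod _ _ _ (idm S) (idm S) (idm S) (idm S) (S1 _ _) (S1 _ _) (S1 _ _)).
  by exists 0%N, 0%N; split=> //; exact: LocalSum0.
have [|eiso|eiso] := @local_split1 _ _ _ (bp1 B \oc e \oc bi1 B)
    (bp1 B \oc (idm S - e) \oc bi1 B) locL.
- by rewrite -compDl -compDr addrC subrK compm1 bp1i1.
- exact: splits_rankS locL ee IH eiso.
- apply: splits_rankC; apply: splits_rankS locL _ IH eiso => //.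
  by rewrite compBl comp1m compBr compm1 ee subrr subr0.
Qed.

Lemma idempotent_splits S (e : hom S S) : krull_schmidt C -> e \oc e = e ->
  exists (S1 S2 : C) (B : biprod S1 S2 S), bi1 B \oc bp1 B = e.
Proof.
move=> KS ee; have [r rS] := krull_schmidt_local_sum KS S.
have [S1 [S2 [B [r1 [r2 [Be _ _ _]]]]]] := idempotent_splits_rank KS.1 rS ee.
by exists S1, S2, B.
Qed.

Lemma biprod_summand_iso X1 X2 Y1 Y2 S (B : biprod X1 X2 S) (B' : biprod Y1 Y2 S) :
  bi1 B \oc bp1 B = bi1 B' \oc bp1 B' -> is_iso (bp1 B' \oc bi1 B).
Proof.
move=> BB'; exists (bp1 B \oc bi1 B'); split.
  rewrite compA -(compA _ (bi1 B')) -BB' compA bp1i1 comp1m; exact: bp1i1.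
rewrite compA -(compA _ (bi1 B)) BB' compA bp1i1 comp1m; exact: bp1i1.
Qed.

Lemma local_sum_biprod r X1 X2 S (B : biprod X1 X2 S) :
  additive_cat C -> local_sum r S ->
  exists r1 r2, [/\ local_sum r1 X1, local_sum r2 X2 & (r1 + r2)%N = r].
Proof.
move=> addC rS.
have [|S1 [S2 [B' [r1 [r2 [BB' rS1 rS2 r12]]]]]] :=
    idempotent_splits_rank (e := bi1 B \oc bp1 B) addC rS.
  by rewrite compA -(compA (bi1 B)) bp1i1 compm1.
exists r1, r2; split=> //.
- exact: local_sum_iso (biprod_summand_iso BB') rS1.
- apply: local_sum_iso (biprod_summand_iso (B := biprodC B') (B' := biprodC B) _) rS2.
  rewrite /=; apply: (addrI (bi1 B \oc bp1 B)).
  by rewrite -{1}BB' (bsum B) (bsum B').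
Qed.

End Biproducts.

(** * Fitting's lemma *)

Section FiniteLength.
Variables (k : comPzRingType) (V : lmodType k).

Lemma submodule0 (P : V -> Prop) : submodule P -> P 0.
Proof. by case. Qed.

Lemma submoduleD (P : V -> Prop) u v : submodule P -> P u -> P v -> P (u + v).
Proof. by move=> [_ PP] Pu Pv; have := PP 1 u v Pu Pv; rewrite scale1r. Qed.

Lemma submoduleB (P : V -> Prop) u v : submodule P -> P u -> P v -> P (u - v).
Proof.
by move=> [_ PP] Pu Pv; have := PP (-1) v u Pv Pu; rewrite scaleN1r addrC.
Qed.

(** The factors of a composition series that a submodule meets nontrivially form
    a finite set, which can only shrink along a descending chain; where it stays
    the same, so does the submodule. *)
Lemma finite_length_dcc (Q : nat -> V -> Prop) :
  finite_length V -> (forall i, submodule (Q i)) ->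
  (forall i v, Q i.+1 v -> Q i v) -> exists N, forall v, Q N v -> Q N.+1 v.
Proof.
move=> [n [P [subP P0 Pn simP]]] subQ decQ.
pose J i : {set 'I_n} := [set j : 'I_n | `[< exists v, [/\ Q i v, P j.+1 v & ~ P j v] >]].
have JS i : J i.+1 \subset J i.
  apply/subsetP => j; rewrite !inE => /asboolP[v [Qv Pv nPv]].
  by apply/asboolP; exists v; split=> //; exact: decQ.
have [N JN] : exists N, J N = J N.+1.
  apply: contrapT => nJ.
  pose c i := #|J i|.
  have lt i : (c i.+1 < c i)%N.
    apply: proper_card; rewrite properEneq JS andbT.
    by apply/eqP => JJ; apply: nJ; exists i.
  have le i : (c i + i <= c 0)%N.
    by elim: i => [|i IH]; [rewrite addn0|move: (lt i) IH; lia].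
  by have := le (c 0).+1; rewrite addnS ltnNge leq_addl.
exists N => v Qv.
suff H j : (j <= n)%N -> forall w, Q N w -> P j w -> Q N.+1 w by exact: (H n).
elim: j => [_ w _ /P0->|j IH ltj w Qw Pw]; first exact: submodule0.
case: (pselect (P j w)) => [Pjw|nPw]; first by apply: IH => //; exact: ltnW.
have [PjS _ maxP] := simP j ltj.
have : Ordinal ltj \in J N by rewrite inE; apply/asboolP; exists w.
rewrite JN inE => /asboolP[x [Qx Px nPx]].
pose M y := exists p z, [/\ P j p, Q N.+1 z, P j.+1 z & y = p + z].
have [||y [p [z [Pp _ Pz ->]]]|M1|M2] := maxP M.
- split; first by exists 0, 0; rewrite addr0; split=> //; exact: submodule0.
  move=> a _ _ [p [z [Pp Qz Pz ->]]] [p' [z' [Pp' Qz' Pz' ->]]].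
  exists (a *: p + p'), (a *: z + z'); split.
  + exact: (subP j).2.
  + exact: (subQ N.+1).2.
  + exact: (subP j.+1).2.
  + by rewrite scalerDr addrACA.
- by move=> y Py; exists y, 0; rewrite addr0; split=> //; exact: submodule0.
- by apply: submoduleD => //; exact: PjS.
- case: nPx; apply/M1; exists 0, x; rewrite add0r; split=> //; exact: submodule0.
- have /M2[p [z [Pp Qz Pz wE]]] := Pw.
  rewrite wE; apply: submoduleD => //; apply: IH => //; first exact: ltnW.
  have -> : p = w - z by rewrite wE addrK.
  by apply: submoduleB => //; exact: decQ.
Qed.
End FiniteLength.

Section Fitting.
Variables (k : comPzRingType) (C : kcat k).
Implicit Types X Y Z : C.

Definition endo_pow X (f : hom X X) (n : nat) : hom X X := iter n (comp f) (idm X).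

Lemma endo_powD X (f : hom X X) m n :
  endo_pow f (m + n) = endo_pow f m \oc endo_pow f n.
Proof.
elim: m => [|m IH]; first by rewrite comp1m.
by rewrite addSn /= IH compA.
Qed.

Lemma endo_powSr X (f : hom X X) n : endo_pow f n.+1 = endo_pow f n \oc f.
Proof. by rewrite -addn1 endo_powD /= compm1. Qed.

(** Far enough out, the powers of [f] are strongly regular: the chains of right
    and of left ideals that they generate in the endomorphism ring are stationary. *)
Lemma endo_pow_regular X (f : hom X X) : finite_length (hom X X) ->
  exists N, forall M, (N <= M)%N -> exists g h : hom X X,
    endo_pow f M = endo_pow f M \oc endo_pow f M \oc h /\
    endo_pow f M = g \oc endo_pow f M \oc endo_pow f M.
Proof.
move=> finX.
have [||N1 N1P] := @finite_length_dcc _ _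
    (fun i v => exists h : hom X X, v = endo_pow f i \oc h) finX.
- move=> i; split; first by exists 0; rewrite comp0r.
  by move=> a _ _ [h ->] [h' ->]; exists (a *: h + h'); rewrite comp_linr.
- by move=> i v [h ->]; exists (f \oc h); rewrite endo_powSr compA.
have [||N2 N2P] := @finite_length_dcc _ _
    (fun i v => exists g : hom X X, v = g \oc endo_pow f i) finX.
- move=> i; split; first by exists 0; rewrite comp0l.
  by move=> a _ _ [g ->] [g' ->]; exists (a *: g + g'); rewrite comp_linl.
- by move=> i v [g ->]; exists (g \oc f); rewrite /= compA.
have [|x xP] := N1P (endo_pow f N1); first by exists (idm X); rewrite compm1.
have [|y yP] := N2P (endo_pow f N2); first by exists (idm X); rewrite comp1m.
exists (maxn N1 N2) => M leM.
have xM t : exists h, endo_pow f M = endo_pow f (M + t) \oc h.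
  elim: t => [|t [h hP]]; first by exists (idm X); rewrite addn0 compm1.
  exists (x \oc h); rewrite hP.
  have -> : (M + t)%N = (M + t - N1 + N1)%N by lia.
  have -> : (M + t.+1)%N = (M + t - N1 + N1.+1)%N by lia.
  by rewrite !(endo_powD f (M + t - N1)) xP !compA.
have yM t : exists g, endo_pow f M = g \oc endo_pow f (M + t).
  elim: t => [|t [g gP]]; first by exists (idm X); rewrite addn0 comp1m.
  exists (g \oc y); rewrite gP.
  have -> : (M + t)%N = (N2 + (M + t - N2))%N by lia.
  have -> : (M + t.+1)%N = (N2.+1 + (M + t - N2))%N by lia.
  by rewrite !endo_powD yP !compA.
have [h hP] := xM M; have [g gP] := yM M.
by exists g, h; split; [rewrite -endo_powD|rewrite -compA -endo_powD].
Qed.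

Lemma nilpotent_iso X (f : hom X X) M : endo_pow f M = 0 -> is_iso (idm X - f).
Proof.
have [s [fs sf _]] : exists s : hom X X, [/\ (idm X - f) \oc s = idm X - endo_pow f M,
    s \oc (idm X - f) = idm X - endo_pow f M & f \oc s = s \oc f].
  elim: M => [|M [s [fs sf cs]]].
    by exists 0; rewrite !comp0r !comp0l /= subrr.
  have H : idm X - f + (f - f \oc endo_pow f M) = idm X - endo_pow f M.+1.
    by rewrite addrA subrK.
  exists (idm X + f \oc s); split.
  - rewrite compDr compm1 compA compBl comp1m.
    have -> : f - f \oc f = f \oc (idm X - f) by rewrite compBr compm1.
    by rewrite -compA fs compBr compm1.
  - by rewrite compDl comp1m -compA sf compBr compm1.
  - by rewrite compDr compm1 compDl comp1m -compA -cs.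
by move=> fM; exists s; rewrite fs sf fM subr0.
Qed.

Lemma endo_pow_iso X (f : hom X X) M : is_iso (endo_pow f M.+1) -> is_iso f.
Proof.
move=> [g [gl gr]]; apply: section_retraction_iso.
  by exists (g \oc endo_pow f M); rewrite -compA -endo_powSr.
by exists (endo_pow f M \oc g); rewrite compA.
Qed.

End Fitting.

Local Notation chom X Y := (@hom _ (CplxCat _ _) X Y).
Local Notation cbiprod := (@biprod _ (CplxCat _ _)).

(** * Complexes *)

Lemma choice_dep (I : Type) (T : I -> Type) (P : forall i, T i -> Prop) :
  (forall i, exists x, P i x) -> exists f : forall i, T i, forall i, P i (f i).
Proof. by move=> H; exists (fun i => projT1 (cid (H i))) => i; case: cid. Qed.

Section ComplexLemmas.
Variables (k : comPzRingType) (A : kcat k) (I : nzRingType).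
Implicit Types X Y Z : cplx A I.

Lemma cm_comp X Y Z (g : chom Y Z) (f : chom X Y) i :
  cm (g \oc f) i = cm g i \oc cm f i.
Proof. by []. Qed.
Lemma cm_id X i : cm (idm (X : CplxCat A I)) i = idm (X i).
Proof. by []. Qed.
Lemma cm0 X Y i : cm (0 : chom X Y) i = 0.
Proof. by []. Qed.
Lemma cmD X Y (f g : chom X Y) i : cm (f + g) i = cm f i + cm g i.
Proof. by []. Qed.
Lemma cmN X Y (f : chom X Y) i : cm (- f) i = - cm f i.
Proof. by []. Qed.
Lemma cm_sum X Y (T : Type) (r : seq T) (f : T -> chom X Y) i :
  cm (\sum_(t <- r) f t) i = \sum_(t <- r) cm (f t) i.
Proof. by elim: r => [|t r IH]; rewrite ?big_nil // !big_cons cmD IH. Qed.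
Definition cmE := (cm_comp, cm_id, cm0, cmD, cmN, cm_sum).

Lemma cm_eq X Y (f g : chom X Y) : f = g -> forall i, cm f i = cm g i.
Proof. by move->. Qed.

Lemma cplx_is_zero X : is_zero (X : CplxCat A I) <-> forall i, is_zero (X i).
Proof.
split=> [zX i|zX]; first by have := cm_eq zX i.
by apply: cmext => i; exact: zX.
Qed.

Lemma cm_is_iso X Y (f : chom X Y) : is_iso f -> forall i, is_iso (cm f i).
Proof.
by move=> [g [gf fg]] i; exists (cm g i); split; [have := cm_eq gf i|have := cm_eq fg i].
Qed.

Lemma cplx_is_iso X Y (f : chom X Y) : (forall i, is_iso (cm f i)) -> is_iso f.
Proof.
move=> fiso; have [g gP] := choice_dep fiso.
have gc i j : cd X i j \oc g i = g j \oc cd Y i j.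
  have [gf fg] := gP i; have [gf' fg'] := gP j.
  rewrite -[LHS]comp1m -gf' -!compA; congr (_ \oc _).
  by rewrite compA -cmP -compA fg compm1.
by exists (CMap gc); split; apply: cmext => i; have [gf fg] := gP i.
Qed.

(** The splittings in the single degrees assemble to a splitting of complexes because
    [e] commutes with the differential. *)
Lemma idempotent_splits_cplx X (e : chom X X) : krull_schmidt A -> e \oc e = e ->
  exists (X1 X2 : cplx A I) (B : @biprod _ (CplxCat A I) X1 X2 X),
    bi1 B \oc bp1 B = e.
Proof.
move=> KS ee.
have splits i : exists T : {S1 : A & {S2 : A & biprod S1 S2 (X i)}},
    bi1 (projT2 (projT2 T)) \oc bp1 (projT2 (projT2 T)) = cm e i.
  have [S1 [S2 [B Be]]] := idempotent_splits KS (cm_eq ee i).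
  by exists (existT _ S1 (existT _ S2 B)).
have [T TP] := choice_dep splits.
pose B i := projT2 (projT2 (T i)).
have BP i : bi1 (B i) \oc bp1 (B i) = cm e i by exact: TP.
have BP' i : bi2 (B i) \oc bp2 (B i) = idm _ - cm e i.
  by rewrite -(bsum (B i)) -BP addrC addKr.
have ec i j : cd X i j \oc cm e i = cm e j \oc cd X i j by exact: cmP.
clearbody B; clear TP.
have p1d i j : cd X i j \oc bi1 (B i) = bi1 (B j) \oc bp1 (B j) \oc cd X i j \oc bi1 (B i).
  by rewrite BP -ec -BP -!compA bp1i1 compm1.
have p2d i j : cd X i j \oc bi2 (B i) = bi2 (B j) \oc bp2 (B j) \oc cd X i j \oc bi2 (B i).
  rewrite BP' compBl comp1m -ec compBl -BP -!(compA _ _ (bi2 _)) bp1i2 !comp0r.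
  by rewrite subr0.
have d1p i j : bp1 (B j) \oc cd X i j = bp1 (B j) \oc cd X i j \oc bi1 (B i) \oc bp1 (B i).
  by rewrite -!compA BP ec -BP !compA bp1i1 comp1m.
have d2p i j : bp2 (B j) \oc cd X i j = bp2 (B j) \oc cd X i j \oc bi2 (B i) \oc bp2 (B i).
  rewrite -!compA BP' compBr compm1 ec -BP compBr !compA bp2i1 !comp0l.
  by rewrite subr0.
have sh1 i j : j != i + 1 -> bp1 (B j) \oc cd X i j \oc bi1 (B i) = 0.
  by move=> nij; rewrite (@cd_shape _ _ _ X) // comp0r comp0l.
have sh2 i j : j != i + 1 -> bp2 (B j) \oc cd X i j \oc bi2 (B i) = 0.
  by move=> nij; rewrite (@cd_shape _ _ _ X) // comp0r comp0l.
have cc1 i j l : (bp1 (B l) \oc cd X j l \oc bi1 (B j)) \oc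
    (bp1 (B j) \oc cd X i j \oc bi1 (B i)) = 0.
  by rewrite !compA -d1p -(compA (bp1 _)) cd_cd comp0r comp0l.
have cc2 i j l : (bp2 (B l) \oc cd X j l \oc bi2 (B j)) \oc
    (bp2 (B j) \oc cd X i j \oc bi2 (B i)) = 0.
  by rewrite !compA -d2p -(compA (bp2 _)) cd_cd comp0r comp0l.
pose X1 := Cplx sh1 cc1; pose X2 := Cplx sh2 cc2.
have i1P i j : cd X i j \oc bi1 (B i) = bi1 (B j) \oc cd X1 i j.
  by rewrite p1d /= !compA.
have i2P i j : cd X i j \oc bi2 (B i) = bi2 (B j) \oc cd X2 i j.
  by rewrite p2d /= !compA.
have p1P i j : cd X1 i j \oc bp1 (B i) = bp1 (B j) \oc cd X i j.
  by rewrite d1p.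
have p2P i j : cd X2 i j \oc bp2 (B i) = bp2 (B j) \oc cd X i j.
  by rewrite d2p.
pose I1 : chom X1 X := @CMap _ _ _ X1 X (fun i => bi1 (B i)) i1P.
pose I2 : chom X2 X := @CMap _ _ _ X2 X (fun i => bi2 (B i)) i2P.
pose P1 : chom X X1 := @CMap _ _ _ X X1 (fun i => bp1 (B i)) p1P.
pose P2 : chom X X2 := @CMap _ _ _ X X2 (fun i => bp2 (B i)) p2P.
unshelve eexists X1, X2, (@Biprod _ (CplxCat A I) X1 X2 X I1 I2 P1 P2 _ _ _).
- by apply: cmext => i; exact: bp1i1.
- by apply: cmext => i; exact: bp2i2.
- by apply: cmext => i; exact: bsum.
- by apply: cmext => i; exact: BP.
Qed.

Lemma biprod_cm X1 X2 X (B : @biprod _ (CplxCat A I) X1 X2 X) i :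
  biprod (X1 i) (X2 i) (X i).
Proof.
apply: (@Biprod _ _ _ _ _ (cm (bi1 B) i) (cm (bi2 B) i) (cm (bp1 B) i) (cm (bp2 B) i)).
- exact: (cm_eq (bp1i1 B)).
- exact: (cm_eq (bp2i2 B)).
- exact: (cm_eq (bsum B)).
Defined.

Lemma cm_endo_pow X (f : chom X X) M i : cm (endo_pow f M) i = endo_pow (cm f i) M.
Proof. by elim: M => //= M <-. Qed.

(** The Fitting decomposition of [X] under [f], where the exponent [M] is large
    enough for all degrees at once. *)
Lemma fitting_cplx X (f : chom X X) M :
  (forall i, exists g h : hom (X i) (X i),
    endo_pow (cm f i) M = endo_pow (cm f i) M \oc endo_pow (cm f i) M \oc h /\
    endo_pow (cm f i) M = g \oc endo_pow (cm f i) M \oc endo_pow (cm f i) M) ->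
  exists e : chom X X, [/\ e \oc e = e, endo_pow f M \oc e = endo_pow f M &
    e = idm _ -> is_iso (endo_pow f M)].
Proof.
move=> fP; pose a := endo_pow f M.
have [|gh ghP] := @choice_dep I (fun i => hom (X i) (X i) * hom (X i) (X i))%type
    (fun i gh => cm a i = cm a i \oc cm a i \oc gh.2 /\
                 cm a i = gh.1 \oc cm a i \oc cm a i).
  by move=> i; have [g [h H]] := fP i; exists (g, h); rewrite /a cm_endo_pow.
pose g i := (gh i).1; pose h i := (gh i).2.
have aah i : cm a i \oc cm a i \oc h i = cm a i by rewrite -(ghP i).1.
have gaa i : g i \oc cm a i \oc cm a i = cm a i by rewrite -(ghP i).2.
have gah i : g i \oc cm a i = cm a i \oc h i.
  by rewrite -{1}(aah i) !compA gaa.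
have ahca i : cm a i \oc (cm a i \oc h i) = cm a i by rewrite compA aah.
have ahac i : cm a i \oc h i \oc cm a i = cm a i by rewrite -gah gaa.
have ac i j : cd X i j \oc cm a i = cm a j \oc cd X i j by exact: cmP.
have ec i j : cd X i j \oc (cm a i \oc h i) = (cm a j \oc h j) \oc cd X i j.
  transitivity (cm a j \oc h j \oc cd X i j \oc (cm a i \oc h i)).
    have -> : cd X i j \oc (cm a i \oc h i) = cm a j \oc cd X i j \oc h i.
      by rewrite compA ac.
    by rewrite -!compA [cd X i j \oc (_ \oc _)]compA ac !compA ahac.
  by rewrite -(gah j) -(compA (g j)) -ac -!compA ahca.
pose e : chom X X := @CMap _ _ _ X X (fun i => cm a i \oc h i) ec.
exists e; split.
- by apply: cmext => i /=; rewrite compA ahac.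
- by apply: cmext => i; rewrite cm_comp /= ahca.
move=> e1; apply: cplx_is_iso => i.
apply: section_retraction_iso.
  by exists (g i); rewrite gah; exact: (cm_eq e1 i).
by exists (h i); exact: (cm_eq e1 i).
Qed.

End ComplexLemmas.

(** * Decomposition of bounded complexes *)

Section BoundedComplexes.
Variables (k : comPzRingType) (A : kcat k).
Implicit Types X Y Z : cplx A int.

Lemma boundedP X : bounded X <-> fin_supp (cx X).
Proof.
split=> [[a [b abX]]|[s sX]].
  exists [seq a + i%:Z | i <- iota 0 (absz (b - a)).+1] => i nis.
  apply: abX; apply: contraNN nis => /andP[ai ib].
  apply/mapP; exists (absz (i - a)); first by rewrite mem_iota; lia.
  by rewrite gez0_abs; lia.
pose N := (\max_(i <- s) absz i)%N.
exists (- N%:Z), N%:Z => i ni; apply: sX; apply: contraNN ni => si.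
have : (absz i <= N)%N by exact: leq_bigmax_seq.
lia.
Qed.

(** Decompositions into arbitrary complexes are considered; the summands of a bounded
    complex are automatically bounded. *)
Definition indec_cplx X : Prop :=
  ~ is_zero (X : CplxCat A int) /\
  forall X1 X2, cbiprod X1 X2 X ->
    is_zero (X1 : CplxCat A int) \/ is_zero (X2 : CplxCat A int).

Definition narrow_cplx (n : nat) X : Prop :=
  exists a : int, forall i, ~~ (a <= i < a + n%:Z) -> is_zero (X i).

Lemma indec_cplx_indecomposable (X : Cb A) :
  indec_cplx (sval X) -> indecomposable X.
Proof.
move=> [nX indX]; split=> // F D.
have B := biprod_of_dsum D.
have [|z|z] := indX (sval (F true)) (sval (F false)).
- exact: (@Biprod _ (CplxCat A int) _ _ _ (bi1 B) (bi2 B) (bp1 B) (bp2 B)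
    (bp1i1 B) (bp2i2 B) (bsum B)).
- by exists true.
- by exists false.
Qed.

(** By Fitting's lemma, [X] is the direct sum of two complexes on which an
    endomorphism [a] is invertible and nilpotent, respectively. As one of them
    vanishes, [a] or [1 - a] is invertible. *)
Lemma indec_cplx_local X : hom_finite A -> krull_schmidt A ->
  bounded X -> indec_cplx X -> local_end (X : CplxCat A int).
Proof.
move=> hfin KS /boundedP[s sX] [nX indX]; split=> // f g nf ng [u [uf fu]].
pose a : chom X X := u \oc f.
have ab : a + u \oc g = idm (X : CplxCat A int) by rewrite -compDr uf.
have na : ~ is_iso a.
  move=> aiso; apply: nf; apply: is_iso_compKl aiso.
  by exists (f + g).
have ub : ~ is_iso (u \oc g).
  by move=> biso; apply: ng; apply: is_iso_compKl biso; exists (f + g).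
have [N NP] := choice_dep (fun i => endo_pow_regular (cm a i) (hfin (X i) (X i))).
pose M := (\max_(i <- s) N i).+1.
have [|e [ee ae e1]] := @fitting_cplx _ _ _ X a M.
  move=> i; case: (boolP (i \in s)) => [si|/sX zX].
    by apply: NP; rewrite leqW //; exact: leq_bigmax_seq.
  by exists 0, 0; split; rewrite (zero_domE (endo_pow _ _) zX) !comp0l.
have [X1 [X2 [B Be]]] := idempotent_splits_cplx KS ee.
have [z|z] := indX X1 X2 B; last first.
  apply: na; apply: (@endo_pow_iso _ _ _ _ (M.-1)); apply: e1.
  by rewrite -Be -(bsum B) (zero_domE (bi2 B) z) comp0l addr0.
apply: ub; have -> : u \oc g = idm (X : CplxCat A int) - a by rewrite -ab addrC addKr.
apply: (@nilpotent_iso _ _ _ _ M).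
by rewrite -ae -Be (zero_domE (bi1 B) z) comp0l comp0r.
Qed.

(** Bounded complexes decompose into indecomposable ones: the total number of
    local summands of the components drops in a nontrivial decomposition. *)
Lemma bounded_ind (P : cplx A int -> Prop) : krull_schmidt A ->
  (forall X, is_zero (X : CplxCat A int) -> P X) ->
  (forall X, bounded X -> indec_cplx X -> P X) ->
  (forall X1 X2 X, cbiprod X1 X2 X -> P X1 -> P X2 -> P X) ->
  forall X, bounded X -> P X.
Proof.
move=> KS P0 P1 P2.
have main N : forall X (s : seq int) (r : int -> nat), (forall i, local_sum (r i) (X i)) ->
    (forall i, i \notin s -> r i = 0%N) -> (\sum_(i <- s) r i < N)%N -> P X.
  elim: N => // N IH X s r rX r0 rN.
  case: (pselect (is_zero (X : CplxCat A int))) => [/P0//|nX].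
  have bX : bounded X.
    by apply/boundedP; exists s => i /r0 ri; apply: contrapT => /(local_sum_gt0 (rX i)); rewrite ri.
  case: (pselect (indec_cplx X)) => [/P1 PX|nind]; first exact: PX.
  have [X1 [X2 [B [nX1 nX2]]]] : exists X1 X2 (B : cbiprod X1 X2 X),
      ~ is_zero (X1 : CplxCat A int) /\ ~ is_zero (X2 : CplxCat A int).
    apply: contrapT => H; apply: nind; split=> // X1 X2 B.
    case: (pselect (is_zero (X1 : CplxCat A int))) => [z|nz]; first by left.
    case: (pselect (is_zero (X2 : CplxCat A int))) => [z|nz']; first by right.
    by case: H; exists X1, X2, B.
  have [r1 r1P] := choice_dep (fun i => local_sum_biprod (biprod_cm B i) KS.1 (rX i)).
  have [r2 r2P] := choice_dep r1P.
  have rE i : (r1 i + r2 i)%N = r i by have [] := r2P i.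
  have sum12 : (\sum_(i <- s) r1 i + \sum_(i <- s) r2 i)%N = \sum_(i <- s) r i.
    by rewrite -big_split; apply: eq_bigr => i _; exact: rE.
  have sum_gt0 (Y : cplx A int) (r' : int -> nat) :
      ~ is_zero (Y : CplxCat A int) -> (forall i, local_sum (r' i) (Y i)) ->
      (forall i, i \notin s -> r' i = 0%N) -> (0 < \sum_(i <- s) r' i)%N.
    move=> nY r'Y r'0; have [i nYi] : exists i, ~ is_zero (Y i).
      by apply: contrapT => H; apply/nY/cplx_is_zero => i; apply: contrapT => Hi; apply: H; exists i.
    have ri := local_sum_gt0 (r'Y i) nYi.
    have si : i \in s by apply: contraTT ri => /r'0->.
    by rewrite (big_rem i si) /=; lia.
  have r10 i : i \notin s -> r1 i = 0%N by move=> /r0; have := rE i; lia.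
  have r20 i : i \notin s -> r2 i = 0%N by move=> /r0; have := rE i; lia.
  have r1X i : local_sum (r1 i) (X1 i) by have [] := r2P i.
  have r2X i : local_sum (r2 i) (X2 i) by have [] := r2P i.
  have gt1 := sum_gt0 X1 r1 nX1 r1X r10; have gt2 := sum_gt0 X2 r2 nX2 r2X r20.
  apply: (P2 X1 X2 X B).
    by apply: (IH X1 s r1) => //; rewrite -ltnS; apply: leq_trans rN;
      rewrite ltnS -sum12 -addn1 leq_add2l.
  by apply: (IH X2 s r2) => //; rewrite -ltnS; apply: leq_trans rN;
    rewrite ltnS -sum12 -add1n leq_add2r.
move=> X /boundedP[s sX].
have [r rX] := choice_dep (fun i => krull_schmidt_local_sum KS (X i)).
pose r' i := if i \in s then r i else 0%N.
apply: (main (\sum_(i <- s) r' i).+1 X s r') => // i.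
  by rewrite /r'; case: ifPn => [_|/sX]; [exact: rX|exact: LocalSum0].
by rewrite /r' => /negPf->.
Qed.

Section Narrow.
Variable n : nat.
Hypothesis KS : krull_schmidt A.
Hypothesis narrow : forall X, bounded X -> indec_cplx X -> narrow_cplx n X.

(** The idempotent [e] projects onto the indecomposable summands that are nonzero in
    degree [p]. These are concentrated at distance less than [n] from [p]. *)
Lemma split_near p X : bounded X ->
  exists e : chom X X, [/\ e \oc e = e, cm e p = idm (X p) &
    forall i, (i <= p - n%:Z) || (p + n%:Z <= i) -> cm e i = 0].
Proof.
move: X; apply: (bounded_ind KS).
- move=> X zX; exists 0; split; rewrite ?comp0l //.
  by apply/esym/zero_domE; move/cplx_is_zero: zX.
- move=> X bX iX; have [a aX] := narrow bX iX.
  case: (pselect (is_zero (X p))) => [zXp|nXp].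
    by exists 0; split; rewrite ?comp0l //; exact/esym/zero_domE.
  exists (idm (X : CplxCat A int)); split; rewrite ?comp1m // => i ip.
  have ap : a <= p < a + n%:Z by apply: contrapT => /negP/aX.
  by apply: zero_domE; apply: aX; lia.
- move=> X1 X2 X B [e1 [ee1 e1p e1n]] [e2 [ee2 e2p e2n]].
  exists (bi1 B \oc e1 \oc bp1 B + bi2 B \oc e2 \oc bp2 B); split.
  + rewrite !(compDl, compDr) !compA -!(compA _ (bp1 B)) bp1i1 bp1i2.
    rewrite -!(compA _ (bp2 B)) bp2i2 bp2i1 !(comp0r, comp0l) add0r addr0 !compm1.
    by rewrite -(compA (bi1 B)) ee1 -(compA (bi2 B)) ee2.
  + by rewrite !cmE e1p e2p !compm1 (bsum (biprod_cm B p)).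
  + by move=> i ip; rewrite !cmE (e1n _ ip) (e2n _ ip) !(comp0r, comp0l) addr0.
Qed.

Lemma indec_summand_at p X : bounded X -> ~ is_zero (X p) ->
  exists (B : cplx A int) (i : chom B X) (q : chom X B),
    [/\ bounded B, indec_cplx B, q \oc i = idm _ & ~ is_zero (B p)].
Proof.
move: X; apply: (bounded_ind KS).
- by move=> X /cplx_is_zero/(_ p).
- by move=> X bX iX nXp; exists X, (idm _), (idm _); rewrite comp1m.
- move=> X1 X2 X B IH1 IH2 nXp.
  case: (pselect (is_zero (X1 p))) => [z1|/IH1[Y [i [q [bY iY qi nY]]]]].
    case: (pselect (is_zero (X2 p))) => [z2|/IH2[Y [i [q [bY iY qi nY]]]]].
      case: nXp; rewrite /is_zero -(bsum (biprod_cm B p)).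
      by rewrite (zero_domE (bi1 _) z1) (zero_domE (bi2 _) z2) !comp0l addr0.
    exists Y, (bi2 B \oc i), (q \oc bp2 B); split=> //.
    by rewrite compA -(compA q) bp2i2 compm1.
  exists Y, (bi1 B \oc i), (q \oc bp1 B); split=> //.
  by rewrite compA -(compA q) bp1i1 compm1.
Qed.

End Narrow.

(** A complex in the degrees from 1 to [n], shifted by [t], lives in the degrees from
    [1 - t] to [n - t]. *)
Lemma narrow_of_shift (n : nat) :
  (forall X : Cb A, indecomposable X ->
     exists (t : int) (Y : C1n A n),
       indecomposable Y /\ isomorphic X (shift A t (incl (concentrated n) Y))) ->
  forall X, bounded X -> indec_cplx X -> narrow_cplx n X.
Proof.
move=> hshift X bX iX.
have [|t [Y [_ [f [g [gf fg]]]]]] := hshift (exist _ X bX).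
  exact: indec_cplx_indecomposable.
exists (1 - t) => i ni.
have := cm_eq gf i; rewrite /= => gfi.
apply: (is_zero_retract gfi).
by apply: (proj2_sig Y); lia.
Qed.

End BoundedComplexes.

(** * Quotient modules *)

Section Quotient.
Variables (k : comPzRingType) (V : lmodType k) (S : V -> Prop).
Hypothesis subS : submodule S.

Fact quo_repr_subproof x : exists y, S (y - x).
Proof. by exists x; rewrite subrr; exact: submodule0. Qed.

(** A representative that depends only on the class of [x], by extensionality of
    predicates: the quotient is formed of these representatives. *)
Definition quo_repr x : V := projT1 (cid (quo_repr_subproof x)).

Lemma quo_reprP x : S (quo_repr x - x).
Proof. exact: projT2 (cid (quo_repr_subproof x)). Qed.

Lemma quo_repr_eq x y : S (x - y) -> quo_repr x = quo_repr y.
Proof.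
move=> Sxy; rewrite /quo_repr.
have E : (fun z => S (z - x)) = (fun z => S (z - y)).
  apply/funext => z; apply/propext; split=> H.
    by rewrite -(subrKA x z); exact: submoduleD.
  rewrite -(subrKA y z); apply: submoduleD => //.
  by rewrite -opprB -sub0r; apply: submoduleB => //; exact: submodule0.
move: (quo_repr_subproof x) (quo_repr_subproof y); rewrite E => e1 e2.
by rewrite (Prop_irrelevance e1 e2).
Qed.

Record quo := Quo { quo_val : V; quo_valP : quo_repr quo_val = quo_val }.

HB.instance Definition _ := gen_eqMixin quo.
HB.instance Definition _ := gen_choiceMixin quo.

Definition quo_pi (x : V) : quo := Quo (quo_repr_eq (quo_reprP x)).

Lemma quo_piK (a : quo) : quo_pi (quo_val a) = a.
Proof.
case: a => x xP; rewrite /quo_pi /=; move: (quo_repr_eq _); rewrite xP => e.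
by rewrite (Prop_irrelevance e xP).
Qed.

Lemma quo_piE x y : quo_pi x = quo_pi y <-> S (x - y).
Proof.
split=> [[E]|Sxy].
  rewrite -(subrKA (quo_repr x) x) {2}E; apply: submoduleD => //; last exact: quo_reprP.
  rewrite -opprB -sub0r; apply: submoduleB => //; first exact: submodule0.
  exact: quo_reprP.
rewrite /quo_pi; move: (quo_repr_eq (quo_reprP x)) (quo_repr_eq (quo_reprP y)).
by rewrite (quo_repr_eq Sxy) => e1 e2; rewrite (Prop_irrelevance e1 e2).
Qed.

Lemma quo_val_pi x : S (quo_val (quo_pi x) - x).
Proof. by apply/quo_piE; rewrite quo_piK. Qed.

Definition quo_add a b := quo_pi (quo_val a + quo_val b).
Definition quo_opp a := quo_pi (- quo_val a).
Definition quo_scale c a := quo_pi (c *: quo_val a).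

Lemma quo_addE x y : quo_add (quo_pi x) (quo_pi y) = quo_pi (x + y).
Proof.
by apply/quo_piE; rewrite opprD addrACA; apply: submoduleD => //; exact: quo_val_pi.
Qed.

Lemma quo_scaleE c x : quo_scale c (quo_pi x) = quo_pi (c *: x).
Proof.
apply/quo_piE; rewrite -scalerBr -[X in S X]addr0; apply: subS.2; first exact: quo_val_pi.
exact: submodule0.
Qed.

Fact quo_addA : associative quo_add.
Proof.
move=> a b c; rewrite -(quo_piK a) -(quo_piK b) -(quo_piK c).
by rewrite !quo_addE addrA.
Qed.
Fact quo_addC : commutative quo_add.
Proof. by move=> a b; rewrite /quo_add addrC. Qed.
Fact quo_add0 : left_id (quo_pi 0) quo_add.
Proof. by move=> a; rewrite -(quo_piK a) quo_addE add0r. Qed.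
Fact quo_addN : left_inverse (quo_pi 0) quo_opp quo_add.
Proof. by move=> a; rewrite /quo_opp -{2}(quo_piK a) quo_addE addNr. Qed.

HB.instance Definition _ :=
  GRing.isZmodule.Build quo quo_addA quo_addC quo_add0 quo_addN.

Fact quo_scaleA c d a : quo_scale c (quo_scale d a) = quo_scale (c * d) a.
Proof. by rewrite -(quo_piK a) !quo_scaleE scalerA. Qed.
Fact quo_scale1 : left_id 1 quo_scale.
Proof. by move=> a; rewrite -(quo_piK a) quo_scaleE scale1r. Qed.
Fact quo_scaleDr : right_distributive quo_scale +%R.
Proof.
move=> c a b; rewrite -(quo_piK a) -(quo_piK b) [quo_pi _ + _]quo_addE !quo_scaleE.
by rewrite [RHS]quo_addE scalerDr.
Qed.
Fact quo_scaleDl a : {morph quo_scale^~ a : c d / c + d}.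
Proof. by move=> c d; rewrite -(quo_piK a) !quo_scaleE [RHS]quo_addE scalerDl. Qed.

HB.instance Definition _ := GRing.Zmodule_isLmodule.Build k quo
  quo_scaleA quo_scale1 quo_scaleDr quo_scaleDl.

Lemma quo_pi_linear : linear quo_pi.
Proof. by move=> c x y; rewrite [c *: quo_pi x]quo_scaleE [RHS]quo_addE. Qed.

Lemma quo_pi0 x : quo_pi x = 0 <-> S x.
Proof. by rewrite -[x in S x]subr0; exact: quo_piE. Qed.

End Quotient.

Section QuotientMap.
Variables (k : comPzRingType) (V V' : lmodType k) (S : V -> Prop) (S' : V' -> Prop).
Hypotheses (subS : submodule S) (subS' : submodule S').
Variable g : lin V V'.
Hypothesis gS : forall v, S v -> S' (lin_app g v).

Definition quo_map_fun (a : quo subS) : quo subS' := quo_pi subS' (lin_app g (quo_val a)).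

Lemma quo_map_pi v : quo_map_fun (quo_pi subS v) = quo_pi subS' (lin_app g v).
Proof.
apply/quo_piE; have -> : lin_app g (quo_val (quo_pi subS v)) - lin_app g v =
    lin_app g (quo_val (quo_pi subS v) - v) by rewrite /lin_app linearB.
by apply: gS; exact: quo_val_pi.
Qed.

Lemma quo_map_linear : linear quo_map_fun.
Proof.
move=> c a b; rewrite -(quo_piK a) -(quo_piK b) -quo_pi_linear !quo_map_pi.
by rewrite linearP_lin quo_pi_linear.
Qed.

Definition quo_map : lin (quo subS) (quo subS') := mklin quo_map_linear.
End QuotientMap.

(** * Weak kernels *)

Section WeakKernels.
Variables (k : comPzRingType) (A : kcat k).
Implicit Types (F G : ModA A) (X Y T : A).

Definition has_weak_kernels : Prop :=
  forall (Y1 Y0 : A) (f : hom Y1 Y0), exists (W : A) (u : hom W Y1), f \oc u = 0 /\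
    forall T (g : hom T Y1), f \oc g = 0 -> exists v, g = u \oc v.

Definition elt F X : Type := (F X : lmodType k).

Definition act F X Y (u : hom X Y) (y : elt F Y) : elt F X :=
  lin_app (fmap F (u : @hom k (opcat A) Y X)) y.

Lemma actM F X Y Z (v : hom Y Z) (u : hom X Y) (z : elt F Z) :
  act (v \oc u) z = act u (act v z).
Proof.
exact: (congr1 (fun h => lin_app h z)
  (fmapM F (u : @hom k (opcat A) Y X) (v : @hom k (opcat A) Z Y))).
Qed.

Lemma act_linl F X Y a (u v : hom X Y) (y : elt F Y) :
  act (a *: u + v) y = a *: act u y + act v y :> (F X : lmodType k).
Proof.
exact: (congr1 (fun h => lin_app h y)
  (fmap_lin F a (u : @hom k (opcat A) Y X) (v : @hom k (opcat A) Y X))).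
Qed.

Lemma act_linr F X Y (u : hom X Y) a (x y : (F Y : lmodType k)) :
  act (F := F) u (a *: x + y) = a *: act (F := F) u x + act (F := F) u y
    :> (F X : lmodType k).
Proof. exact: linearP_lin. Qed.

Lemma nt_act F G (eta : nat_trans F G) X Y (u : hom X Y) (y : elt F Y) :
  nt_app eta (act u y) = act (F := G) u (nt_app eta y).
Proof. exact: ntP. Qed.

Lemma nt_lin F G (eta : nat_trans F G) X a (x y : (F X : lmodType k)) :
  nt_app eta (a *: x + y) = a *: nt_app eta x + nt_app eta y.
Proof. exact: linearP_lin. Qed.

Lemma nt_appB F G (eta : nat_trans F G) X (x y : (F X : lmodType k)) :
  nt_app eta (x - y) = nt_app eta x - nt_app eta y.
Proof. by rewrite -scaleN1r addrC nt_lin scaleN1r addrC. Qed.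

Lemma nt_app0 F G (eta : nat_trans F G) X : nt_app eta (0 : (F X : lmodType k)) = 0.
Proof. by rewrite -(subrr 0) nt_appB subrr. Qed.

Lemma act0 F X Y (u : hom X Y) : act (F := F) u 0 = 0 :> (F X : lmodType k).
Proof.
have := act_linr u (-1) (0 : (F Y : lmodType k)) 0.
by rewrite !scaleN1r !addNr.
Qed.

Lemma act0l F X Y (y : elt F Y) : act (0 : hom X Y) y = 0 :> (F X : lmodType k).
Proof.
have := act_linl (-1) (0 : hom X Y) 0 y.
by rewrite !scaleN1r !addNr.
Qed.

(** The morphism from a representable functor that corresponds to an element
    under the Yoneda lemma. *)
Definition yoneda_elt F X (x : elt F X) : nat_trans (yoneda X) F.
Proof.
exists (fun Y : A => mklin (fun a u v => act_linl a u v x :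
  act (a *: u + v) x = _)) => Y Z u y.
exact: actM.
Defined.

Lemma yoneda_eltE F X (x : elt F X) Y (u : hom Y X) :
  @nt_app k A (yoneda X) F (yoneda_elt x) Y u = act u x.
Proof. by []. Qed.

Lemma yoneda_nt F X (eta : nat_trans (yoneda X) F) Y (u : hom Y X) :
  @nt_app k A (yoneda X) F eta Y u = act u (@nt_app k A (yoneda X) F eta X (idm X)).
Proof.
rewrite -nt_act; congr (nt_app eta _); exact: (esym (comp1m u)).
Qed.

Section Cokernel.
Variables (Y1 Y0 : A) (f : hom Y1 Y0).

Definition im_comp X (u : hom X Y0) : Prop := exists v : hom X Y1, u = f \oc v.

Lemma im_comp_submodule X : submodule (@im_comp X).
Proof.
split; first by exists 0; rewrite comp0r.
by move=> a _ _ [v ->] [w ->]; exists (a *: v + w); rewrite comp_linr.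
Qed.

Lemma im_comp_stable X Z (u : hom Z X) (v : hom X Y0) :
  im_comp v -> im_comp (lin_app (yoneda_map Y0 u) v).
Proof. by move=> [w ->]; exists (w \oc u); rewrite compA. Qed.

Definition coker_ob (X : opcat A) : Modk k := quo (@im_comp_submodule X) : lmodType k.

Definition coker_map (X Z : opcat A) (u : hom X Z) : hom (coker_ob X) (coker_ob Z) :=
  quo_map (@im_comp_submodule X) (@im_comp_submodule Z)
    (@im_comp_stable X Z (u : @hom k A Z X)).

Definition coker_pi (X : A) (v : hom X Y0) : (coker_ob X : lmodType k) :=
  quo_pi (@im_comp_submodule X) v.

Lemma coker_mapE (X Z : A) (u : hom Z X) (v : hom X Y0) :
  lin_app (coker_map (u : @hom k (opcat A) X Z)) (coker_pi v) = coker_pi (v \oc u).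
Proof.
exact: (@quo_map_pi k (hom X Y0) (hom Z Y0) (@im_comp X) (@im_comp Z)
  (@im_comp_submodule X) (@im_comp_submodule Z) (yoneda_map Y0 u) (@im_comp_stable X Z u) v).
Qed.

Lemma coker_piP (X : A) (x : (coker_ob X : lmodType k)) : exists v, x = coker_pi v.
Proof. by exists (quo_val x); rewrite /coker_pi quo_piK. Qed.

Lemma coker_pi_linear X : linear (@coker_pi X).
Proof. exact: quo_pi_linear. Qed.

Definition cokernel_functor : ModA A.
Proof.
apply: (@KFunctor k (opcat A) (Modk k) coker_ob coker_map).
- move=> X; apply: linext => x; have [v ->] := coker_piP x.
  exact: (etrans (@coker_mapE X X (idm _) v) (congr1 (@coker_pi X) (compm1 v))).
- move=> X Y Z v u; apply: linext => x; have [w ->] := coker_piP x.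
  apply: (etrans (@coker_mapE X Z ((u : @hom k A Y X) \oc (v : @hom k A Z Y)) w)).
  apply: (etrans (congr1 (@coker_pi Z) (compA w (u : @hom k A Y X) (v : @hom k A Z Y)))).
  apply: (etrans (esym (@coker_mapE Y Z v (w \oc (u : @hom k A Y X))))).
  exact: (congr1 (lin_app (coker_map v)) (esym (@coker_mapE X Y u w))).
- move=> X Y a u v; apply: linext => x; have [w ->] := coker_piP x.
  apply: (etrans (@coker_mapE X Y (a *: (u : @hom k A Y X) + v) w)).
  apply: (etrans (congr1 (@coker_pi Y)
    (comp_linr a w (u : @hom k A Y X) (v : @hom k A Y X)))).
  by rewrite coker_pi_linear -!coker_mapE.
Defined.

Definition cokernel_proj : nat_trans (yoneda Y0) cokernel_functor.
Proof.
exists (fun X : A => mklin (@coker_pi_linear X)) => X Z u v.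
exact: (esym (coker_mapE u v)).
Defined.

Lemma cokernel_proj0 X (u : hom X Y0) :
  @nt_app k A (yoneda Y0) cokernel_functor cokernel_proj X u = 0 <->
  exists v, u = f \oc v.
Proof. exact: quo_pi0. Qed.

Lemma cokernel_finitely_presented : finitely_presented cokernel_functor.
Proof.
exists Y1, Y0, (yoneda_elt (F := yoneda Y0) f), cokernel_proj; split.
  by move=> X y; have [v ->] := coker_piP y; exists v.
move=> X y; split=> [/cokernel_proj0[v ->]|[v <-]]; first by exists v.
by apply/cokernel_proj0; exists v.
Qed.
End Cokernel.

Lemma yoneda_finitely_presented X : finitely_presented (yoneda X).
Proof.
exists X, X, (yoneda_elt (F := yoneda X) (0 : hom X X)), (yoneda_elt (F := yoneda X) (idm X)).
split; first by move=> Y y; exists y; exact: comp1m.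
move=> Y y; rewrite yoneda_eltE [act _ _]comp1m; split=> [->|[v <-]].
  by exists 0; exact: comp0r.
exact: comp0l.
Qed.

Hypothesis addA : additive_cat A.

(** The relations of [F] are those of [P] together with the generators of [K]. *)
Lemma finitely_presented_quotient F K P (i : nat_trans K P) (p : nat_trans P F) :
  finitely_presented K -> finitely_presented P -> nt_epi p -> nt_exact i p ->
  finitely_presented F.
Proof.
move=> [_ [C [_ [pK [pK_epi _]]]]] [B [D [b [pP [pP_epi pP_ex]]]]] p_epi p_ex.
have [a aP] := pP_epi C (nt_app i (@nt_app k A (yoneda C) K pK C (idm C))).
have [S [BS]] := biprod_ex addA B C.
pose b0 : hom B D := @nt_app k A (yoneda B) (yoneda D) b B (idm B).
have bE T (u : hom T B) : @nt_app k A (yoneda B) (yoneda D) b T u = b0 \oc u.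
  exact: yoneda_nt.
pose c : hom S D := b0 \oc bp1 BS + a \oc bp2 BS.
pose pF : nat_trans (yoneda D) F :=
  yoneda_elt (nt_app p (@nt_app k A (yoneda D) P pP D (idm D))).
have pFE T (u : hom T D) : @nt_app k A (yoneda D) F pF T u =
    nt_app p (@nt_app k A (yoneda D) P pP T u).
  by rewrite yoneda_eltE -nt_act -(yoneda_nt pP).
have pb0 T (u : hom T B) : @nt_app k A (yoneda D) P pP T (b0 \oc u) = 0.
  by apply/(pP_ex T); exists u; exact: bE.
have pa T (u : hom T C) : @nt_app k A (yoneda D) P pP T (a \oc u) =
    nt_app i (@nt_app k A (yoneda C) K pK T u).
  rewrite (yoneda_nt pK) nt_act -aP -nt_act //.
exists S, D, (yoneda_elt (F := yoneda D) c), pF; split.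
  move=> T y; have [x <-] := p_epi T y; have [u <-] := pP_epi T x.
  by exists u; rewrite pFE.
move=> T y; rewrite pFE; split; last first.
  move=> [u <-]; rewrite yoneda_eltE.
  apply: etrans (_ : nt_app p (@nt_app k A (yoneda D) P pP T (c \oc u)) = _); first by [].
  rewrite /c compDl -!compA.
  have := nt_lin pP 1 (b0 \oc (bp1 BS \oc u) : (yoneda D T : lmodType k)) (a \oc (bp2 BS \oc u)).
  rewrite !scale1r => ->; rewrite pb0 add0r pa.
  by apply/(p_ex T); eexists.
move=> /(p_ex T)[x xP]; have [u uP] := pK_epi T x.
have /(pP_ex T)[v vP] : @nt_app k A (yoneda D) P pP T
    ((y : @hom k A T D) - (a : @hom k A C D) \oc (u : @hom k A T C)) = 0.
  by rewrite (nt_appB pP) pa uP xP subrr.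
exists (bi1 BS \oc v + bi2 BS \oc u).
rewrite yoneda_eltE [act _ _](_ : _ = c \oc (bi1 BS \oc v + bi2 BS \oc u)) //.
rewrite /c compDl !compDr !compA -!(compA _ _ (bi1 BS)) bp1i1 bp2i1.
rewrite -!(compA _ _ (bi2 BS)) bp1i2 bp2i2 !(comp0r, comp0l, compm1) addr0 add0r.
by rewrite -bE vP subrK.
Qed.

Lemma pd_le_finitely_presented d F : pd_le d F -> finitely_presented F.
Proof.
elim: d F => [|d IH] F; first by case.
case=> [K [P [i [p [/IH fpK [fpP _] _ p_epi p_ex]]]]].
exact: finitely_presented_quotient fpK fpP p_epi p_ex.
Qed.

(** The first step of a projective resolution, in terms of elements: [x] generates
    the kernel of an epimorphism [q] from a projective, and [s] the relations of [x]. *)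
Lemma pd_le_syzygy d F : pd_le d F ->
  exists (P : ModA A) (q : nat_trans P F), [/\ mod_projective P, nt_epi q &
    exists (W W' : A) (x : elt P W) (s : hom W' W),
      [/\ nt_app q x = 0, forall T (y : elt P T), nt_app q y = 0 -> exists u : hom T W, y = act u x,
        act s x = 0 :> (P W' : lmodType k) &
        forall T (u : hom T W), act u x = 0 :> (P T : lmodType k) -> exists v, u = s \oc v]].
Proof.
case: d => [|d].
  move=> projF; have [W _] := zero_object_ex addA.
  exists F; unshelve eexists; first by exists (fun X => lin_id (F X)).
  split=> //; first by move=> X y; exists y.
  exists W, W, (0 : (F W : lmodType k)), (idm W); split=> //.
  - by move=> T y y0; exists 0; rewrite act0; exact: y0.
  - exact: act0.
  - by move=> T u _; exists u; rewrite comp1m.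
case=> [K [P [i [q [/pd_le_finitely_presented fpK projP i_mono q_epi q_ex]]]]].
exists P, q; split=> //.
have [W' [W [r [pK [pK_epi pK_ex]]]]] := fpK.
pose x := nt_app i (@nt_app k A (yoneda W) K pK W (idm W)).
have xE T (u : hom T W) : act u x = nt_app i (@nt_app k A (yoneda W) K pK T u).
  by rewrite (yoneda_nt pK) nt_act.
pose s : hom W' W := @nt_app k A (yoneda W') (yoneda W) r W' (idm W').
have sE T (u : hom T W') : @nt_app k A (yoneda W') (yoneda W) r T u = s \oc u.
  exact: yoneda_nt.
exists W, W', x, s; split.
- by apply/(q_ex W); eexists.
- move=> T y /(q_ex T)[z <-]; have [u <-] := pK_epi T z.
  by exists u; rewrite xE.
- rewrite xE [X in nt_app i X](_ : _ = 0) ?nt_app0 //.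
  by apply/(pK_ex W'); exists (idm W'); rewrite sE compm1.
- move=> T u; rewrite xE -(nt_app0 i T) => /i_mono/(pK_ex T)[v <-].
  by exists v; rewrite sE.
Qed.

(** Schanuel's comparison of [yoneda Y1 -> yoneda Y0] with a projective resolution
    of its cokernel shows that its kernel is finitely generated. *)
Lemma weak_kernels_of_gldim : finite_global_dimension A -> has_weak_kernels.
Proof.
move=> [d pd] Y1 Y0 f; pose F := cokernel_functor f; pose p := cokernel_proj f.
have [P [q [[_ projP] q_epi [W [W' [x [s [qx qker sx sker]]]]]]]] :=
  pd_le_syzygy (pd F (cokernel_finitely_presented f)).
have [mu muP] := projP (yoneda Y0) F p q (yoneda_finitely_presented Y0)
  (cokernel_finitely_presented f) (fun X y => let: ex_intro v e := coker_piP y in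
    ex_intro _ v (esym e)).
have [l lP] := q_epi Y0 (@nt_app k A (yoneda Y0) F p Y0 (idm Y0)).
have [a aP] : exists a : hom Y1 W, act f l = act a x.
  apply: qker; rewrite nt_act lP -nt_act; apply/cokernel_proj0.
  by exists (idm Y1); rewrite compm1; exact: comp1m.
have [w wP] : exists w, @nt_app k A P (yoneda Y0) mu W x = f \oc w.
  by apply/cokernel_proj0; rewrite -/p muP.
have [t tP] : exists t, idm Y0 - @nt_app k A P (yoneda Y0) mu Y0 l = f \oc t.
  by apply/cokernel_proj0; rewrite -/p (nt_appB p) muP lP subrr.
pose th := idm Y1 - w \oc a - t \oc f.
have fth : f \oc th = 0.
  have E : @nt_app k A P (yoneda Y0) mu Y0 l \oc f = f \oc w \oc a.
    apply: etrans (_ : @nt_app k A P (yoneda Y0) mu Y1 (act f l) = _).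
      by rewrite nt_act.
    by rewrite aP nt_act wP.
  rewrite /th !compBr compm1 !compA -tP compBl comp1m E.
  by rewrite opprB addrC subrKA subrr.
have fws : f \oc (w \oc s) = 0.
  apply: etrans (_ : @nt_app k A P (yoneda Y0) mu W' (act s x) = _).
    by rewrite nt_act wP; exact: compA.
  by rewrite sx nt_app0.
have [S [BS]] := biprod_ex addA Y1 W'.
exists S, (th \oc bp1 BS + w \oc s \oc bp2 BS); split.
  by rewrite compDr !compA fth -(compA f) fws !comp0l addr0.
move=> T g fg.
have [v vP] : exists v, a \oc g = s \oc v.
  by apply: sker; rewrite actM -aP -actM fg act0l.
exists (bi1 BS \oc g + bi2 BS \oc v).
rewrite compDl !compDr !compA -!(compA _ _ (bi1 BS)) bp1i1 bp2i1.
rewrite -!(compA _ _ (bi2 BS)) bp1i2 bp2i2 !(comp0r, comp0l, compm1) addr0 add0r.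
rewrite -(compA w s) -vP /th !compBl comp1m -(compA t) fg comp0r subr0 compA.
by rewrite subrK.
Qed.

End WeakKernels.

(** * End terms of almost split sequences *)

Section AlmostSplitLocal.
Variables (k : comPzRingType) (C : kcat k).
Implicit Types X Y Z : C.

(** The maps to [Z] that are not retractions factor through [g], hence so do their
    sums. In [End Z] every retraction [a], with section [s], is invertible: [1 - s a]
    is not a retraction, so that [s a] is one and [s] is invertible. *)
Lemma right_almost_split_local Y Z (g : hom Y Z) :
  right_almost_split g -> local_end Z.
Proof.
move=> [ng gP].
have nretrD (a b : hom Z Z) : ~ retraction a -> ~ retraction b -> ~ retraction (a + b).
  move=> /gP[u <-] /gP[v <-] [s]; rewrite -compDr -compA => gs.
  by apply: ng; exists ((u + v) \oc s).
have nZ : ~ is_zero Z by move=> zZ; apply: ng; exists 0; rewrite comp0r zZ.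
have retr_iso (a : hom Z Z) : retraction a -> is_iso a.
  move=> [s as1]; apply: section_retraction_iso; last by exists s.
  have n1 : ~ retraction (idm Z - s \oc a).
    case=> x; rewrite compBl comp1m => H.
    apply: nZ; rewrite /is_zero -as1 -[a]compm1 -H !compBr.
    by rewrite !compA as1 comp1m subrr comp0l.
  case: (pselect (retraction (s \oc a))) => [[y sy]|nsa]; last first.
    case: (nretrD _ _ nsa n1); exists (idm Z); rewrite addrC subrK; exact: comp1m.
  exists s; rewrite -[LHS]compm1 -{1}sy !compA -(compA s a s) as1 compm1; exact: sy.
split=> // a b na nb iab; apply: (nretrD a b) (is_iso_retraction iab).
  by move/retr_iso.
by move/retr_iso.
Qed.

Lemma left_almost_split_local X Y (f : hom X Y) : left_almost_split f -> local_end X.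
Proof.
move=> [nf fP].
have nsecD (a b : hom X X) : ~ section a -> ~ section b -> ~ section (a + b).
  move=> /fP[u <-] /fP[v <-] [s]; rewrite -compDl compA => gs.
  by apply: nf; exists (s \oc (u + v)).
have nX : ~ is_zero X by move=> zX; apply: nf; exists 0; rewrite comp0l zX.
have sec_iso (a : hom X X) : section a -> is_iso a.
  move=> [s sa1]; apply: section_retraction_iso; first by exists s.
  have n1 : ~ section (idm X - a \oc s).
    case=> x; rewrite compBr compm1 => H.
    apply: nX; rewrite /is_zero -sa1 -[a]comp1m -H !compBl.
    by rewrite -!compA sa1 compm1 subrr comp0r.
  case: (pselect (section (a \oc s))) => [[y sy]|nsa]; last first.
    case: (nsecD _ _ nsa n1); exists (idm X); rewrite addrC subrK; exact: comp1m.
  exists s; rewrite -[LHS]comp1m -{1}sy -!compA (compA s a s) sa1 comp1m; exact: sy.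
split=> // a b na nb iab; apply: (nsecD a b) (is_iso_section iab).
  by move/sec_iso.
by move/sec_iso.
Qed.

Lemma split_five_iso (X Y Z X' Y' Z' : C) (f : hom X Y) (g : hom Y Z)
    (r : hom Y X) (s : hom Z Y) (f' : hom X' Y') (g' : hom Y' Z')
    (r' : hom Y' X') (s' : hom Z' Y') (a : hom X X') (b : hom Y Y') (c : hom Z Z') :
  g \oc f = 0 -> r \oc f = idm X -> g \oc s = idm Z -> f \oc r + s \oc g = idm Y ->
  g' \oc f' = 0 -> r' \oc f' = idm X' -> g' \oc s' = idm Z' ->
  f' \oc r' + s' \oc g' = idm Y' ->
  b \oc f = f' \oc a -> c \oc g = g' \oc b -> is_iso a -> is_iso c -> is_iso b.
Proof.
move=> gf rf gs fr gf' rf' gs' fr' bf cg [a' [a'a aa']] [c' [c'c cc']].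
pose d := f \oc a' \oc r' + (s - f \oc a' \oc r' \oc b \oc s) \oc c' \oc g'.
have db : d \oc b = idm Y.
  rewrite /d compDl -(compA _ g') -cg -!compA (compA c') c'c comp1m.
  rewrite compBl -!compA.
  have -> : s \oc g = idm Y - f \oc r by rewrite -fr addrC addKr.
  rewrite compBr compm1 (compA b f) bf !compBr !compA -(compA (f \oc a') r' f').
  rewrite rf' compm1 -(compA f a' a) a'a compm1 opprB addrC subrKA.
  by rewrite subrK.
have sec : section b by exists d.
apply: section_retraction_iso => //.
exists d; rewrite /d compDr !compA bf -(compA f' a a') aa' compm1.
rewrite compBr !compA bf -(compA f' a a') aa' compm1.
have -> : b \oc s - f' \oc r' \oc b \oc s = s' \oc c.
  rewrite -[in RHS](compm1 c) -gs (compA c) cg !compA.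
  have -> : s' \oc g' = idm Y' - f' \oc r' by rewrite -fr' addrC addKr.
  by rewrite !compBl comp1m.
by rewrite -(compA s' c) cc' compm1.
Qed.
End AlmostSplitLocal.

(** * Extensions of complexes and their classes *)

Section Extensions.
Variables (k : comPzRingType) (A : kcat k) (I : nzRingType).
Implicit Types X Y Z V : cplx A I.

(** Degree 1 maps [Z -> X] that commute with the differentials up to the sign -1:
    the chain maps from [Z] to the suspension of [X]. *)
Definition cocycle Z X (w : forall i j, hom (Z i) (X j)) : Prop :=
  (forall i j, j != i + 1 -> w i j = 0) /\
  forall i j l, cd X j l \oc w i j + w j l \oc cd Z i j = 0.

Definition coboundary Z X (w : forall i j, hom (Z i) (X j)) : Prop :=
  exists s : forall i, hom (Z i) (X i),
    forall i j, w i j = cd X i j \oc s i - s j \oc cd Z i j.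

Lemma cocycle_compr Z X V (w : forall i j, hom (Z i) (X j)) (h : chom V Z) :
  cocycle w -> cocycle (fun i j => w i j \oc cm h i).
Proof.
move=> [w0 wd]; split=> [i j /w0->|i j l]; first by rewrite comp0l.
by rewrite -compA -cmP !compA -compDl wd comp0l.
Qed.

Lemma cocycle_compl Z X V (w : forall i j, hom (Z i) (X j)) (h : chom X V) :
  cocycle w -> cocycle (fun i j => cm h j \oc w i j).
Proof.
move=> [w0 wd]; split=> [i j /w0->|i j l]; first by rewrite comp0r.
by rewrite compA cmP -!compA -compDr wd comp0r.
Qed.

Lemma coboundary_compr Z X V (w : forall i j, hom (Z i) (X j)) (h : chom V Z) :
  coboundary w -> coboundary (fun i j => w i j \oc cm h i).
Proof.
move=> [s sP]; exists (fun i => s i \oc cm h i) => i j.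
by rewrite sP compBl !compA -(compA (s j)) cmP compA.
Qed.

Lemma coboundary_compl Z X V (w : forall i j, hom (Z i) (X j)) (h : chom X V) :
  coboundary w -> coboundary (fun i j => cm h j \oc w i j).
Proof.
move=> [s sP]; exists (fun i => cm h i \oc s i) => i j.
by rewrite sP compBr !compA cmP.
Qed.

Lemma coboundaryD Z X (v w : forall i j, hom (Z i) (X j)) :
  coboundary v -> coboundary w -> coboundary (fun i j => v i j + w i j).
Proof.
move=> [s sP] [t tP]; exists (fun i => s i + t i) => i j.
by rewrite sP tP compDr compDl opprD addrACA.
Qed.

Lemma coboundaryN Z X (w : forall i j, hom (Z i) (X j)) :
  coboundary w -> coboundary (fun i j => - w i j).
Proof.
move=> [s sP]; exists (fun i => - s i) => i j.
by rewrite sP compNr compNl opprB opprK addrC.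
Qed.

Lemma coboundaryB Z X (v w : forall i j, hom (Z i) (X j)) :
  coboundary v -> coboundary w -> coboundary (fun i j => v i j - w i j).
Proof. by move=> cv /coboundaryN; exact: coboundaryD. Qed.

Lemma coboundary_sum Z X (T : eqType) (r : seq T)
    (w : T -> forall i j, hom (Z i) (X j)) :
  (forall t, t \in r -> coboundary (w t)) ->
  coboundary (fun i j => \sum_(t <- r) w t i j).
Proof.
elim: r => [|t r IH] wr.
  by exists (fun=> 0) => i j; rewrite big_nil comp0r comp0l subr0.
have [|s sP] := coboundaryD (wr t (mem_head _ _)) (IH _).
  by move=> u ur; apply: wr; rewrite inE ur orbT.
by exists s => i j; rewrite big_cons sP.
Qed.

Lemma eq_coboundary Z X (v w : forall i j, hom (Z i) (X j)) :
  (forall i j, v i j = w i j) -> coboundary v -> coboundary w.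
Proof. by move=> vw [s sP]; exists s => i j; rewrite -vw. Qed.

(** A conflation, together with splittings in all degrees and its class in the
    group of extensions. *)
Record extension X Z := Extension {
  x_mid : cplx A I;
  x_f : chom X x_mid;
  x_g : chom x_mid Z;
  x_r : forall i, hom (x_mid i) (X i);
  x_s : forall i, hom (Z i) (x_mid i);
  x_gf : forall i, cm x_g i \oc cm x_f i = 0;
  x_rf : forall i, x_r i \oc cm x_f i = idm (X i);
  x_gs : forall i, cm x_g i \oc x_s i = idm (Z i);
  x_sum : forall i, cm x_f i \oc x_r i + x_s i \oc cm x_g i = idm (x_mid i);
  x_cls : forall i j, hom (Z i) (X j);
  x_clsE : forall i j, x_cls i j = x_r j \oc cd x_mid i j \oc x_s i
}.

Section ExtensionTheory.
Variables (X Z : cplx A I) (E : extension X Z).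
Local Notation f := (x_f E).
Local Notation g := (x_g E).
Local Notation r := (x_r E).
Local Notation s := (x_s E).
Local Notation Y := (x_mid E).
Local Notation cls := (x_cls E).

Lemma x_rs i : r i \oc s i = 0.
Proof.
have : r i \oc idm (Y i) \oc s i = r i \oc s i by rewrite compm1.
rewrite -x_sum compDr compDl !compA x_rf comp1m -2!compA x_gs compm1.
by move/eqP; rewrite -subr_eq0 addrK => /eqP.
Qed.

Lemma x_ds i j : cd Y i j \oc s i = cm f j \oc cls i j + s j \oc cd Z i j.
Proof.
rewrite x_clsE !compA -[cd Y i j in LHS]comp1m -(x_sum E j) !compDl.
by congr (_ + _); rewrite -(compA (s j)) -cmP -!compA x_gs compm1.
Qed.

Lemma x_rd i j : r j \oc cd Y i j = cd X i j \oc r i + cls i j \oc cm g i.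
Proof.
rewrite x_clsE -[cd Y i j in LHS]compm1 -(x_sum E i) !compDr !compA.
by congr (_ + _); rewrite -(compA (r j)) cmP !compA x_rf comp1m.
Qed.

Lemma x_cls_shape i j : j != i + 1 -> cls i j = 0.
Proof. by move=> nij; rewrite x_clsE cd_shape // comp0r comp0l. Qed.

Lemma x_cls_cocycle : cocycle cls.
Proof.
split=> [i j|i j l]; first exact: x_cls_shape.
have H : (cd X j l \oc r j + cls j l \oc cm g j) \oc (cd Y i j \oc s i) = 0.
  by rewrite -x_rd -!compA (compA (cd Y j l)) cd_cd comp0l comp0r.
rewrite -[RHS]H x_ds compDl !compDr -!compA !(compA (r j)) x_rf comp1m x_rs comp0l.
by rewrite !(compA (cm g j)) x_gf x_gs comp0l !comp0r addr0 add0r comp1m.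
Qed.

(** The obstruction to lifting [h] is the class of the extension pulled back along [h]. *)
Lemma x_lift V (h : chom V Z) :
  (exists u : chom V Y, g \oc u = h) <-> coboundary (fun i j => cls i j \oc cm h i).
Proof.
split=> [[u <-]|[t tP]].
  exists (fun i => - (r i \oc cm u i)) => i j.
  rewrite cm_comp !compNr compNl opprK !compA.
  have -> : cls i j \oc cm g i = r j \oc cd Y i j - cd X i j \oc r i.
    by rewrite x_rd addrC addKr.
  by rewrite compBl -(compA (r j)) cmP compA addrC.
have uP i j : cd Y i j \oc (x_s E i \oc cm h i - cm f i \oc t i) =
    (x_s E j \oc cm h j - cm f j \oc t j) \oc cd V i j.
  rewrite compBr compBl !compA x_ds compDl -!compA tP cmP.
  rewrite (compA (cd Y i j)) cmP -!compA -cmP compBr.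
  rewrite addrAC (addrAC (cm f j \oc _)) subrr sub0r addrC //.
pose u : chom V Y := @CMap _ _ _ V Y _ uP.
exists u; apply: cmext => i; rewrite cm_comp /= compBr !compA x_gs comp1m.
by rewrite x_gf comp0l subr0.
Qed.

Lemma x_extend V (h : chom X V) :
  (exists u : chom Y V, u \oc f = h) <-> coboundary (fun i j => cm h j \oc cls i j).
Proof.
split=> [[u <-]|[t tP]].
  exists (fun i => cm u i \oc s i) => i j.
  rewrite cm_comp -compA.
  have -> : cm f j \oc cls i j = cd Y i j \oc s i - s j \oc cd Z i j.
    by rewrite x_ds addrK.
  by rewrite compBr !compA cmP.
have uP i j : cd V i j \oc (cm h i \oc r i + t i \oc cm g i) =
    (cm h j \oc r j + t j \oc cm g j) \oc cd Y i j.
  rewrite compDr compDl -!compA x_rd compDr !compA tP cmP.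
  by rewrite -(compA (t j)) -(cmP g) !compA compBl -addrA subrK.
pose u : chom Y V := @CMap _ _ _ Y V _ uP.
exists u; apply: cmext => i; rewrite cm_comp /= compDl -!compA x_rf compm1.
by rewrite x_gf comp0r addr0.
Qed.

Lemma x_g_retraction : retraction g <-> coboundary cls.
Proof.
split=> [[u gu]|cE].
  have /x_lift : exists u : chom Z Y, g \oc u = idm (Z : CplxCat A I) by exists u.
  by apply: eq_coboundary => i j; rewrite compm1.
apply/x_lift; apply: eq_coboundary cE => i j; exact: esym (compm1 _).
Qed.

Lemma x_f_section : section f <-> coboundary cls.
Proof.
split=> [[u uf]|cE].
  have /x_extend : exists u : chom Y X, u \oc f = idm (X : CplxCat A I) by exists u.
  by apply: eq_coboundary => i j; rewrite comp1m.
apply/x_extend; apply: eq_coboundary cE => i j; exact: esym (comp1m _).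
Qed.

End ExtensionTheory.

(** The push-out of [E] along [a] and the pull-back of [E'] along [c] are the same extension. *)
Lemma x_cls_morph X Z X' Z' (E : extension X Z) (E' : extension X' Z')
    (a : chom X X') (b : chom (x_mid E) (x_mid E')) (c : chom Z Z') :
  b \oc x_f E = x_f E' \oc a -> c \oc x_g E = x_g E' \oc b ->
  coboundary (fun i j => cm a j \oc x_cls E i j - x_cls E' i j \oc cm c i).
Proof.
move=> bf cg; exists (fun i => x_r E' i \oc cm b i \oc x_s E i) => i j.
have gbs : cm (x_g E') i \oc (cm b i \oc x_s E i) = cm c i.
  by rewrite compA -cm_comp -cg cm_comp -compA x_gs compm1.
rewrite [X in X - _ \oc _ = _](_ : _ = x_r E' j \oc cm b j \oc cd (x_mid E) i j \oc x_s E i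
   - x_r E' j \oc cm b j \oc x_s E j \oc cd Z i j); last first.
  rewrite -!compA x_ds !compDr addrK !compA -(compA (x_r E' j)) -cm_comp bf.
  by rewrite cm_comp !compA x_rf comp1m.
rewrite addrAC; congr (_ - _).
by rewrite -(compA (x_r E' j)) -cmP !compA x_rd !compDl -!compA gbs addrK.
Qed.

(** The five lemma holds in each degree. *)
Lemma x_five_iso X Z X' Z' (E : extension X Z) (E' : extension X' Z')
    (a : chom X X') (b : chom (x_mid E) (x_mid E')) (c : chom Z Z') :
  b \oc x_f E = x_f E' \oc a -> c \oc x_g E = x_g E' \oc b ->
  is_iso a -> is_iso c -> is_iso b.
Proof.
move=> bf cg aiso ciso; apply: cplx_is_iso => i.
exact: (split_five_iso (x_gf E i) (x_rf E i) (x_gs E i) (x_sum E i)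
  (x_gf E' i) (x_rf E' i) (x_gs E' i) (x_sum E' i) (cm_eq bf i) (cm_eq cg i)
  (cm_is_iso aiso i) (cm_is_iso ciso i)).
Qed.

(** Up to a shift, the middle term is the cone of the cocycle. *)
Lemma cone_ex X Z (w : forall i j, hom (Z i) (X j)) :
  additive_cat A -> cocycle w ->
  exists E : extension X Z, forall i j, x_cls E i j = w i j.
Proof.
move=> addA [w0 wd].
have [Y YP] := choice_dep (fun i => biprod_ex addA (X i) (Z i)).
have [B _] := choice_dep (fun i => let: inhabits b := YP i in
  ex_intro (fun _ : biprod (X i) (Z i) (Y i) => True) b Logic.I).
pose d i j : hom (Y i) (Y j) := bi1 (B j) \oc cd X i j \oc bp1 (B i)
  + bi1 (B j) \oc w i j \oc bp2 (B i) + bi2 (B j) \oc cd Z i j \oc bp2 (B i).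
have d0 i j : j != i + 1 -> d i j = 0.
  by move=> nij; rewrite /d !cd_shape // w0 // !(comp0r, comp0l) !addr0.
have p1i1 i (V : A) (h : hom V _) : bp1 (B i) \oc (bi1 (B i) \oc h) = h.
  by rewrite compA bp1i1 comp1m.
have p2i2 i (V : A) (h : hom V _) : bp2 (B i) \oc (bi2 (B i) \oc h) = h.
  by rewrite compA bp2i2 comp1m.
have p1i2 i (V : A) (h : hom V _) : bp1 (B i) \oc (bi2 (B i) \oc h) = 0.
  by rewrite compA bp1i2 comp0l.
have p2i1 i (V : A) (h : hom V _) : bp2 (B i) \oc (bi1 (B i) \oc h) = 0.
  by rewrite compA bp2i1 comp0l.
have dp1 i j (V : A) (h : hom V _) : d i j \oc (bi1 (B i) \oc h) = bi1 (B j) \oc (cd X i j \oc h).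
  by rewrite /d !compDl -!compA p1i1 p2i1 !comp0r !addr0.
have dp2 i j (V : A) (h : hom V _) : d i j \oc (bi2 (B i) \oc h) =
    bi1 (B j) \oc (w i j \oc h) + bi2 (B j) \oc (cd Z i j \oc h).
  by rewrite /d !compDl -!compA p1i2 p2i2 !comp0r add0r.
have dd i j l : d j l \oc d i j = 0.
  rewrite {2}/d !compDr -!compA !dp1 dp2 !(compA (cd X j l)) !(compA (cd Z j l)) !cd_cd.
  rewrite !comp0l !comp0r add0r addr0 -compDr (compA (w j l)) -compDl.
  by rewrite wd comp0l comp0r.
pose YY : cplx A I := Cplx d0 dd.
have fP i j : cd YY i j \oc bi1 (B i) = bi1 (B j) \oc cd X i j.
  by rewrite -[bi1 (B i)]compm1 /= dp1 compm1.
have gP i j : cd Z i j \oc bp2 (B i) = bp2 (B j) \oc cd YY i j.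
  by rewrite /= /d !compDr -!compA !p2i1 p2i2 !add0r.
pose f : chom X YY := @CMap _ _ _ X YY _ fP.
pose g : chom YY Z := @CMap _ _ _ YY Z _ gP.
have wE i j : w i j = bp1 (B j) \oc cd YY i j \oc bi2 (B i).
  by rewrite /= -compA -[bi2 (B i)]compm1 dp2 compDr p1i1 p1i2 addr0 compm1.
by exists (@Extension X Z YY f g (fun i => bp1 (B i)) (fun i => bi2 (B i))
  (fun i => bp2i1 (B i)) (fun i => bp1i1 (B i)) (fun i => bp2i2 (B i))
  (fun i => bsum (B i)) w wE).
Qed.

Lemma x_mid_zero X Z (E : extension X Z) i :
  is_zero (X i) -> is_zero (Z i) -> is_zero (x_mid E i).
Proof.
move=> zX zZ; rewrite /is_zero -(x_sum E) (zero_domE (cm (x_f E) i) zX).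
by rewrite (zero_domE (x_s E i) zZ) !comp0l addr0.
Qed.

Lemma extension_of_split (S : sseq (CplxCat A I)) : degreewise_split S ->
  exists E : extension (s_fst S) (s_lst S),
    S = @SSeq _ (CplxCat A I) _ (x_mid E) _ (x_f E) (x_g E).
Proof.
case: S => X Y Z f g split.
have [r rP] := choice_dep (fun i => (split i).2).
have [s rsP] := choice_dep rP.
have gf i : cm g i \oc cm f i = 0 := (split i).1.
have rf i : r i \oc cm f i = idm (X i) by have [] := rsP i.
have gs i : cm g i \oc s i = idm (Z i) by have [] := rsP i.
have rs i : cm f i \oc r i + s i \oc cm g i = idm (Y i) by have [] := rsP i.
by exists (@Extension X Z Y f g r s gf rf gs rs _ (fun _ _ => erefl)).
Qed.

End Extensions.

(** * Almost split classes *)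

Section AlmostSplitClasses.
Variables (k : comPzRingType) (A : kcat k) (I : nzRingType).
Variable P : cplx A I -> Prop.
Implicit Types X Y Z V : cplx A I.

(** The cocycles that almost split sequences of complexes in [P] have as classes. *)
Definition almost_split_class X Z (w : forall i j, hom (Z i) (X j)) : Prop :=
  [/\ ~ coboundary w,
      forall V (h : chom V Z), P V -> ~ retraction h ->
        coboundary (fun i j => w i j \oc cm h i)
    & forall V (h : chom X V), P V -> ~ section h ->
        coboundary (fun i j => cm h j \oc w i j)].

(** Modulo coboundaries, [a w = w c] for the class [w]. As [w] is annihilated by all
    maps that are not sections or retractions but is itself not a coboundary, [a] is
    invertible if and only if [c] is. *)
Lemma almost_split_class_iso_end X Z (E : extension X Z) (b : chom (x_mid E) (x_mid E))
    (a : chom X X) (c : chom Z Z) :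
  almost_split_class (x_cls E) -> P X -> P Z ->
  local_end (X : CplxCat A I) -> local_end (Z : CplxCat A I) ->
  b \oc x_f E = x_f E \oc a -> c \oc x_g E = x_g E \oc b ->
  is_iso a \/ is_iso c -> is_iso b.
Proof.
move=> [nE rE lE] PX PZ locX locZ bf cg ac; have coh := x_cls_morph bf cg.
suff [aiso ciso] : is_iso a /\ is_iso c by exact: x_five_iso bf cg aiso ciso.
have isoP : is_iso a <-> is_iso c.
  split=> [[a' [a'a aa']]|[c' [c'c cc']]].
    apply: (local_retraction locZ); apply: contrapT => /(rE _ _ PZ) H; apply: nE.
    have := coboundary_compl (a' : chom X X) (coboundaryD coh H).
    apply: eq_coboundary => i j; rewrite /= subrK compA -cm_comp a'a; exact: comp1m.
  apply: (local_section locX); apply: contrapT => /(lE _ _ PX) H; apply: nE.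
  have := coboundary_compr (c' : chom Z Z) (coboundaryB H coh).
  apply: eq_coboundary => i j; rewrite /= subKr -compA -cm_comp cc'; exact: compm1.
by case: ac => /[dup] /isoP.
Qed.

(** An endomorphism of the middle term that is the identity on [X] induces an
    endomorphism of [Z]. *)
Lemma almost_split_class_left_minimal X Z (E : extension X Z) :
  almost_split_class (x_cls E) -> P X -> P Z ->
  local_end (X : CplxCat A I) -> local_end (Z : CplxCat A I) ->
  left_minimal (x_f E).
Proof.
move=> asE PX PZ locX locZ b bf.
have cP i j : cd Z i j \oc (cm (x_g E) i \oc cm b i \oc x_s E i) =
    (cm (x_g E) j \oc cm b j \oc x_s E j) \oc cd Z i j.
  rewrite !compA cmP -(compA (cm (x_g E) j)) cmP -!compA x_ds !compDr !compA.
  by rewrite -(compA _ (cm b j) (cm (x_f E) j)) -cm_comp bf x_gf comp0l add0r.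
pose c : chom Z Z := @CMap _ _ _ Z Z _ cP.
apply: (almost_split_class_iso_end (a := idm (X : CplxCat A I)) (c := c) asE) => //.
- by rewrite bf compm1.
- apply: cmext => i; rewrite !cm_comp /= -compA.
  have -> : x_s E i \oc cm (x_g E) i = idm _ - cm (x_f E) i \oc x_r E i.
    by rewrite -(x_sum E) addrC addKr.
  rewrite compBr compm1 !compA -(compA _ (cm b i) (cm (x_f E) i)) -(cm_comp b) bf x_gf comp0l.
  by rewrite subr0.
- by left; exact: is_iso_id.
Qed.

Lemma almost_split_class_right_minimal X Z (E : extension X Z) :
  almost_split_class (x_cls E) -> P X -> P Z ->
  local_end (X : CplxCat A I) -> local_end (Z : CplxCat A I) ->
  right_minimal (x_g E).
Proof.
move=> asE PX PZ locX locZ b gb.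
have aP i j : cd X i j \oc (x_r E i \oc cm b i \oc cm (x_f E) i) =
    (x_r E j \oc cm b j \oc cm (x_f E) j) \oc cd X i j.
  rewrite -!compA -cmP (compA (cm b j)) -cmP -!compA (compA (x_r E j)) x_rd compDl.
  by rewrite -!compA (compA (cm (x_g E) i)) -(cm_comp (x_g E)) gb x_gf comp0r addr0.
pose a : chom X X := @CMap _ _ _ X X _ aP.
apply: (almost_split_class_iso_end (a := a) (c := idm (Z : CplxCat A I)) asE) => //.
- apply: cmext => i; rewrite !cm_comp /= !compA.
  have -> : cm (x_f E) i \oc x_r E i = idm _ - x_s E i \oc cm (x_g E) i.
    by rewrite -(x_sum E) addrK.
  rewrite !compBl comp1m -!compA (compA (cm (x_g E) i)) -(cm_comp (x_g E)) gb x_gf comp0r.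
  by rewrite subr0.
- by rewrite gb comp1m.
- by right; exact: is_iso_id.
Qed.

Lemma almost_split_class_of_sequence X Z (E : extension X Z) :
  left_almost_split (x_f E) -> right_almost_split (x_g E) -> almost_split_class (x_cls E).
Proof.
move=> [_ lE] [ng rE]; split.
- by move/x_g_retraction.
- by move=> V h _ /rE/x_lift.
- by move=> V h _ /lE/x_extend.
Qed.

End AlmostSplitClasses.

Section Reflection.
Variables (k : comPzRingType) (C D : kcat k) (Phi : kfunctor C D).

Definition almost_split_maps (B : kcat k) (E : sseq B) : Prop :=
  [/\ left_minimal (s_f E), left_almost_split (s_f E),
      right_minimal (s_g E) & right_almost_split (s_g E)].

Hypothesis faithful : forall (X Y : C) (f g : hom X Y), fmap Phi f = fmap Phi g -> f = g.
Hypothesis full : forall (X Y : C) (g : hom (Phi X) (Phi Y)), exists f, fmap Phi f = g.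

Lemma reflect_is_iso (X Y : C) (f : hom X Y) : is_iso (fmap Phi f) -> is_iso f.
Proof.
move=> [g [gf fg]]; have [h hg] := full g.
by exists h; split; apply: faithful; rewrite fmapM fmap1 hg.
Qed.

Lemma reflect_almost_split_maps (E : sseq C) :
  almost_split_maps (map_sseq Phi E) -> almost_split_maps E.
Proof.
move=> [lm [nf lf] rm [ng rg]]; split.
- move=> u uf; apply: reflect_is_iso; apply: lm; rewrite /= -fmapM uf //.
- split=> [[u uf]|W h nh]; first by apply: nf; exists (fmap Phi u); rewrite /= -fmapM uf fmap1.
  have [|u uh] := lf (Phi W) (fmap Phi h).
    by move=> [s sh]; apply: nh; have [t ts] := full s; exists t; apply: faithful;
      rewrite fmapM fmap1 ts.
  by have [v vu] := full u; exists v; apply: faithful; rewrite fmapM vu.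
- move=> u uf; apply: reflect_is_iso; apply: rm; rewrite /= -fmapM uf //.
- split=> [[u uf]|W h nh]; first by apply: ng; exists (fmap Phi u); rewrite /= -fmapM uf fmap1.
  have [|u uh] := rg (Phi W) (fmap Phi h).
    by move=> [s sh]; apply: nh; have [t ts] := full s; exists t; apply: faithful;
      rewrite fmapM fmap1 ts.
  by have [v vu] := full u; exists v; apply: faithful; rewrite fmapM vu.
Qed.

End Reflection.

Lemma almost_split_maps_iso (k : comPzRingType) (C : kcat k) (E E' : sseq C) :
  sseq_iso E E' -> almost_split_maps E -> almost_split_maps E'.
Proof.
case: E E' => [X Y Z f g] [X' Y' Z' f' g'] [/= a [b [c [[a' [a'a aa']] [b' [b'b bb']]
  [c' [c'c cc']] bf cg]]]] [/= lm [nf lf] rm [ng rg]].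
have f'E : f' = b \oc f \oc a' by rewrite bf -compA aa' compm1.
have g'E : g' = c \oc g \oc b' by rewrite cg -compA bb' compm1.
split.
- move=> u; rewrite /= f'E => uf.
  have : is_iso (b' \oc u \oc b).
    apply: lm; have := congr1 (fun h => b' \oc h \oc a) uf.
    by rewrite !compA -!(compA _ a' a) a'a !compm1 b'b comp1m.
  move/(is_iso_compKr (_ : is_iso b)) => H; apply: (@is_iso_compKl _ _ _ _ _ b').
    by exists b.
  by apply: H; exists b'.
- split=> /= [[u uf]|W h nh].
    apply: nf; exists (a' \oc u \oc b); rewrite -compA bf -!compA (compA u) uf comp1m //.
  have [|u uh] := lf W (h \oc a).
    move=> [s sh]; apply: nh; exists (a \oc s).
    by rewrite -[h]compm1 -aa' -!compA (compA h) (compA s) sh comp1m.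
  by exists (u \oc b'); rewrite f'E -!compA (compA b') b'b comp1m compA uh -compA aa' compm1.
- move=> u; rewrite /= g'E => uf.
  have : is_iso (b' \oc u \oc b).
    apply: rm; have := congr1 (fun h => c' \oc h \oc b) uf.
    by rewrite !compA c'c comp1m -(compA _ b' b) b'b compm1.
  move/(is_iso_compKr (_ : is_iso b)) => H; apply: (@is_iso_compKl _ _ _ _ _ b').
    by exists b.
  by apply: H; exists b'.
- split=> /= [[u uf]|W h nh].
    by apply: ng; exists (b' \oc u \oc c); rewrite !compA -[g]comp1m -c'c -!compA (compA c) cg
     -!compA (compA b) bb' comp1m (compA g') uf comp1m.
  have [|u uh] := rg W (c' \oc h).
    move=> [s sh]; apply: nh; exists (s \oc c').
    by rewrite -[h]comp1m -cc' -!compA (compA h) (compA c') (compA c' h) sh comp1m.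
  by exists (b \oc u); rewrite g'E -!compA (compA b') b'b comp1m uh compA cc' comp1m.
Qed.

(** * Truncations and shifts of complexes *)

Section Deltas.
Variables (k : comPzRingType) (C : kcat k) (T : eqType) (F : T -> C).

Lemma delta_compL a b c : b = c -> delta F b c \oc delta F a b = delta F a c.
Proof. by move->; rewrite delta_id comp1m. Qed.

Lemma delta_compR a b c : a = b -> delta F b c \oc delta F a b = delta F a c.
Proof. by move->; rewrite delta_id compm1. Qed.

Lemma delta_natural (G : T -> C) (f : forall i, hom (F i) (G i)) i j :
  delta G i j \oc f i = f j \oc delta F i j.
Proof. exact: diag_mxE. Qed.

Lemma delta_reindex (U : eqType) (h : U -> T) i j : injective h ->
  delta (fun u => F (h u)) i j = delta F (h i) (h j).
Proof.
move=> injh; have [->|nij] := eqVneq i j; first by rewrite !delta_id.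
by rewrite !delta_neq // (inj_eq injh).
Qed.

End Deltas.

Section ComplexTools.
Variables (k : comPzRingType) (A : kcat k).

Lemma cmap_adjacent (I : nzRingType) (X Y : cplx A I) (f : forall i, hom (X i) (Y i)) :
  (forall i j, j = i + 1 -> cd Y i j \oc f i = f j \oc cd X i j) ->
  forall i j, cd Y i j \oc f i = f j \oc cd X i j.
Proof.
move=> H i j; have [/H//|nij] := eqVneq j (i + 1).
by rewrite !cd_shape // comp0l comp0r.
Qed.

Lemma cd_delta (I : nzRingType) (X : cplx A I) a a' c c' :
  a' = a + 1 -> c' = c + 1 ->
  cd X c c' \oc delta (cx X) a c = delta (cx X) a' c' \oc cd X a a'.
Proof.
move=> -> ->; have [->|nac] := eqVneq a c; first by rewrite !delta_id comp1m compm1.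
by rewrite !delta_neq ?comp0l ?comp0r // (inj_eq (addIr 1)).
Qed.

Lemma cplx_additive (I : nzRingType) : additive_cat A -> additive_cat (CplxCat A I).
Proof.
move=> addA r F.
have [S SP] := choice_dep (fun i => addA r (fun l => (F l : cplx A I) i)).
have [D _] := choice_dep (fun i => let: inhabits b := SP i in
  ex_intro (fun _ : dsum (fun l => (F l : cplx A I) i) (S i) => True) b Logic.I).
pose d i j : hom (S i) (S j) :=
  \sum_l (ds_in (D j) l \oc cd (F l) i j \oc ds_pr (D i) l).
have prin j l : ds_pr (D j) l \oc ds_in (D j) l = idm (cx (F l) j) := ds_prin (D j) l.
have prin0 j l l' : l != l' -> ds_pr (D j) l' \oc ds_in (D j) l = 0 := @ds_prin0 _ _ _ _ _ (D j) l l'.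
have pd i j l : ds_pr (D j) l \oc d i j = cd (F l) i j \oc ds_pr (D i) l.
  rewrite /d comp_sumr (bigD1 l) //= big1 ?addr0; first by rewrite !compA prin comp1m.
  by move=> l' nl; rewrite !compA prin0 // !comp0l.
have di i j l : d i j \oc ds_in (D i) l = ds_in (D j) l \oc cd (F l) i j.
  rewrite /d comp_suml (bigD1 l) //= big1 ?addr0; first by rewrite -!compA prin compm1.
  by move=> l' nl; rewrite -!compA prin0 1?eq_sym // !comp0r.
have d0 i j : j != i + 1 -> d i j = 0.
  by move=> nij; rewrite /d big1 // => l _; rewrite cd_shape // comp0r comp0l.
have dd i j l : d j l \oc d i j = 0.
  rewrite {2}/d comp_sumr big1 // => t _.
  by rewrite !compA di -!compA (compA (cd (F t) j l)) (cd_cd (F t)) comp0l comp0r.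
pose SS : cplx A I := Cplx d0 dd.
pose ii l : chom (F l) SS := @CMap _ _ _ (F l) SS (fun i => ds_in (D i) l) (fun i j => di i j l).
pose pp l : chom SS (F l) := @CMap _ _ _ SS (F l) (fun i => ds_pr (D i) l)
  (fun i j => esym (pd i j l)).
exists SS; constructor; apply: (@DSum _ (CplxCat A I) _ F SS (enum 'I_r) ii pp).
- exact: enum_uniq.
- by move=> l; apply: cmext => i; exact: prin.
- by move=> l l' nl; apply: cmext => i; exact: prin0.
- apply: cmext => i; rewrite cm_sum big_enum; exact: (ds_sum_fin (D i)).
Qed.

Section Truncation.
Variables (I : nzRingType) (O : A) (S : pred I) (X : cplx A I).
Hypothesis zO : is_zero O.

Definition trunc_ob j : A := if S j then X j else O.
Definition trunc_in j : hom (X j) (trunc_ob j) :=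
  if S j as b return hom (X j) (if b then X j else O) then idm (X j) else 0.
Definition trunc_pr j : hom (trunc_ob j) (X j) :=
  if S j as b return hom (if b then X j else O) (X j) then idm (X j) else 0.

Lemma trunc_inpr j : trunc_in j \oc trunc_pr j = idm (trunc_ob j).
Proof.
rewrite /trunc_in /trunc_pr /trunc_ob; case: (S j); first exact: comp1m.
by rewrite comp0l zO.
Qed.

Lemma trunc_prin j : S j -> trunc_pr j \oc trunc_in j = idm (X j).
Proof.
by rewrite /trunc_in /trunc_pr /trunc_ob; case: (S j) => // _; exact: comp1m.
Qed.

Lemma trunc_out j : ~~ S j -> is_zero (trunc_ob j).
Proof. by rewrite /trunc_ob => /negPf->. Qed.

(** The brutal truncation of [X] to the degrees in [S]. *)
Definition trunc : cplx A I.
Proof.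
exists trunc_ob (fun i j => trunc_in j \oc cd X i j \oc trunc_pr i) => [i j nij|i j l].
  by rewrite cd_shape // comp0r comp0l.
rewrite !compA -(compA _ (trunc_pr j)); case: (boolP (S j)) => Sj.
  by rewrite trunc_prin // compm1 -(compA _ (cd X j l)) cd_cd comp0r comp0l.
by rewrite (zero_domE (trunc_pr j) (trunc_out Sj)) comp0l comp0r !comp0l.
Defined.

End Truncation.

Section UnsignedShift.
Variable q : int.

Definition ush_ob (X : cplx A int) : cplx A int.
Proof.
exists (fun i => X (i + q)) (fun i j => cd X (i + q) (j + q)) => [i j nij|i j l].
  by apply: cd_shape; rewrite addrAC (inj_eq (addIr q)).
exact: cd_cd.
Defined.

Definition ush_map (X Y : cplx A int) (f : cmap X Y) : cmap (ush_ob X) (ush_ob Y).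
Proof. by exists (fun i => f (i + q)) => i j; exact: (cmP f (i + q) (j + q)). Defined.

(** Without the sign on the differential, a shift by a multiple of the period does
    not change the compression. *)
Definition ush : kfunctor (CplxCat A int) (CplxCat A int).
Proof.
apply: (@KFunctor k (CplxCat A int) (CplxCat A int) ush_ob (fun X Y f => ush_map f)).
- by move=> X; apply: cmext.
- by move=> X Y Z g f; apply: cmext.
- by move=> X Y a f g; apply: cmext.
Defined.

Lemma delta_ush (X : cplx A int) i j : delta (cx (ush_ob X)) i j = delta (cx X) (i + q) (j + q).
Proof. exact: delta_reindex (addIr q). Qed.

Lemma ush_full (X Y : cplx A int) (g : chom (ush X) (ush Y)) : exists f : chom X Y, fmap ush f = g.
Proof.
pose f j : hom (X j) (Y j) :=
  delta (cx Y) (j - q + q) j \oc cm g (j - q) \oc delta (cx X) j (j - q + q).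
have fP i j : cd Y i j \oc f i = f j \oc cd X i j.
  move: i j; apply: cmap_adjacent => i j ij; rewrite /f !compA.
  rewrite (@cd_delta _ Y (i - q + q) (j - q + q) i j); [|lia|lia].
  rewrite -(compA _ (cd Y _ _)) (cmP (g : cmap (ush_ob X) (ush_ob Y)) (i - q) (j - q)) /=.
  rewrite -!compA; do 2!congr (_ \oc _).
  by apply: cd_delta; lia.
exists (@CMap _ _ _ X Y f fP); apply: cmext => i /=; rewrite /f.
have E : i + q - q = i by rewrite addrK.
rewrite -!delta_ush (delta_natural (cm g)) -compA.
rewrite -[RHS]compm1; congr (_ \oc _).
exact: (etrans (@delta_compL _ _ _ (cx (ush_ob X)) i (i + q - q) i E) (delta_id _ _)).
Qed.

Lemma ush_faithful (X Y : cplx A int) (f g : chom X Y) : fmap ush f = fmap ush g -> f = g.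
Proof.
move=> fg; apply: cmext => i; have := cm_eq fg (i - q) => /= {}fg.
have H (h : chom X Y) : cm h i = delta (cx Y) (i - q + q) i \oc cm h (i - q + q) \oc
    delta (cx X) i (i - q + q).
  by rewrite (delta_natural (cm h)) -compA delta_compL ?subrK // delta_id compm1.
by rewrite (H f) (H g) fg.
Qed.

End UnsignedShift.

Lemma full_faithful_local (C D : kcat k) (Phi : kfunctor C D) (X : C) :
  (forall f g : hom X X, fmap Phi f = fmap Phi g -> f = g) ->
  (forall g : hom (Phi X) (Phi X), exists f, fmap Phi f = g) ->
  local_end X -> local_end (Phi X).
Proof.
move=> faith full [nX locX].
have isoP (f : hom X X) : is_iso (fmap Phi f) <-> is_iso f.
  split=> [[g [gf fg]]|[g [gf fg]]].
    have [h hg] := full g.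
    by exists h; split; apply: faith; rewrite fmapM fmap1 hg.
  by exists (fmap Phi g); rewrite -!fmapM gf fg !fmap1.
have fmapD (f g : hom X X) : fmap Phi (f + g) = fmap Phi f + fmap Phi g.
  by have := fmap_lin Phi 1 f g; rewrite !scale1r.
split.
  move=> z; apply: nX; apply: faith; rewrite fmap1 z.
  by have := fmapD 0 0; rewrite addr0 -[LHS]addr0 => /addrI.
move=> f g; have [f' <-] := full f; have [g' <-] := full g.
by rewrite -fmapD => nf ng /isoP; apply: locX => /isoP.
Qed.

(** Otherwise the support of [B], which is finite and nonempty, would be closed under
    translation by [q' - q]. *)
Lemma ush_support_eq (B : cplx A int) q q' : bounded B -> ~ is_zero (B : CplxCat A int) ->
  (forall i, is_zero (B (i + q')) -> is_zero (B (i + q))) -> q = q'.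
Proof.
move=> [a [b abB]] nB H; apply/eqP; apply: contrapT => /negP nq; apply: nB.
apply/cplx_is_zero => j; apply: contrapT => nj.
have iterH N : ~ is_zero (B (j + N%:Z * (q' - q))).
  elim: N => [|N IH]; first by rewrite mul0r addr0.
  move=> z; apply: IH; have := H (j + N%:Z * (q' - q) - q).
  rewrite subrK; apply; rewrite (_ : _ + q' = j + N.+1%:Z * (q' - q)) //.
  by rewrite -addn1 PoszD mulrDl mul1r; lia.
pose N := (absz a + absz b + absz j).+1.
apply: (iterH N); apply: abB.
have : (N <= absz (N%:Z * (q' - q))%R)%N by rewrite abszM leq_pmulr //; lia.
move: (N%:Z * (q' - q)) => s; rewrite /N; lia.
Qed.

End ComplexTools.

(** * Unrolling and compression *)

Section Compressions.
Variables (k : comPzRingType) (A : kcat k) (I : nzRingType).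
Implicit Types (B : cplx A int) (W M : cplx A I).

Definition res (i : int) : I := i%:~R.

Lemma resS i j : j = i + 1 -> res j = res i + 1.
Proof. by move=> ->; rewrite /res intrD. Qed.

Lemma res_sub0 i j : res j = res i -> res (j - i) = 0.
Proof. by rewrite /res intrB => ->; exact: subrr. Qed.

Lemma res_shift q i : res q = 0 -> res (i + q) = res i.
Proof. by rewrite /res intrD => ->; rewrite addr0. Qed.

Definition unroll M : cplx A int.
Proof.
exists (fun i => M (res i)) (fun i j => if j == i + 1 then cd M (res i) (res j) else 0).
  by move=> i j /negPf->.
move=> i j l; case: ifP => _; last by rewrite comp0l.
by case: ifP => _; [rewrite cd_cd|rewrite comp0r].
Defined.

Lemma unroll_cd M i j : j = i + 1 -> cd (unroll M) i j = cd M (res i) (res j).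
Proof. by move=> -> /=; rewrite eqxx. Qed.

Definition unroll_map W M (f : chom W M) : chom (unroll W) (unroll M).
Proof.
exists (fun i => cm f (res i)); apply: cmap_adjacent => i j ij.
by rewrite !unroll_cd //; exact: (cmP (f : cmap W M) (res i) (res j)).
Defined.

(** [W] is the compression of [B]: in each degree [c] it is the direct sum of the
    components of [B] in the degrees over [c], with the differential of [B]. This
    determines [W] up to isomorphism only, and so is invariant under isomorphisms. *)
Record compression_of B W := CompressionOf {
  cin : chom B (unroll W);
  cpr : chom (unroll W) B;
  csupp : seq int;
  csupp_uniq : uniq csupp;
  cprin : forall i j, (cm cpr j : hom (W (res j)) (B j)) \oc delta (cx W) (res i) (res j)
    \oc (cm cin i : hom (B i) (W (res i))) = delta (cx B) i j;
  csum : forall c, \sum_(i <- csupp) (delta (cx W) (res i) c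
    \oc (cm cin i : hom (B i) (W (res i))) \oc (cm cpr i : hom (W (res i)) (B i))
    \oc delta (cx W) c (res i)) = idm (W c)
}.

Section OneCompression.
Variables (B : cplx A int) (W : cplx A I) (K : compression_of B W).

Definition ci i : hom (B i) (W (res i)) := cm (cin K) i.
Definition cp i : hom (W (res i)) (B i) := cm (cpr K) i.

Lemma cp_ci i j : cp j \oc delta (cx W) (res i) (res j) \oc ci i = delta (cx B) i j.
Proof. exact: cprin. Qed.

Lemma cp_ci1 i : cp i \oc ci i = idm (B i).
Proof. by have := cp_ci i i; rewrite !delta_id compm1. Qed.

Lemma ci_cp_sum c : \sum_(i <- csupp K)
  (delta (cx W) (res i) c \oc ci i \oc cp i \oc delta (cx W) c (res i)) = idm (W c).
Proof. exact: csum. Qed.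

Lemma ci_cd i j : j = i + 1 -> cd W (res i) (res j) \oc ci i = ci j \oc cd B i j.
Proof. by move=> ij; rewrite -unroll_cd //; exact: (cmP (cin K)). Qed.

Lemma cp_cd i j : j = i + 1 -> cd B i j \oc cp i = cp j \oc cd W (res i) (res j).
Proof. by move=> ij; rewrite -[in RHS]unroll_cd //; exact: (cmP (cpr K)). Qed.

Lemma csupp_zero i : i \notin csupp K -> is_zero (B i).
Proof.
move=> ni; rewrite /is_zero -cp_ci1 -[ci i]comp1m -(ci_cp_sum (res i)).
rewrite comp_suml comp_sumr big_seq big1 // => j js.
rewrite -!compA (compA (cp j)) cp_ci (@delta_neq _ _ _ (cx B)) ?comp0r //.
by apply: contraNneq ni => ->.
Qed.

Lemma ci_jointly_epi c (V : A) (f g : hom (W c) V) :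
  (forall j, f \oc delta (cx W) (res j) c \oc ci j = g \oc delta (cx W) (res j) c \oc ci j) ->
  f = g.
Proof.
move=> fg; rewrite -[f]compm1 -[g]compm1 -ci_cp_sum !comp_sumr.
by apply: eq_bigr => j _; rewrite !compA fg.
Qed.

Lemma cp_jointly_mono c (V : A) (f g : hom V (W c)) :
  (forall j, cp j \oc (delta (cx W) c (res j) \oc f) = cp j \oc (delta (cx W) c (res j) \oc g)) ->
  f = g.
Proof.
move=> fg; rewrite -[f]comp1m -[g]comp1m -ci_cp_sum !comp_suml.
by apply: eq_bigr => j _; rewrite -!compA fg.
Qed.

(** The unrolling is right adjoint to the compression. *)
Lemma compression_lift M (phi : chom B (unroll M)) :
  exists h : chom W M, unroll_map h \oc cin K = phi.
Proof.
pose p i : hom (B i) (M (res i)) := cm phi i.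
pose h c : hom (W c) (M c) := \sum_(i <- csupp K)
  (delta (cx M) (res i) c \oc p i \oc cp i \oc delta (cx W) c (res i)).
have hE c j : h c \oc delta (cx W) (res j) c \oc ci j = delta (cx M) (res j) c \oc p j.
  rewrite /h !comp_suml; have [<-|njc] := eqVneq (res j) c; last first.
    rewrite (@delta_neq _ _ _ (cx M) _ _ njc) comp0l big1 // => i _.
    by rewrite (@delta_neq _ _ _ (cx W) _ _ njc) comp0r comp0l.
  rewrite (@delta_id _ _ _ (cx M)) comp1m.
  have E i : delta (cx M) (res i) (res j) \oc p i \oc cp i \oc delta (cx W) (res j) (res i)
      \oc delta (cx W) (res j) (res j) \oc ci j =
      delta (cx M) (res i) (res j) \oc p i \oc delta (cx B) j i.
    by rewrite delta_id compm1 -!compA (compA (cp i)) cp_ci.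
  under eq_bigr => i _ do rewrite E.
  case: (boolP (j \in csupp K)) => jK.
    rewrite (bigD1_seq j) ?csupp_uniq //= big1 ?addr0; first by rewrite !delta_id comp1m compm1.
    by move=> i nij; rewrite (@delta_neq _ _ _ (cx B)) 1?eq_sym // comp0r.
  rewrite (zero_domE (p j) (csupp_zero jK)) big1 // => i _.
  by rewrite (zero_domE (delta (cx B) j i) (csupp_zero jK)) comp0r.
have hP : forall c c', cd M c c' \oc h c = h c' \oc cd W c c'.
  apply: cmap_adjacent => c c' cc'; apply: ci_jointly_epi => j.
  have jj : res (j + 1) = res j + 1 by exact: resS.
  rewrite -!(compA (cd M c c')) hE compA (cd_delta M jj cc').
  rewrite -(compA (h c')) (cd_delta W jj cc') compA -(compA _ _ (ci j)) ci_cd //.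
  rewrite !compA hE -!compA; congr (_ \oc _).
  by rewrite -unroll_cd //; exact: (cmP phi).
exists (@CMap _ _ _ W M h hP); apply: cmext => j.
by have := hE (res j) j; rewrite !delta_id compm1 comp1m.
Qed.

(** The unrolling is also left adjoint to the compression. *)
Lemma compression_colift M (phi : chom (unroll M) B) :
  exists h : chom M W, cpr K \oc unroll_map h = phi.
Proof.
pose p i : hom (M (res i)) (B i) := cm phi i.
pose h c : hom (M c) (W c) := \sum_(i <- csupp K)
  (delta (cx W) (res i) c \oc ci i \oc p i \oc delta (cx M) c (res i)).
have hE c j : cp j \oc (delta (cx W) c (res j) \oc h c) = p j \oc delta (cx M) c (res j).
  rewrite /h !comp_sumr; have [->|njc] := eqVneq c (res j); last first.
    rewrite (@delta_neq _ _ _ (cx M) _ _ njc) comp0r big1 // => i _.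
    by rewrite (@delta_neq _ _ _ (cx W) _ _ njc) comp0l comp0r.
  rewrite (@delta_id _ _ _ (cx M)) compm1.
  have E i : cp j \oc (delta (cx W) (res j) (res j) \oc
      (delta (cx W) (res i) (res j) \oc ci i \oc p i \oc delta (cx M) (res j) (res i))) =
      delta (cx B) i j \oc (p i \oc delta (cx M) (res j) (res i)).
    by rewrite delta_id comp1m !compA cp_ci.
  under eq_bigr => i _ do rewrite E.
  case: (boolP (j \in csupp K)) => jK.
    rewrite (bigD1_seq j) ?csupp_uniq //= big1 ?addr0; first by rewrite !delta_id comp1m compm1.
    by move=> i nij; rewrite (@delta_neq _ _ _ (cx B)) // comp0l.
  rewrite (zero_codE (p j) (csupp_zero jK)) big1 // => i _.
  by rewrite (zero_codE (delta (cx B) i j) (csupp_zero jK)) comp0l.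
have hP : forall c c', cd W c c' \oc h c = h c' \oc cd M c c'.
  apply: cmap_adjacent => c c' cc'; apply: cp_jointly_mono => j.
  have jj : res j = res (j - 1) + 1 by apply: resS; rewrite subrK.
  have dl N : delta (cx N) c' (res j) \oc cd N c c' =
      cd N (res (j - 1)) (res j) \oc delta (cx N) c (res (j - 1)).
    by rewrite (cd_delta N cc' jj).
  rewrite (compA (delta _ _ _)) dl -!compA (compA (cp j)) -cp_cd ?subrK //.
  rewrite -(compA (cd B _ _)) hE [delta _ _ _ \oc (h _ \oc _)]compA [cp j \oc _]compA hE.
  rewrite -!compA dl !compA; congr (_ \oc _).
  have E : j = j - 1 + 1 by rewrite subrK.
  by rewrite -(unroll_cd M E); exact: (cmP phi).
exists (@CMap _ _ _ M W h hP); apply: cmext => j.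
by have := hE (res j) j; rewrite !delta_id compm1 comp1m.
Qed.

Lemma compression_of_iso M (a : chom W M) : is_iso a -> inhabited (compression_of B M).
Proof.
move=> [a' [a'a aa']]; constructor.
apply: (@CompressionOf B M (unroll_map a \oc cin K) (cpr K \oc unroll_map (a' : chom M W)) (csupp K)).
- exact: csupp_uniq.
- move=> i j; rewrite -[RHS]cp_ci.
  have <- : cm a' (res j) \oc delta (cx M) (res i) (res j) \oc cm a (res i) =
      delta (cx W) (res i) (res j).
    rewrite -compA (delta_natural (cm a)) compA -cm_comp a'a; exact: comp1m.
  by rewrite !compA.
- move=> c; have aa'c : cm a c \oc cm a' c = idm (M c) by exact: (cm_eq aa' c).
  rewrite -[RHS]aa'c -[cm a c]compm1 -(ci_cp_sum c) comp_sumr comp_suml.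
  apply: eq_bigr => i _; rewrite !compA -(delta_natural (cm a)).
  by rewrite -!compA -(delta_natural (cm a')).
Qed.

End OneCompression.
End Compressions.

(** * Endomorphisms of a compression *)

Lemma eq_big_support (V : nmodType) (T : eqType) (s t : seq T) (F : T -> V) :
  uniq s -> uniq t -> (forall x, x \in s -> x \notin t -> F x = 0) ->
  (forall x, x \in t -> x \notin s -> F x = 0) ->
  \sum_(x <- s) F x = \sum_(x <- t) F x.
Proof.
move=> us ut st ts.
have sub (a b : seq T) : (forall x, x \in a -> x \notin b -> F x = 0) ->
    \sum_(x <- a) F x = \sum_(x <- [seq x <- a | x \in b]) F x.
  move=> ab; rewrite big_filter [LHS](bigID (mem b)) /= [X in _ + X]big_seq_cond.
  by rewrite [X in _ + X]big1 ?addr0 // => x /andP[xa xb]; exact: ab.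
rewrite (sub s t) // (sub t s) //; apply: perm_big; apply: uniq_perm.
- exact: filter_uniq.
- exact: filter_uniq.
- by move=> x; rewrite !mem_filter andbC.
Qed.

Section CompressionTheory.
Variables (k : comPzRingType) (A : kcat k) (I : nzRingType).
Implicit Types (B : cplx A int) (W M : cplx A I).
Local Notation res := (res I).

(** The structure maps of [W] as the compression of the shift of [B] by a multiple
    [q] of the period. *)
Definition sci B W (K : compression_of B W) q i : hom (B (i + q)) (W (res i)) :=
  delta (cx W) (res (i + q)) (res i) \oc ci K (i + q).
Definition scp B W (K : compression_of B W) q i : hom (W (res i)) (B (i + q)) :=
  cp K (i + q) \oc delta (cx W) (res i) (res (i + q)).

(** The multiples of the period are the kernel of [res], and only the residues of the
    degrees enter the compression. *)
Lemma compression_of_shift q B W (K : compression_of B W) : res q = 0 ->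
  exists K' : compression_of (ush_ob q B) W,
    (forall i, ci K' i = sci K q i) /\ (forall i, cp K' i = scp K q i).
Proof.
move=> q0; have rq i : res (i + q) = res i by exact: res_shift.
have ciP : forall i j, cd (unroll W) i j \oc sci K q i = sci K q j \oc cd (ush_ob q B) i j.
  apply: (@cmap_adjacent _ _ _ (ush_ob q B) (unroll W) (sci K q)) => i j ij.
  rewrite unroll_cd // /sci compA.
  have ijq : j + q = i + q + 1 by rewrite ij addrAC.
  by rewrite (cd_delta W (resS I ijq) (resS I ij)) -!compA (ci_cd K ijq).
have cpP : forall i j, cd (ush_ob q B) i j \oc scp K q i = scp K q j \oc cd (unroll W) i j.
  apply: (@cmap_adjacent _ _ _ (unroll W) (ush_ob q B) (scp K q)) => i j ij.
  rewrite unroll_cd // /scp -compA.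
  have ijq : j + q = i + q + 1 by rewrite ij addrAC.
  by rewrite -(cd_delta W (resS I ij) (resS I ijq)) !compA (cp_cd K ijq).
pose Ci : chom (ush_ob q B) (unroll W) := @CMap _ _ _ (ush_ob q B) (unroll W) _ ciP.
pose Cp : chom (unroll W) (ush_ob q B) := @CMap _ _ _ (unroll W) (ush_ob q B) _ cpP.
unshelve eexists (@CompressionOf _ _ _ (ush_ob q B) W Ci Cp [seq i - q | i <- csupp K] _ _ _) => //.
- by rewrite map_inj_uniq ?csupp_uniq //; exact: addIr.
- move=> i j; rewrite delta_ush -(cp_ci K) /= /scp /sci -!compA; congr (_ \oc _).
  by rewrite !compA delta_compL // delta_compR.
- move=> c; rewrite -[RHS](ci_cp_sum K) big_map; apply: eq_bigr => i _ /=.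
  rewrite /sci /scp !compA delta_compR // -!compA delta_compL // !compA.
  by rewrite subrK.
Qed.

(** The unrolling of [W] is the direct sum of all shifts of [B] by multiples of the
    period. In finitely many degrees, finitely many shifts suffice. *)
Lemma shift_sum B W (K : compression_of B W) (R : seq int) :
  exists Q : seq int, [/\ uniq Q, 0 \in Q, forall q, q \in Q -> res q = 0 &
    forall i, i \in R -> \sum_(q <- Q) (sci K q i \oc scp K q i) = idm (W (res i))].
Proof.
exists (undup (0 :: [seq q <- [seq j - i | i <- R, j <- csupp K] | res q == 0])).
split.
- exact: undup_uniq.
- by rewrite mem_undup mem_head.
- by move=> q; rewrite mem_undup inE mem_filter => /orP[/eqP->|/andP[/eqP]].
move=> i iR; rewrite -(ci_cp_sum K).
pose F j := delta (cx W) (res j) (res i) \oc ci K j \oc cp K j \oc delta (cx W) (res i) (res j).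
set Q := undup _; transitivity (\sum_(j <- [seq i + q | q <- Q]) F j).
  by rewrite big_map; apply: eq_bigr => q _; rewrite /F /sci /scp !compA.
apply: eq_big_support.
- by rewrite map_inj_uniq ?undup_uniq //; exact: addrI.
- exact: csupp_uniq.
- by move=> j _ /csupp_zero zj; rewrite /F (zero_domE (ci K j) zj) comp0r !comp0l.
- move=> j jK njQ; rewrite /F delta_neq ?comp0l //.
  apply: contraNneq njQ => rij; apply/mapP; exists (j - i); last by rewrite addrC subrK.
  rewrite mem_undup inE mem_filter; apply/orP; right.
  apply/andP; split; first by apply/eqP/res_sub0.
  by apply/allpairsP; exists (i, j).
Qed.

Hypothesis res_surj : forall c : I, exists i, res i = c.

(** An endomorphism of the compression of a local complex [B] whose component on
    [B] is the identity differs from the identity by a morphism in the radical, as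
    the shifts of [B] are not isomorphic to each other. *)
Lemma compression_endo_iso B W (K : compression_of B W) (c : chom W W) :
  additive_cat A -> bounded B -> local_end (B : CplxCat A int) ->
  cpr K \oc unroll_map c \oc cin K = idm (B : CplxCat A int) -> is_iso c.
Proof.
move=> addA bB locB c1; apply: cplx_is_iso => c0; have [p <-] := res_surj c0 => {c0}.
have [Q [uQ _ Q0 Qsum]] := shift_sum K [:: p].
pose t (l : 'I_(size Q)) := tnth (in_tuple Q) l.
have tQ l : res (t l) = 0 by apply: Q0; exact: mem_tnth.
have t_inj : injective t.
  move=> l l'; rewrite /t !(tnth_nth 0) => /eqP.
  by rewrite nth_uniq // => /eqP; exact: val_inj.
have [Kt KtP] := choice_dep (fun l => compression_of_shift K (tQ l)).
have [S [D]] := cplx_additive (I := int) addA (fun l => ush_ob (t l) B : CplxCat A int).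
pose al : chom S (unroll W) := \sum_l (cin (Kt l) \oc ds_pr D l).
pose be : chom (unroll W) S := \sum_l (ds_in D l \oc cpr (Kt l)).
have al_in l : al \oc ds_in D l = cin (Kt l).
  rewrite /al comp_suml (@big_only1 _ _ _ _ l) //.
    by rewrite -compA (ds_prin D) compm1.
  by move=> l' nl _; rewrite -compA (ds_prin0 D) 1?eq_sym // comp0r.
have pr_be l : ds_pr D l \oc be = cpr (Kt l).
  rewrite /be comp_sumr (@big_only1 _ _ _ _ l) //.
    by rewrite compA (ds_prin D) comp1m.
  by move=> l' nl _; rewrite compA (ds_prin0 D) // comp0l.
have entryE l l' i : cm (cpr (Kt l') \oc unroll_map c \oc cin (Kt l)) i =
    scp K (t l') i \oc cm c (res i) \oc sci K (t l) i.
  by rewrite !cm_comp -(KtP l).1 -(KtP l').2.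
have rt l i : res (i + t l) = res i by exact: res_shift.
have phi1 l : ds_pr D l \oc (be \oc unroll_map c \oc al) \oc ds_in D l = idm _.
  rewrite !compA pr_be -(compA _ al) al_in; apply: cmext => i.
  rewrite entryE /scp /sci !compA -(compA (cp K _)) (delta_natural (cm c)).
  rewrite -!compA (compA (delta _ _ _)) delta_compL // delta_id comp1m compA.
  exact: (cm_eq c1 (i + t l)).
have phir l l' : l != l' ->
    radical (ds_pr D l' \oc (be \oc unroll_map c \oc al) \oc ds_in D l).
  move=> nl; apply: local_radical.
    exact: (full_faithful_local (@ush_faithful _ _ (t l) B B) (@ush_full _ _ (t l) B B) locB).
  move=> g giso; case/negP: nl; apply/eqP/t_inj.
  apply: (ush_support_eq bB locB.1) => i zi.
  by apply: is_zero_iso0 (cm_is_iso giso i) _; rewrite cm_comp (zero_domE (cm g i) zi) comp0l.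
have := unipotent_iso phi1 phir => /cm_is_iso/(_ p).
have albe : cm al p \oc cm be p = idm (W (res p)).
  rewrite -[RHS]Qsum ?mem_head // [RHS](big_tnth _ _ Q) -cm_comp.
  have -> : al \oc be = \sum_l (cin (Kt l) \oc cpr (Kt l)).
    by rewrite /al comp_suml; apply: eq_bigr => l _; rewrite -compA pr_be.
  by rewrite cm_sum; apply: eq_bigr => l _; rewrite cm_comp -(KtP l).1 -(KtP l).2.
have cpr_cin l l' : l != l' -> cpr (Kt l') \oc cin (Kt l) = 0.
  move=> nl; apply: cmext => i; rewrite cm_comp -/(cp _ _) -/(ci _ _).
  have E : delta (cx W) (res i) (res (i + t l')) \oc delta (cx W) (res (i + t l)) (res i) =
      delta (cx W) (res (i + t l)) (res (i + t l')) by apply: delta_compR; exact: rt.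
  rewrite (KtP l).1 (KtP l').2 /scp /sci !compA -(compA (cp K _)) E.
  apply: (etrans (cp_ci K (i + t l) (i + t l'))).
  by rewrite delta_neq // (inj_eq (addrI i)) (inj_eq t_inj).
have beal : be \oc al = idm S.
  rewrite -(ds_sum_fin D) /be comp_suml; apply: eq_bigr => l _.
  rewrite -compA; congr (_ \oc _); rewrite /al comp_sumr (@big_only1 _ _ _ _ l) //.
    rewrite compA; have -> : cpr (Kt l) \oc cin (Kt l) = idm _.
      by apply: cmext => i; exact: (cp_ci1 (Kt l)).
    exact: comp1m.
  by move=> l' nl _; rewrite compA cpr_cin // comp0l.
rewrite !cm_comp => H.
have -> : cm c (res p) = cm al p \oc (cm be p \oc cm (unroll_map c) p \oc cm al p) \oc cm be p.
  by rewrite !compA albe comp1m -compA albe compm1.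
have {}beal : cm be p \oc cm al p = idm (cx S p) by exact: (cm_eq beal p).
apply: is_iso_comp; last by exists (cm al p).
by apply: is_iso_comp H; exists (cm be p).
Qed.

End CompressionTheory.

(** * The compression functor *)

Section DsumSupport.
Variables (k : comPzRingType) (C : kcat k) (I : eqType).
Variables (F : I -> C) (S : C) (DF : dsum F S).

Lemma ds_in0 i : i \notin ds_supp DF -> ds_in DF i = 0.
Proof. by move=> /ds_supp_zero; exact: zero_domE. Qed.

Lemma ds_pr0 i : i \notin ds_supp DF -> ds_pr DF i = 0.
Proof. by move=> /ds_supp_zero; exact: zero_codE. Qed.

End DsumSupport.

Section DsumMaps.
Variables (k : comPzRingType) (C : kcat k) (I J : eqType).
Variables (F : I -> C) (G : J -> C) (S T : C) (DF : dsum F S) (DG : dsum G T).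

Lemma dsum_map_in (M : forall i j, hom (F i) (G j)) i :
  dsum_map DF DG M \oc ds_in DF i = \sum_(j <- ds_supp DG) (ds_in DG j \oc M i j).
Proof.
rewrite /dsum_map comp_suml; case: (boolP (i \in ds_supp DF)) => iF; last first.
  rewrite big1 => [|i' _]; last by rewrite ds_in0 // comp0r.
  by rewrite big1 // => j _; rewrite (zero_domE (M i j) (ds_supp_zero iF)) comp0r.
rewrite (bigD1_seq i) ?ds_uniq //= [X in _ + X]big1 ?addr0 => [|i' ni].
  by rewrite comp_suml; apply: eq_bigr => j _; rewrite -compA ds_prin compm1.
rewrite comp_suml big1 // => j _.
by rewrite -compA ds_prin0 1?eq_sym // comp0r.
Qed.

Lemma pr_dsum_map (M : forall i j, hom (F i) (G j)) j :
  ds_pr DG j \oc dsum_map DF DG M = \sum_(i <- ds_supp DF) (M i j \oc ds_pr DF i).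
Proof.
rewrite /dsum_map comp_sumr; apply: eq_bigr => i _; rewrite comp_sumr.
case: (boolP (j \in ds_supp DG)) => jG; last first.
  rewrite (zero_codE (M i j) (ds_supp_zero jG)) comp0l big1 // => j' _.
  by rewrite ds_pr0 // comp0l.
rewrite (bigD1_seq j) ?ds_uniq //= big1 ?addr0 => [|j' nj].
  by rewrite !compA ds_prin comp1m.
by rewrite !compA ds_prin0 // !comp0l.
Qed.

End DsumMaps.

Section DsumDiag.
Variables (k : comPzRingType) (C : kcat k) (I : eqType).
Variables (F G H : I -> C) (S T U : C).
Variables (DF : dsum F S) (DG : dsum G T) (DH : dsum H U).

Lemma dsum_diag_in (f : forall i, hom (F i) (G i)) i :
  dsum_map DF DG (diag_mx f) \oc ds_in DF i = ds_in DG i \oc f i.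
Proof.
rewrite dsum_map_in; case: (boolP (i \in ds_supp DG)) => iG; last first.
  rewrite (zero_codE (f i) (ds_supp_zero iG)) comp0r big1 // => j _.
  by rewrite /diag_mx (zero_codE (f i) (ds_supp_zero iG)) !comp0r.
rewrite (bigD1_seq i) ?ds_uniq //= big1 ?addr0 => [|j nj].
  by rewrite /diag_mx delta_id comp1m.
by rewrite /diag_mx delta_neq 1?eq_sym // comp0l comp0r.
Qed.

Lemma dsum_diag_comp (g : forall i, hom (G i) (H i)) (f : forall i, hom (F i) (G i)) :
  dsum_map DG DH (diag_mx g) \oc dsum_map DF DG (diag_mx f) =
  dsum_map DF DH (diag_mx (fun i => g i \oc f i)).
Proof.
rewrite dsum_map_diagl; apply: eq_dsum_map => i j _ _.
by rewrite !diag_mxE compA.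
Qed.

End DsumDiag.

Section CompressionFunctor.
Variables (k : comPzRingType) (A : kcat k) (m : nat) (m_gt1 : (1 < m)%N).
Variable addA : additive_cat A.
Local Notation res := (res 'Z_m).

Lemma res_cidx (c : 'Z_m) t : res (cidx c t) = c.
Proof.
rewrite /res /cidx !(intrD, intrM) -!pmulrn.
have -> : (m%:R : 'Z_m) = 0 by exact: pchar_Zp.
by rewrite mulr0 addr0 natr_Zp.
Qed.

Lemma res_surj (c : 'Z_m) : exists i, res i = c.
Proof. by exists (cidx c 0); exact: res_cidx. Qed.

Lemma cidx_res i : cidx (res i) (i %/ m%:Z)%Z = i.
Proof.
have m0 : m%:Z != 0 by lia.
have r0 := modz_ge0 i m0; have rm := ltz_mod i m0.
have [r rE] : exists r : nat, (i %% m%:Z)%Z = r%:Z by exists (absz (i %% m%:Z)%Z); lia.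
have rlt : (r < m)%N by move: rm; rewrite rE; lia.
have -> : res i = r%:R.
  rewrite /res {1}(divz_eq i m%:Z) intrD intrM rE -!pmulrn.
  have -> : (m%:R : 'Z_m) = 0 by exact: pchar_Zp.
  by rewrite mulr0 add0r.
rewrite /cidx val_Zp_nat // modn_small // [RHS](divz_eq i m%:Z) rE addrC //.
Qed.

Lemma cidx_inj c : injective (@cidx m c).
Proof.
move=> s t; rewrite /cidx => /addrI /mulIf; apply; lia.
Qed.

Section OneComplex.
Variable X : Cb A.
Local Notation D := (compr_dsum m_gt1 addA X).
Local Notation W := (compr_cplx m_gt1 addA X).

Lemma compr_pr_in c c' s t :
  ds_pr (D c') t \oc delta (cx W) c c' \oc ds_in (D c) s =
  delta (cx (sval X)) (cidx c s) (cidx c' t).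
Proof.
have [<-|ncc] := eqVneq c c'; last first.
  rewrite !delta_neq ?comp0r ?comp0l //.
  by apply: contraNneq ncc => /(congr1 res); rewrite !res_cidx => ->.
rewrite delta_id compm1; have [<-|nst] := eqVneq s t.
  by rewrite delta_id; exact: (ds_prin (D c)).
rewrite delta_neq ?(inj_eq (@cidx_inj c)) //; exact: (ds_prin0 (D c)).
Qed.

(** The component of [X] in degree [i] is the summand of index [i %/ m]. *)
Definition compr_in i : hom (sval X i) (W (res i)) :=
  ds_in (D (res i)) (i %/ m%:Z)%Z \oc
    delta (cx (sval X)) i (cidx (res i) (i %/ m%:Z)%Z).

Definition compr_pr i : hom (W (res i)) (sval X i) :=
  delta (cx (sval X)) (cidx (res i) (i %/ m%:Z)%Z) i \oc
    ds_pr (D (res i)) (i %/ m%:Z)%Z.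

Lemma compr_inP : forall i j, cd (unroll W) i j \oc compr_in i = compr_in j \oc cd (sval X) i j.
Proof.
apply: (@cmap_adjacent _ _ _ (sval X) (unroll W) compr_in) => i j ij; rewrite unroll_cd //.
rewrite /compr_in compA (dsum_map_in (D (res i)) (D (res j))) comp_suml.
have E : cidx (res j) (j %/ m%:Z)%Z = cidx (res i) (i %/ m%:Z)%Z + 1 by rewrite !cidx_res.
rewrite -[RHS]compA -(cd_delta (sval X) ij E).
case: (boolP ((j %/ m%:Z)%Z \in ds_supp (D (res j)))) => jD; last first.
  rewrite ds_in0 // comp0l big_seq big1 // => t tD; rewrite cd_shape ?comp0r ?comp0l //.
  rewrite -E (inj_eq (@cidx_inj _)); by apply: contraNneq jD => <-.
rewrite (bigD1_seq _ jD) ?ds_uniq //= big1 ?addr0 -?compA // => t nt.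
by rewrite cd_shape ?comp0r ?comp0l // -E (inj_eq (@cidx_inj _)).
Qed.

Lemma compr_prP : forall i j, cd (sval X) i j \oc compr_pr i = compr_pr j \oc cd (unroll W) i j.
Proof.
apply: (@cmap_adjacent _ _ _ (unroll W) (sval X) compr_pr) => i j ij; rewrite unroll_cd //.
rewrite /compr_pr -[RHS]compA (pr_dsum_map (D (res i)) (D (res j))) comp_sumr.
have E : cidx (res j) (j %/ m%:Z)%Z = cidx (res i) (i %/ m%:Z)%Z + 1 by rewrite !cidx_res.
rewrite compA (cd_delta (sval X) E ij).
case: (boolP ((i %/ m%:Z)%Z \in ds_supp (D (res i)))) => jD; last first.
  rewrite ds_pr0 // comp0r big_seq big1 // => t tD; rewrite cd_shape ?comp0l ?comp0r //.
  by apply: contraNneq jD; rewrite E => /addIr/cidx_inj->.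
rewrite (bigD1_seq _ jD) ?ds_uniq //= big1 ?addr0 -?compA // => t nt.
rewrite cd_shape ?comp0l ?comp0r //; apply: contraNneq nt.
by rewrite E => /addIr/cidx_inj->.
Qed.

Definition compr_supp : seq int :=
  undup (flatten [seq [seq cidx c t | t <- ds_supp (D c)] | c <- enum 'Z_m]).

Lemma compr_sum c : \sum_(i <- compr_supp) (delta (cx W) (res i) c \oc compr_in i \oc
  compr_pr i \oc delta (cx W) c (res i)) = idm (W c).
Proof.
rewrite -[RHS](ds_sum (D c)).
pose H i := delta (cx W) (res i) c \oc compr_in i \oc compr_pr i \oc delta (cx W) c (res i).
have HE t : H (cidx c t) = ds_in (D c) t \oc ds_pr (D c) t.
  have cE := cidx_res (cidx c t).
  rewrite /H /compr_in /compr_pr; move: (_ %/ _)%Z cE; rewrite res_cidx => s /cidx_inj->.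
  by rewrite !delta_id !compm1 !comp1m.
transitivity (\sum_(i <- [seq cidx c t | t <- ds_supp (D c)]) H i); last first.
  by rewrite big_map; apply: eq_bigr => t _; exact: HE.
apply: eq_big_support.
- exact: undup_uniq.
- by rewrite map_inj_uniq ?ds_uniq //; exact: cidx_inj.
- move=> i _ ni; rewrite /H; have [rc|nrc] := eqVneq (res i) c; last first.
    by rewrite delta_neq // !comp0l.
  rewrite /compr_in ds_in0 ?comp0l ?comp0r ?comp0l //.
  by apply: contraNN ni => iD; rewrite -(cidx_res i) -rc; exact: map_f.
- move=> i iD; rewrite mem_undup => /negP[]; apply/flattenP.
  by exists [seq cidx c t | t <- ds_supp (D c)] => //; apply/mapP; exists c => //; rewrite mem_enum.
Qed.

Definition compr_compression : compression_of (sval X) W.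
Proof.
apply: (@CompressionOf _ _ _ (sval X) W (@CMap _ _ _ (sval X) (unroll W) _ compr_inP)
  (@CMap _ _ _ (unroll W) (sval X) _ compr_prP) compr_supp).
- exact: undup_uniq.
- move=> i j; set s := (i %/ m%:Z)%Z; set t := (j %/ m%:Z)%Z.
  transitivity (delta (cx (sval X)) (cidx (res j) t) j \oc
    (ds_pr (D (res j)) t \oc delta (cx W) (res i) (res j) \oc ds_in (D (res i)) s) \oc
    delta (cx (sval X)) i (cidx (res i) s)); first by rewrite !compA.
  by rewrite compr_pr_in delta_compL ?cidx_res // delta_compR ?cidx_res.
- exact: compr_sum.
Defined.

End OneComplex.

Lemma compr_compression_map (X Y : Cb A) (f : hom X Y) :
  unroll_map (fmap (compression m_gt1 addA) f : chom (compr_cplx m_gt1 addA X) (compr_cplx m_gt1 addA Y))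
    \oc cin (compr_compression X) = cin (compr_compression Y) \oc (f : chom (sval X) (sval Y)).
Proof.
apply: cmext => i; pose c := res i; pose t := (i %/ m%:Z)%Z.
apply: (etrans (_ : _ = ds_in (compr_dsum m_gt1 addA Y c) t \oc cm f (cidx c t) \oc
  delta (cx (sval X)) i (cidx c t))).
  rewrite -(dsum_diag_in (compr_dsum m_gt1 addA X c) (compr_dsum m_gt1 addA Y c)
    (fun t => cm f (cidx c t))) -compA //.
by rewrite -compA -(delta_natural (cm f)) compA.
Qed.

Lemma compression_conflation (E : sseq (Cb A)) :
  Cb_conflation E -> Cper_conflation (map_sseq (compression m_gt1 addA) E).
Proof.
move=> split c; case: E split => X Y Z f g split.
have [r rP] := choice_dep (fun i => (split i).2).
have [s rsP] := choice_dep rP.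
pose DX := compr_dsum m_gt1 addA X c; pose DY := compr_dsum m_gt1 addA Y c.
pose DZ := compr_dsum m_gt1 addA Z c.
pose Df := dsum_map DX DY (diag_mx (fun t => cm f (cidx c t))).
pose Dg := dsum_map DY DZ (diag_mx (fun t => cm g (cidx c t))).
pose Dr := dsum_map DY DX (diag_mx (fun t => r (cidx c t))).
pose Ds := dsum_map DZ DY (diag_mx (fun t => s (cidx c t))).
have diag_id (V : Cb A) (u : forall t, hom (sval V (cidx c t)) (sval V (cidx c t))) :
    (forall t, u t = idm _) ->
    dsum_map (compr_dsum m_gt1 addA V c) (compr_dsum m_gt1 addA V c) (diag_mx u) = idm _.
  move=> u1; rewrite -[RHS](dsum_map_id (compr_dsum m_gt1 addA V c)).
  by apply: eq_dsum_map => i j _ _; rewrite /diag_mx u1 compm1.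
have gf : Dg \oc Df = 0.
  rewrite /Dg /Df dsum_diag_comp; apply: dsum_map0 => i j.
  by rewrite /diag_mx (split (cidx c i)).1 comp0r.
have rf : Dr \oc Df = idm _.
  by rewrite /Dr /Df dsum_diag_comp; apply: diag_id => t; case: (rsP (cidx c t)).
have gs : Dg \oc Ds = idm _.
  by rewrite /Dg /Ds dsum_diag_comp; apply: diag_id => t; case: (rsP (cidx c t)).
have fr : Df \oc Dr + Ds \oc Dg = idm _.
  rewrite /Df /Dr /Ds /Dg !dsum_diag_comp -[X in X + _]scale1r -dsum_map_lin.
  rewrite -[RHS](dsum_map_id DY); apply: eq_dsum_map => i j _ _.
  rewrite scale1r /diag_mx -compDr; have [_ _ ->] := rsP (cidx c i); exact: compm1.
by split; [exact: gf|exists Dr, Ds].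
Qed.

End CompressionFunctor.

(** * Extensions under unrolling *)

Section ExtensionMorphisms.
Variables (k : comPzRingType) (A : kcat k) (I : nzRingType).

(** The converse of [x_cls_morph]. *)
Lemma x_cls_morph_ex (X Z X' Z' : cplx A I) (E : extension X Z) (E' : extension X' Z')
    (a : chom X X') (c : chom Z Z') :
  coboundary (fun i j => cm a j \oc x_cls E i j - x_cls E' i j \oc cm c i) ->
  exists b : chom (x_mid E) (x_mid E'),
    b \oc x_f E = x_f E' \oc a /\ c \oc x_g E = x_g E' \oc b.
Proof.
move=> [s sP].
pose u i : hom (x_mid E i) (X' i) := cm a i \oc x_r E i + s i \oc cm (x_g E) i.
pose v : chom (x_mid E) Z' := c \oc x_g E.
have ud i j : cd X' i j \oc u i + x_cls E' i j \oc cm v i = u j \oc cd (x_mid E) i j.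
  have aw : cm a j \oc x_cls E i j =
      cd X' i j \oc s i - s j \oc cd Z i j + x_cls E' i j \oc cm c i by rewrite -sP subrK.
  rewrite /u compDr compDl -(compA (cm a j)) x_rd compDr !(compA (cm a j)) aw.
  rewrite -(compA (s j)) -(cmP (x_g E)) -(cmP a) cm_comp !compDl compNl !compA.
  rewrite -!addrA; congr (_ + (_ + _)).
  by rewrite [RHS]addrC -[RHS]addrA subrr addr0.
have uE i : u i = cm a i \oc x_r E i + s i \oc cm (x_g E) i by [].
have vE : v = c \oc x_g E by [].
clearbody u v.
have bP i j : cd (x_mid E') i j \oc (cm (x_f E') i \oc u i + x_s E' i \oc cm v i) =
    (cm (x_f E') j \oc u j + x_s E' j \oc cm v j) \oc cd (x_mid E) i j.
  rewrite compDr compDl -(compA (cm (x_f E') j)) -ud compDr !compA (cmP (x_f E')) x_ds.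
  by rewrite compDl -!compA (cmP v) addrA.
pose b : chom (x_mid E) (x_mid E') := @CMap _ _ _ (x_mid E) (x_mid E') _ bP.
exists b; split; apply: cmext => i; rewrite !cm_comp /= vE.
  by rewrite compDl -!compA uE compDl -!compA x_rf x_gf !comp0r compm1 !addr0.
by rewrite compDr !compA x_gf comp0l add0r x_gs comp1m.
Qed.

End ExtensionMorphisms.

Section Unrolling.
Variables (k : comPzRingType) (A : kcat k) (I : nzRingType).
Implicit Types (X Y Z W V M : cplx A I) (B : cplx A int).
Local Notation res := (res I).

Definition unroll_cls Z X (w : forall i j, hom (Z i) (X j)) (i j : int) :
    hom (unroll Z i) (unroll X j) :=
  if j == i + 1 then w (res i) (res j) else 0.

Lemma unroll_coboundary Z X (w : forall i j, hom (Z i) (X j)) :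
  coboundary w -> @coboundary _ _ _ (unroll Z) (unroll X) (unroll_cls w).
Proof.
move=> [s sP]; exists (fun i => s (res i)) => i j; rewrite /unroll_cls /=.
by case: ifP => _; [exact: sP|rewrite comp0l comp0r subr0].
Qed.

Lemma unroll_cocycle Z X (w : forall i j, hom (Z i) (X j)) :
  cocycle w -> @cocycle _ _ _ (unroll Z) (unroll X) (unroll_cls w).
Proof.
move=> [w0 wd]; split=> [i j|i j l]; rewrite /unroll_cls /=; first by move/negPf->.
case: (j == i + 1); case: (l == j + 1); rewrite ?comp0l ?comp0r ?addr0 //.
exact: wd.
Qed.

Lemma unroll_mapM W V M (g : chom V M) (f : chom W V) :
  unroll_map (g \oc f) = unroll_map g \oc unroll_map f.
Proof. exact: cmext. Qed.

Definition unroll_extension X Z (E : extension X Z) : extension (unroll X) (unroll Z).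
Proof.
apply: (@Extension _ _ _ (unroll X) (unroll Z) (unroll (x_mid E)) (unroll_map (x_f E))
  (unroll_map (x_g E)) (fun i => x_r E (res i)) (fun i => x_s E (res i))
  (fun i => x_gf E (res i)) (fun i => x_rf E (res i)) (fun i => x_gs E (res i))
  (fun i => x_sum E (res i)) (unroll_cls (x_cls E))) => i j.
rewrite /unroll_cls /=; case: ifP => _; first exact: x_clsE.
by rewrite comp0r comp0l.
Defined.

Lemma unroll_idm W : unroll_map (idm (W : CplxCat A I)) = idm (unroll W : CplxCat A int).
Proof. exact: cmext. Qed.

Lemma cpr_cin B W (K : compression_of B W) : cpr K \oc cin K = idm (B : CplxCat A int).
Proof. by apply: cmext => i; exact: cp_ci1. Qed.

(** Uniqueness in the universal property [compression_lift]. *)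
Lemma compression_hom_eq B W M (K : compression_of B W) (f g : chom W M) :
  unroll_map f \oc cin K = unroll_map g \oc cin K -> f = g.
Proof.
move=> fg; apply: cmext => c; apply: (ci_jointly_epi (K := K)) => j.
rewrite -!(delta_natural (cm (_ : chom W M))) -!compA; congr (_ \oc _).
exact: (cm_eq fg j).
Qed.

Lemma compression_cpr_natural B B' W W' (K : compression_of B W) (K' : compression_of B' W')
    (h : chom B B') (H : chom W W') :
  unroll_map H \oc cin K = cin K' \oc h -> cpr K' \oc unroll_map H = h \oc cpr K.
Proof.
move=> Hh; apply: cmext => i; rewrite !cm_comp.
apply: (ci_jointly_epi (K := K) (c := res i)) => j.
have E : cm H (res j) \oc ci K j = ci K' j \oc cm h j by exact: (cm_eq Hh j).
rewrite -[LHS]compA -(compA (cm (cpr K') i)).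
rewrite (_ : cm (unroll_map H) i \oc _ = delta (cx W') (res j) (res i) \oc (ci K' j \oc cm h j)).
  rewrite compA [LHS](_ : _ = cp K' i \oc delta (cx W') (res j) (res i) \oc ci K' j \oc cm h j).
    rewrite cp_ci -[RHS]compA -[RHS]compA [cm (cpr K) i \oc _](_ : _ = delta (cx B) j i).
      exact: (delta_natural (cm h)).
    by rewrite -(cp_ci K) compA.
  by rewrite !compA.
by rewrite -E [RHS]compA (delta_natural (cm H)) -compA.
Qed.

End Unrolling.

(** * Almost split classes between compressions *)

Section Transfer.
Variables (k : comPzRingType) (A : kcat k) (I : nzRingType).
Implicit Types (W M : cplx A I) (B V : cplx A int).
Local Notation res := (res I).
Hypothesis addA : additive_cat A.
Hypothesis res_surj : forall c : I, exists i, res i = c.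
Hypothesis compressible :
  forall B, bounded B -> exists W, inhabited (compression_of B W).

Definition cls_component (X0 Z0 : cplx A int) (X Z : cplx A I) (K : compression_of X0 X) (KZ : compression_of Z0 Z)
    (w : forall i j, hom (Z i) (X j)) (i j : int) : hom (Z0 i) (X0 j) :=
  cm (cpr K) j \oc (unroll_cls w i j \oc cm (cin KZ) i).

Lemma cls_component_cocycle (X0 Z0 : cplx A int) (X Z : cplx A I) (K : compression_of X0 X)
    (KZ : compression_of Z0 Z) (w : forall i j, hom (Z i) (X j)) :
  cocycle w -> cocycle (cls_component K KZ w).
Proof.
move=> /unroll_cocycle cw.
exact: (cocycle_compl (cpr K) (cocycle_compr (cin KZ) cw)).
Qed.

(** A chain map to [Z0] that is not a retraction compresses to one that is not a
    retraction either, as [cin] and [cpr] transport sections; dually for [X0]. *)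
Lemma cls_component_almost_split (X0 Z0 : cplx A int) (X Z : cplx A I) (K : compression_of X0 X)
    (KZ : compression_of Z0 Z) (w : forall i j, hom (Z i) (X j)) :
  almost_split_class (fun _ => True) w -> ~ coboundary (cls_component K KZ w) ->
  almost_split_class (@bounded _ A) (cls_component K KZ w).
Proof.
move=> [_ rw lw] nw; split=> // V h bV nh; have [WV [KV]] := compressible bV.
  have [H HP] := compression_lift KV (cin KZ \oc h).
  have Hpr := compression_cpr_natural HP.
  have /(rw _ H)/unroll_coboundary cH : ~ retraction H.
    move=> [s sP]; apply: nh; exists (cpr KV \oc unroll_map s \oc cin KZ).
    by rewrite !compA -Hpr -(compA (cpr KZ)) -unroll_mapM sP unroll_idm compm1 cpr_cin.
  have := coboundary_compl (cpr K) (coboundary_compr (cin KV) (cH Logic.I)).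
  apply: eq_coboundary => i j; rewrite /cls_component -!compA; congr (_ \oc _).
  have HPi : cm H (res i) \oc cm (cin KV) i = cm (cin KZ) i \oc cm h i by exact: (cm_eq HP i).
  rewrite -HPi compA; congr (_ \oc _).
  by rewrite /unroll_cls; case: ifP => // _; rewrite comp0l.
have [H HP] := compression_lift K (cin KV \oc h).
have Hpr := compression_cpr_natural HP.
have /(lw _ H)/unroll_coboundary cH : ~ section H.
  move=> [s sP]; apply: nh; exists (cpr K \oc unroll_map s \oc cin KV).
  by rewrite -!compA -HP (compA (unroll_map s)) -unroll_mapM sP unroll_idm comp1m cpr_cin.
have := coboundary_compl (cpr KV) (coboundary_compr (cin KZ) (cH Logic.I)).
apply: eq_coboundary => i j; rewrite /cls_component.
have Hprj : cm (cpr KV) j \oc cm H (res j) = cm h j \oc cm (cpr K) j by exact: (cm_eq Hpr j).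
rewrite !compA -Hprj -!compA; congr (_ \oc _); rewrite !compA; congr (_ \oc _).
by rewrite /unroll_cls; case: ifP => // _; rewrite comp0r.
Qed.

(** An almost split class determines its starting term. Pulled back to the cone of
    [w1], the class [w2] becomes a coboundary; hence [w2] is the image of [w1] under
    some [a], which must be a section because the image is not a coboundary. *)
Lemma almost_split_class_section (X1 X2 Z0 : cplx A int)
    (w1 : forall i j, hom (Z0 i) (X1 j)) (w2 : forall i j, hom (Z0 i) (X2 j)) :
  bounded X1 -> bounded X2 -> bounded Z0 -> cocycle w1 ->
  almost_split_class (@bounded _ A) w1 -> almost_split_class (@bounded _ A) w2 ->
  exists a : chom X1 X2, section a.
Proof.
move=> bX1 bX2 bZ0 cw1 [n1 _ l1] [n2 r2 _].
have [E1 E1P] := cone_ex addA cw1.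
have bE1 : bounded (x_mid E1).
  move/boundedP: bX1 => [s1 s1P]; move/boundedP: bZ0 => [s2 s2P].
  apply/boundedP; exists (s1 ++ s2) => i; rewrite mem_cat negb_or => /andP[i1 i2].
  by apply: x_mid_zero; [exact: s1P|exact: s2P].
have [|s sP] := r2 _ (x_g E1) bE1.
  by move/x_g_retraction/(eq_coboundary E1P).
have aP i j : cd X2 i j \oc (s i \oc cm (x_f E1) i) = (s j \oc cm (x_f E1) j) \oc cd X1 i j.
  apply/subr0_eq; rewrite !compA -(compA (s j)) -(cmP (x_f E1)) (compA (s j)) -compBl -sP.
  by rewrite -compA x_gf comp0r.
pose a : chom X1 X2 := @CMap _ _ _ X1 X2 _ aP.
exists a; apply: contrapT => /(l1 _ _ bX2) ca; apply: n2.
have cs : coboundary (fun i j => cd X2 i j \oc (s i \oc x_s E1 i) - (s j \oc x_s E1 j) \oc cd Z0 i j).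
  by exists (fun i => s i \oc x_s E1 i).
have := coboundaryB cs ca; apply: eq_coboundary => i j /=.
rewrite -[RHS]compm1 -(x_gs E1) [RHS]compA sP compBl -!compA x_ds E1P compDr !compA.
by rewrite opprD [RHS]addrA addrAC.
Qed.

Section Components.
Variables (X0 Z0 : cplx A int) (X Z : cplx A I).
Variables (K : compression_of X0 X) (KZ : compression_of Z0 Z).
Variable E : extension X Z.
Hypothesis asE : almost_split_class (fun _ => True) (x_cls E).
Hypotheses (bX0 : bounded X0) (bZ0 : bounded Z0).
Hypothesis nX0 : ~ is_zero (X0 : CplxCat A int).

(** Only finitely many shifts of [X0] meet the bounded complex [Z0], so that the class
    is a finite sum of components on [Z0]. *)
Lemma unroll_cls_sum :
  exists Q : seq int, [/\ uniq Q, 0 \in Q, forall q, q \in Q -> res q = 0 &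
    forall i j, unroll_cls (x_cls E) i j \oc cm (cin KZ) i =
      \sum_(q <- Q) (sci K q j \oc (scp K q j \oc
        (unroll_cls (x_cls E) i j \oc cm (cin KZ) i)))].
Proof.
move/boundedP: bZ0 => [s sZ0].
have [Q [uQ Q0 Qres Qsum]] := shift_sum K [seq i + 1 | i <- s].
exists Q; split=> // i j.
have [->|nij] := eqVneq j (i + 1); last first.
  rewrite /unroll_cls (negPf nij) comp0l big1 // => q _; by rewrite !comp0r.
case: (boolP (i \in s)) => [si|/sZ0 zi]; last first.
  rewrite (zero_domE (cm (cin KZ) i) zi) comp0r big1 // => q _.
  by rewrite !comp0r.
rewrite -[LHS]comp1m -(Qsum (i + 1)); last by apply/mapP; exists i.
by rewrite comp_suml; apply: eq_bigr => q _; rewrite -compA.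
Qed.

(** A lift of [Z0] to the unrolled middle term would correspond, by adjunction, to a
    section of [x_g E]. *)
Lemma cls_not_all_coboundaries :
  ~ coboundary (fun i j => unroll_cls (x_cls E) i j \oc cm (cin KZ) i).
Proof.
move=> cw; case: asE => nE _ _; apply: nE; apply/x_g_retraction.
have [u uP] : exists u : chom Z0 (unroll (x_mid E)),
    unroll_map (x_g E) \oc u = cin KZ by exact/(x_lift (unroll_extension E)).
have [s sP] := compression_lift KZ u.
exists s; apply: (compression_hom_eq (K := KZ)).
by rewrite unroll_mapM -compA sP uP unroll_idm comp1m.
Qed.

Lemma nonzero_component : exists q (q0 : res q = 0) (Kq : compression_of (ush_ob q X0) X),
  ~ coboundary (cls_component Kq KZ (x_cls E)).
Proof.
apply: contrapT => H; apply: cls_not_all_coboundaries.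
have [Q [uQ Q0 Qres Qsum]] := unroll_cls_sum.
have cQ q : q \in Q -> coboundary (fun i j => sci K q j \oc (scp K q j \oc
    (unroll_cls (x_cls E) i j \oc cm (cin KZ) i)) : hom (Z0 i) (unroll X j)).
  move=> /Qres q0; have [Kq [KqI KqP]] := compression_of_shift K q0.
  have cq : coboundary (cls_component Kq KZ (x_cls E)).
    by apply: contrapT => nc; apply: H; exists q, q0, Kq.
  have := coboundary_compl (cin Kq) cq; apply: eq_coboundary => i j.
  by rewrite /cls_component -KqI -KqP.
apply: eq_coboundary (coboundary_sum cQ) => i j; exact: esym (Qsum i j).
Qed.

(** If the component on [X0] is nonzero then the others vanish, since an almost
    split class determines its starting term. *)
Lemma unroll_cls_coh : ~ coboundary (cls_component K KZ (x_cls E)) ->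
  coboundary (fun i j => cm (cin K) j \oc cls_component K KZ (x_cls E) i j -
    unroll_cls (x_cls E) i j \oc cm (cin KZ) i).
Proof.
move=> n0; have [Q [uQ Q0 Qres Qsum]] := unroll_cls_sum.
have cw := x_cls_cocycle E.
have as0 := cls_component_almost_split asE n0.
have cQ q : q \in rem 0 Q -> coboundary (fun i j => sci K q j \oc (scp K q j \oc
    (unroll_cls (x_cls E) i j \oc cm (cin KZ) i)) : hom (Z0 i) (unroll X j)).
  rewrite mem_rem_uniq // inE => /andP[nq /Qres q0].
  have [Kq [KqI KqP]] := compression_of_shift K q0.
  have cq : coboundary (cls_component Kq KZ (x_cls E)).
    apply: contrapT => nc; have asq := cls_component_almost_split asE nc.
    have bq : bounded (ush_ob q X0).
      have [a [b abX]] := bX0; exists (a - q), (b - q) => i ni; apply: abX.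
      by apply: contraNN ni; lia.
    have [a [r ra]] := almost_split_class_section bq bX0 bZ0
      (cls_component_cocycle Kq KZ cw) asq as0.
    case/negP: nq; apply/eqP; apply: (ush_support_eq bX0 nX0) => i; rewrite addr0 => zi.
    exact: (is_zero_retract (cm_eq ra i) zi).
  have := coboundary_compl (cin Kq) cq; apply: eq_coboundary => i j.
  by rewrite /cls_component -KqI -KqP.
apply: eq_coboundary (coboundaryN (coboundary_sum cQ)) => i j.
rewrite [X in _ = _ - X]Qsum (big_rem 0 Q0) /= opprD [RHS]addrA [X in _ = X - _](_ : _ = 0) ?sub0r //.
apply/eqP; rewrite subr_eq0; apply/eqP.
pose F j' := delta (cx X) (res j') (res j) \oc ci K j' \oc cp K j' \oc
  delta (cx X) (res j) (res j').
have FE : sci K 0 j \oc scp K 0 j = ci K j \oc cp K j.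
  transitivity (F (j + 0)); first by rewrite /F /sci /scp !compA.
  by rewrite addr0 /F !delta_id compm1 comp1m.
rewrite /cls_component compA [RHS]compA; congr (_ \oc _); exact: (esym FE).
Qed.

(** [E0] is the cone of the component on [X0]. The inclusions of [X0] and [Z0] extend to
    the middle terms because the other components are coboundaries. *)
Lemma component_extension : ~ coboundary (cls_component K KZ (x_cls E)) ->
  exists (E0 : extension X0 Z0) (b : chom (x_mid E0) (unroll (x_mid E))),
    [/\ almost_split_class (@bounded _ A) (x_cls E0),
        b \oc x_f E0 = unroll_map (x_f E) \oc cin K &
        cin KZ \oc x_g E0 = unroll_map (x_g E) \oc b].
Proof.
move=> n0; have [E0 E0P] := cone_ex addA (cls_component_cocycle K KZ (x_cls_cocycle E)).
have [|b [bf cg]] := @x_cls_morph_ex _ _ _ _ _ _ _ E0 (unroll_extension E) (cin K) (cin KZ).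
  by apply: eq_coboundary (unroll_cls_coh n0) => i j; rewrite E0P.
exists E0, b; split=> //.
have [nc rc lc] := cls_component_almost_split asE n0; split.
- by move/(eq_coboundary E0P).
- move=> V h bV nh; apply: eq_coboundary (rc V h bV nh) => i j; by rewrite E0P.
- move=> V h bV nh; apply: eq_coboundary (lc V h bV nh) => i j; by rewrite E0P.
Qed.

End Components.
End Transfer.

(** * The end terms are close together: upper bound *)

Section Supports.
Variables (k : comPzRingType) (A : kcat k).
Implicit Types X Y Z V : cplx A int.

Lemma tight_bounds X : bounded X -> ~ is_zero (X : CplxCat A int) ->
  exists a b, [/\ ~ is_zero (X a), ~ is_zero (X b) &
    forall i, ~~ (a <= i <= b) -> is_zero (X i)].
Proof.
move=> [l [u luX]] nX.
have [i0 ni0] : exists i, ~ is_zero (X i).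
  by apply: contrapT => H; apply/nX/cplx_is_zero => i; apply: contrapT => Hi; apply: H; exists i.
have lu i : ~ is_zero (X i) -> l <= i <= u by move=> ni; apply: contrapT => /negP/luX.
have := lu _ ni0 => /andP[l0 u0].
have exa : exists N : nat, `[< ~ is_zero (X (l + N%:Z)) >].
  by exists (absz (i0 - l)); apply/asboolP; have -> : l + (absz (i0 - l))%:Z = i0 by lia.
have exb : exists N : nat, `[< ~ is_zero (X (u - N%:Z)) >].
  by exists (absz (u - i0)); apply/asboolP; have -> : u - (absz (u - i0))%:Z = i0 by lia.
have [a /asboolP na amin] := ex_minnP exa; have [b /asboolP nb bmin] := ex_minnP exb.
exists (l + a%:Z), (u - b%:Z); split=> // i ni; apply: contrapT => nz.
have /andP[li ui] := lu _ nz; case/negP: ni; apply/andP; split.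
  have := amin (absz (i - l)); have -> : l + (absz (i - l))%:Z = i by lia.
  by move=> /(_ (introT (asboolP _) nz)); lia.
have := bmin (absz (u - i)); have -> : u - (absz (u - i))%:Z = i by lia.
by move=> /(_ (introT (asboolP _) nz)); lia.
Qed.

Lemma bounded_extension X Z (E : extension X Z) :
  bounded X -> bounded Z -> bounded (x_mid E).
Proof.
move=> /boundedP[s sP] /boundedP[t tP]; apply/boundedP; exists (s ++ t) => i.
by rewrite mem_cat negb_or => /andP[/sP zX /tP zZ]; exact: x_mid_zero.
Qed.

Lemma coboundary_cocycle Z X (s : forall i, hom (Z i) (X i)) :
  cocycle (fun i j => cd X i j \oc s i - s j \oc cd Z i j).
Proof.
split=> [i j nij|i j l]; first by rewrite !cd_shape // comp0l comp0r subrr.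
rewrite compBr compBl !compA cd_cd comp0l -(compA (s l)) cd_cd comp0r.
by rewrite sub0r subr0 addNr.
Qed.

Lemma cocycleB Z X (v w : forall i j, hom (Z i) (X j)) :
  cocycle v -> cocycle w -> cocycle (fun i j => v i j - w i j).
Proof.
move=> [v0 vd] [w0 wd]; split=> [i j nij|i j l]; first by rewrite v0 // w0 // subrr.
by rewrite compBr compBl addrACA -opprD vd wd subrr.
Qed.

Lemma coboundary_compr_iso Z X (w : forall i j, hom (Z i) (X j)) (h : chom Z Z) :
  is_iso h -> coboundary (fun i j => w i j \oc cm h i) -> coboundary w.
Proof.
move=> [h' [_ hh']] /(coboundary_compr (h' : chom Z Z)).
by apply: eq_coboundary => i j; rewrite -compA -cm_comp hh'; exact: compm1.
Qed.

End Supports.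

Section Window.
Variables (k : comPzRingType) (A : kcat k).
Implicit Types X Y Z V : cplx A int.
Variable n : nat.
Hypothesis KS : krull_schmidt A.
Hypothesis narrow : forall X, bounded X -> indec_cplx X -> narrow_cplx n X.

Section AlmostSplit.
Variables (X Z : cplx A int) (w : forall i j, hom (Z i) (X j)) (a b c d : int).
Hypotheses (bX : bounded X) (bZ : bounded Z).
Hypotheses (locX : local_end (X : CplxCat A int)) (locZ : local_end (Z : CplxCat A int)).
Hypothesis cw : cocycle w.
Hypothesis asw : almost_split_class (@bounded _ A) w.
Hypotheses (nXa : ~ is_zero (X a)) (nXb : ~ is_zero (X b)).
Hypotheses (nZc : ~ is_zero (Z c)) (nZd : ~ is_zero (Z d)).
Hypothesis suppX : forall i, ~~ (a <= i <= b) -> is_zero (X i).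
Hypothesis suppZ : forall i, ~~ (c <= i <= d) -> is_zero (Z i).
Hypotheses (ab : b - a < n%:Z) (cd_n : d - c < n%:Z).

(** As the projection of [X] to its components below the top degree [b] is not a
    section, the class can be represented by a single map into the component of
    degree [b]. *)
Lemma top_representative : exists w' : forall i j, hom (Z i) (X j),
  [/\ cocycle w', ~ coboundary w' & forall i j, j != b -> w' i j = 0].
Proof.
have [nw _ lw] := asw.
have [O zO] := zero_object_ex KS.1.
pose S : pred int := fun j => j < b; pose T := trunc S X zO.
pose tin := @trunc_in _ _ _ O S X; pose tpr := @trunc_pr _ _ _ O S X.
have tinP : forall i j, cd T i j \oc tin i = tin j \oc cd X i j.
  apply: (@cmap_adjacent _ _ _ X T tin) => i j ij.
  case: (boolP (S j)) => Sj; last first.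
    rewrite (zero_codE (tin j) (trunc_out X zO Sj)) comp0l.
    by rewrite (zero_codE (cd T i j) (trunc_out X zO Sj)) comp0l.
  have Si : S i by move: Sj; rewrite /S; lia.
  by rewrite /= -compA trunc_prin // compm1.
pose K : chom X T := @CMap _ _ _ X T tin tinP.
have bT : bounded T.
  have [l [u luX]] := bX; exists l, u => i ni; rewrite /T /= /trunc_ob.
  by case: (S i) => //; exact: luX.
have [|s sP] := lw T K bT.
  move=> [r rK]; apply: nXb; apply: is_zero_retract (cm_eq rK b) _.
  by apply: (trunc_out X zO); rewrite /S ltxx.
pose s' i : hom (Z i) (X i) := tpr i \oc s i.
exists (fun i j => w i j - (cd X i j \oc s' i - s' j \oc cd Z i j)); split.
- by apply: cocycleB => //; exact: coboundary_cocycle.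
- move=> cb; apply: nw.
  have c' : coboundary (fun i j => cd X i j \oc s' i - s' j \oc cd Z i j) by exists s'.
  by apply: eq_coboundary (coboundaryD cb c') => i j; rewrite subrK.
move=> i j nj; case: (ltP b j) => bj.
  by apply: zero_codE; apply: suppX; lia.
have Sj : S j by rewrite /S lt_neqAle nj.
have wE : w i j = tpr j \oc (tin j \oc w i j) by rewrite compA trunc_prin // comp1m.
apply/eqP; rewrite subr_eq0; apply/eqP; rewrite wE (sP i j) compBr !compA; congr (_ - _).
by rewrite /= ?compA trunc_prin // comp1m.
Qed.

(** Near the top degree [b] of [X], the middle term has a summand that does not reach
    down to degree [c] if [n <= b - c]. The endomorphism [ee] of [Z] induced by the
    projection onto it vanishes in degree [c], so [1 - ee] is invertible. But the
    class, living in degree [b] only, is annihilated by [1 - ee]. *)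
Lemma window_above : b - c < n%:Z.
Proof.
rewrite ltNge; apply/negP => bc.
have [w' [cw' nw' w'0]] := top_representative; apply: nw'.
have [E EP] := cone_ex KS.1 cw'.
have [e [_ eb e0]] := split_near KS narrow b (bounded_extension E bX bZ).
have zZb j : b <= j -> is_zero (Z j) by move=> bj; apply: suppZ; lia.
pose e' i : hom (Z i) (Z i) := cm (x_g E) i \oc cm e i \oc x_s E i.
have e'P : forall i j, cd Z i j \oc e' i = e' j \oc cd Z i j.
  apply: cmap_adjacent => i j ij; rewrite /e' !compA (cmP (x_g E)).
  rewrite -(compA _ (cd _ i j)) (cmP e) -!compA x_ds !compDr EP.
  have [->|nj] := eqVneq j b; last by rewrite w'0 // !comp0r add0r.
  by rewrite (zero_codE (cm (x_g E) b) (zZb b (lexx b))) !comp0l addr0.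
pose ee : chom Z Z := @CMap _ _ _ Z Z e' e'P.
have e1iso : is_iso (idm (Z : CplxCat A int) - ee).
  have [||//] := local_split1 (a := ee) (b := idm (Z : CplxCat A int) - ee) locZ.
    by rewrite addrC subrK.
  move/cm_is_iso/(_ c) => iso_c; case: nZc; apply: is_zero_iso0 iso_c _.
  by rewrite /= /e' e0 ?comp0r ?comp0l //; apply/orP; left; lia.
apply: (coboundary_compr_iso e1iso).
exists (fun i => x_r E i \oc cm e i \oc x_s E i) => i j.
have dr : cd X i j \oc x_r E i = x_r E j \oc cd (x_mid E) i j - w' i j \oc cm (x_g E) i.
  by rewrite x_rd EP addrK.
have LE : w' i j \oc cm (idm (Z : CplxCat A int) - ee : chom Z Z) i = w' i j - w' i j \oc e' i.
  exact: (etrans (compBr _ _ (e' i)) (congr1 (fun u => u - _) (compm1 _))).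
rewrite LE /e' !compA dr !compBl -!compA (compA (cd (x_mid E) i j)) (cmP e) -!compA x_ds.
rewrite !compDr EP.
rewrite [RHS]addrAC addrK; congr (_ - _).
have [->|nj] := eqVneq j b; last by rewrite w'0 // !comp0r.
by rewrite eb comp1m compA x_rf comp1m.
Qed.

End AlmostSplit.
End Window.

(** * Truncated projective resolutions *)

Section Resolutions.
Variables (k : comPzRingType) (A : kcat k).
Implicit Types X Y Z V G : cplx A int.
Hypothesis addA : additive_cat A.
Hypothesis weak_kernels : has_weak_kernels A.

Definition exact_at G j : Prop := forall T (y : hom T (G j)),
  cd G j (j + 1) \oc y = 0 -> exists x : hom T (G (j - 1)), y = cd G (j - 1) j \oc x.

Definition const_cplx (W : A) : cplx A int.
Proof.
by exists (fun=> W) (fun _ _ => 0) => [//|i j l]; exact: comp0l.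
Defined.

(** Attaching a weak kernel of the differential that leaves degree [p] to the
    component of degree [p - 1] makes the complex exact in degree [p]. *)
Lemma exact_attach G p : bounded G -> exists G' (f : chom G G'),
  [/\ bounded G', forall j, j != p - 1 -> is_iso (cm f j), exact_at G' p &
      forall j, p < j -> exact_at G j -> exact_at G' j].
Proof.
move=> bG; have [W [u [du uP]]] := weak_kernels (cd G p (p + 1)).
have [O zO] := zero_object_ex addA.
pose S := pred1 (p - 1); pose T := trunc S (const_cplx W) zO.
pose tpr i : hom (T i) W := @trunc_pr _ _ _ O S (const_cplx W) i.
pose tin i : hom W (T i) := @trunc_in _ _ _ O S (const_cplx W) i.
have zT i : i != p - 1 -> is_zero (T i).
  by move=> ni; exact: (trunc_out (const_cplx W) zO ni).
have dT i j : cd T i j = 0 by rewrite /= comp0r comp0l.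
pose w i j : hom (T i) (G j) := delta (cx G) p j \oc u \oc tpr i.
have cw : cocycle w.
  split=> [i j nij|i j l]; last first.
    rewrite dT comp0r addr0 /w !compA.
    have [<-|npj] := eqVneq p j; last by rewrite delta_neq // comp0r !comp0l.
    rewrite delta_id compm1; have [->|nl] := eqVneq l (p + 1); first by rewrite du comp0l.
    by rewrite cd_shape // !comp0l.
  have [ip|ni] := eqVneq i (p - 1); last by apply: zero_domE; exact: zT.
  by rewrite /w delta_neq ?comp0l //; move: nij; rewrite ip subrK eq_sym.
have [E EP] := cone_ex addA cw.
have fiso j : j != p - 1 -> is_iso (cm (x_f E) j).
  move=> nj; exists (x_r E j); split; first exact: x_rf.
  by rewrite -[RHS](x_sum E) (zero_codE (cm (x_g E) j) (zT _ nj)) comp0r addr0.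
have bT : bounded T.
  by exists (p - 1), (p - 1) => i ni; apply: zT; move: ni; lia.
have lift j (V : A) (y : hom V (x_mid E j)) : j != p - 1 -> j + 1 != p - 1 ->
    cd (x_mid E) j (j + 1) \oc y = 0 ->
    cm (x_f E) j \oc (x_r E j \oc y) = y /\ cd G j (j + 1) \oc (x_r E j \oc y) = 0.
  move=> nj nj1 dy; have yE : cm (x_f E) j \oc (x_r E j \oc y) = y.
    rewrite -[RHS]comp1m -(x_sum E) (zero_codE (cm (x_g E) j) (zT _ nj)) comp0r addr0.
    by rewrite compA.
  split=> //; rewrite -[LHS]comp1m -(x_rf E) -compA (compA (cm _ _)) -(cmP (x_f E)).
  by rewrite -[X in _ \oc X]compA yE dy comp0r.
exists (x_mid E), (x_f E); split=> //; first exact: bounded_extension.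
  have np : p != p - 1 by lia.
  have np1 : p + 1 != p - 1 by lia.
  move=> V y dy; have [yE dy'] := lift p V y np np1 dy.
  have [v vP] := uP V _ dy'.
  exists (x_s E (p - 1) \oc (tin (p - 1) \oc v)).
  rewrite (compA (cd (x_mid E) (p - 1) p)) x_ds dT comp0r addr0 EP /w delta_id comp1m -!compA (compA (tpr _)).
  have -> : tpr (p - 1) \oc tin (p - 1) = idm W.
    by apply: (@trunc_prin _ _ _ O S (const_cplx W)); rewrite /S /= eqxx.
  by rewrite comp1m -vP yE.
move=> j pj exj V y dy.
have nj : j != p - 1 by lia.
have nj1 : j + 1 != p - 1 by lia.
have [yE dy'] := lift j V y nj nj1 dy.
have [x xP] := exj V _ dy'; exists (cm (x_f E) (j - 1) \oc x).
by rewrite compA (cmP (x_f E)) -compA -xP yE.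
Qed.

(** A complex that agrees with [Z] from degree [d - 1] upwards, and is exact in as
    many degrees below [d] as required: a truncated projective resolution of the
    cokernel of the last differential of [Z]. *)
Lemma truncated_resolution Z d (N : nat) : bounded Z -> exists G (th : chom Z G),
  [/\ bounded G, forall j, d - 1 <= j -> is_iso (cm th j) &
      forall j, d - N%:Z <= j < d -> exact_at G j].
Proof.
move=> bZ; elim: N => [|N [G [th [bG thiso exG]]]].
  exists Z, (idm (Z : CplxCat A int)); split=> // j; first by move=> _; exact: is_iso_id.
  by rewrite subr0 => /andP[dj jd]; have := le_lt_trans dj jd; rewrite ltxx.
have [G' [f [bG' fiso exp exj]]] := exact_attach (d - N.+1%:Z) bG.
exists G', (f \oc th); split=> // j.
  move=> dj; apply: is_iso_comp (thiso j dj); apply: fiso; lia.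
move=> jd; have [->//|nj] := eqVneq j (d - N.+1%:Z).
by apply: exj; [lia|apply: exG; lia].
Qed.

(** The homotopy is constructed by descending induction on the degree, starting at [d]. *)
Lemma exact_null_homotopy V G (phi : chom V G) d (N : nat) :
  (forall j, d <= j -> cm phi j = 0) -> (forall j, d - N%:Z <= j < d -> exact_at G j) ->
  exists t : forall i j, hom (V i) (G j), forall i, d - N%:Z <= i ->
    cm phi i = cd G (i - 1) i \oc t i (i - 1) + t (i + 1) i \oc cd V i (i + 1).
Proof.
move=> phi0; elim: N => [|N IH] exG.
  exists (fun _ _ => 0) => i; rewrite subr0 => di.
  by rewrite phi0 // comp0l comp0r addr0.
have [|t tP] := IH; first by move=> j jd; apply: exG; lia.
pose p := d - N.+1%:Z.
have pd : d - N.+1%:Z <= p < d by rewrite /p; lia.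
have [|x xP] := exG p pd _ (cm phi p - t (p + 1) p \oc cd V p (p + 1)).
  rewrite compBr (cmP phi) tP; last by rewrite /p; lia.
  rewrite compDl -!compA cd_cd comp0r addr0 !compA.
  by rewrite addrK subrr.
pose t' i j := (if i == p then 0 else t i j) +
  delta (cx G) (p - 1) j \oc x \oc delta (cx V) i p.
have t'p : t' p (p - 1) = x by rewrite /t' eqxx add0r !delta_id comp1m compm1.
have t'n i j : i != p -> t' i j = t i j.
  by move=> ni; rewrite /t' (negPf ni) (@delta_neq _ _ _ (cx V)) // comp0r addr0.
exists t' => i pi; have [->|ni] := eqVneq i p.
  by rewrite t'p t'n -?xP ?subrK //; lia.
rewrite !t'n //; last by move: pi; rewrite -/p; lia.
by apply: tP; move: pi ni; rewrite /p; lia.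
Qed.

Lemma null_homotopic_chain Z (t : forall i j, hom (Z i) (Z j)) :
  exists e : chom Z Z, forall i,
    cm e i = cd Z (i - 1) i \oc t i (i - 1) + t (i + 1) i \oc cd Z i (i + 1).
Proof.
pose e i := cd Z (i - 1) i \oc t i (i - 1) + t (i + 1) i \oc cd Z i (i + 1).
have eP : forall i j, cd Z i j \oc e i = e j \oc cd Z i j.
  apply: cmap_adjacent => i _ ->; rewrite /e compDr compDl !compA cd_cd comp0l add0r.
  by rewrite -(compA (t (i + 1 + 1) (i + 1))) cd_cd comp0r addr0 addrK.
by exists (@CMap _ _ _ Z Z e eP).
Qed.

End Resolutions.

(** * The end terms are close together: lower bound *)

Section WindowBelow.
Variables (k : comPzRingType) (A : kcat k).
Implicit Types X Y Z V G : cplx A int.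
Variable n : nat.
Hypothesis KS : krull_schmidt A.
Hypothesis narrow : forall X, bounded X -> indec_cplx X -> narrow_cplx n X.
Hypothesis weak_kernels : has_weak_kernels A.

(** The section [s] is a homotopy from 0 to an endomorphism [e] that is the identity in
    degree [d] and lives in degrees [d] and [d - 1]. As [1 - e] vanishes in degree [d],
    [e] is invertible by locality, so that [Z] lives in these degrees as well. *)
Lemma retraction_differential_support Z d (s : hom (Z d) (Z (d - 1))) :
  local_end (Z : CplxCat A int) -> ~ is_zero (Z d) ->
  cd Z (d - 1) d \oc s = idm (Z d) ->
  forall i, i != d -> i != d - 1 -> is_zero (Z i).
Proof.
move=> locZ nZd ds i nid nid1.
pose t i j := delta (cx Z) (d - 1) j \oc s \oc delta (cx Z) i d.
have td : t d (d - 1) = s by rewrite /t !delta_id comp1m compm1.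
have t0 u v : u != d -> t u v = 0.
  by move=> nu; rewrite /t (@delta_neq _ _ _ (cx Z) u) // comp0r.
have [e eP] := null_homotopic_chain t.
have [|iso_e|] := local_split1 (a := e) (b := idm (Z : CplxCat A int) - e) locZ.
- by rewrite addrC subrK.
- apply: is_zero_iso0 (cm_is_iso iso_e i) _.
  by rewrite eP !t0 ?comp0r ?comp0l ?addr0 //; lia.
- move/cm_is_iso/(_ d) => iso_d; case: nZd; apply: is_zero_iso0 iso_d _.
  apply: (etrans (_ : _ = idm (Z d) - cm e d)); first by [].
  by rewrite eP td ds t0 ?comp0l ?addr0 ?subrr //; lia.
Qed.

Section AlmostSplit.
Variables (X Z : cplx A int) (w : forall i j, hom (Z i) (X j)) (a b c d : int).
Hypotheses (bX : bounded X) (bZ : bounded Z).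
Hypotheses (locX : local_end (X : CplxCat A int)) (locZ : local_end (Z : CplxCat A int)).
Hypothesis cw : cocycle w.
Hypothesis asw : almost_split_class (@bounded _ A) w.
Hypotheses (nXa : ~ is_zero (X a)) (nZd : ~ is_zero (Z d)).
Hypothesis suppX : forall i, ~~ (a <= i <= b) -> is_zero (X i).
Hypothesis suppZ : forall i, ~~ (c <= i <= d) -> is_zero (Z i).

(** The mapping cone of [th] is an extension of [Z] that does not split, since [th] is
    not null homotopic even in degree [d] alone. So the class becomes a coboundary on
    its middle term; restricted to [G], the homotopy [s] gives the factor [h]. *)
Lemma class_factor G (th : chom Z G) : b < d -> bounded G ->
  (forall s : hom (Z d) (G (d - 1)), cm th d <> cd G (d - 1) d \oc s) ->
  exists h : forall i j, hom (G i) (X j),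
    cocycle h /\ coboundary (fun i j => w i j + h i j \oc cm th i).
Proof.
move=> bd bG nth.
pose H := shift_cplx (-1) G.
have dH i j : cd H i j = - cd G (i - 1) (j - 1) by rewrite /= expr1 scaleN1r.
have ddelta i j l : cd G (j - 1) (l - 1) \oc delta (cx G) i (j - 1) =
    delta (cx G) j (l - 1) \oc cd G i j.
  have [ij|nij] := eqVneq j (i + 1); last first.
    rewrite (@delta_neq _ _ _ (cx G) i); last by lia.
    by rewrite (cd_shape G nij) !comp0r.
  have [jl|njl] := eqVneq l (j + 1).
    by apply: cd_delta; lia.
  rewrite (@delta_neq _ _ _ (cx G) j); last by lia.
  by rewrite cd_shape ?comp0l //; lia.
pose om i j : hom (Z i) (H j) := delta (cx G) i (j - 1) \oc cm th i.
have com : cocycle om.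
  split=> [i j nij|i j l].
    by rewrite /om delta_neq ?comp0l //; lia.
  by rewrite dH /om compNl compA ddelta -!compA (cmP th) addNr.
have [E EP] := cone_ex KS.1 com.
have bH : bounded H by exact: shift_bounded.
have [nw rw _] := asw.
have [|s sP] := rw (x_mid E) (x_g E) (bounded_extension E bH bZ).
  move/x_g_retraction => [s sP].
  apply: (nth (- s d)).
  have K q (u : hom (Z d) (G (d - 1))) : q = d ->
      delta (cx G) d q \oc cm th d = - cd G (d - 1) q \oc u ->
      cm th d = cd G (d - 1) d \oc - u.
    by move=> ->; rewrite delta_id comp1m compNl compNr.
  apply: (K (d + 1 - 1)); first by lia.
  have := sP d (d + 1); rewrite EP /om dH.
  rewrite (zero_codE (cd Z d (d + 1))); last by apply: suppZ; lia.
  by rewrite comp0r subr0.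
pose h i j : hom (G i) (X j) := s j \oc cm (x_f E) j \oc (delta (cx G) i (j - 1) : hom (G i) (H j)).
have sf j l : cd X j l \oc (s j \oc cm (x_f E) j) = - (s l \oc cm (x_f E) l \oc cd G (j - 1) (l - 1)).
  rewrite compA -[cd X j l \oc s j](addrK (- (s l \oc cd (x_mid E) j l))) -(sP j l).
  rewrite opprK compDl -!compA x_gf comp0r add0r (cmP (x_f E)) dH !compNr.
  by rewrite !compA.
exists h; split.
  split=> [i j nij|i j l].
    by rewrite /h delta_neq ?comp0r //; lia.
  by rewrite /h compA sf compNl -!compA ddelta addNr.
exists (fun i => s i \oc x_s E i) => i j.
have -> : h i j \oc cm th i = s j \oc (cm (x_f E) j \oc x_cls E i j).
  by rewrite /h EP /om -!compA.
rewrite (compA (cd X i j)) -[cd X i j \oc s i](subrK (s j \oc cd (x_mid E) i j)) -(sP i j).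
rewrite compDl -!compA x_gs compm1 x_ds compDr -addrA; congr (_ + _).
by rewrite addrK.
Qed.

(** Let [G] agree with [Z] from degree [d - 1] upwards and be exact below [d]. The map
    from [Z] to the part of [G] near degree [d] factors the class, so [G] has an
    extension by [X] whose class [h'] vanishes in degrees up to [d - n]. On the
    complement of the part of its middle term near [d], the map to [G] vanishes from
    degree [d] upwards, and is null homotopic by exactness. The homotopy [t] corrects
    the splittings [x_r] to a chain map [R] to [X], which is the identity on [X] in
    degree [a] if [a <= d - n]. By locality of [X] the extension splits, although [h']
    is not a coboundary. *)
Lemma window_below : b - a < n%:Z -> d - a < n%:Z.
Proof.
move=> ab; rewrite ltNge; apply/negP => da; have bd : b < d by lia.
have [nw _ _] := asw.
have suppZd j : d < j -> is_zero (Z j) by move=> dj; apply: suppZ; lia.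
have an : a <= d - n%:Z by lia.
pose N := absz (d - a + 2).
have [G [th [bG thiso exG]]] := truncated_resolution KS.1 weak_kernels d N bZ.
have zG j : d < j -> is_zero (G j).
  move=> dj; have [|u [_ uP]] := thiso j; first by lia.
  by rewrite /is_zero -uP (zero_codE u (suppZd j dj)) comp0r.
have [e [_ ed e0]] := split_near KS narrow d bG.
(* a null homotopy of [e th] in degree [d] would make the last differential of [Z]
   a retraction, and leave no room for the class *)
have [|h [ch wh]] := class_factor (th := e \oc th) bd bG.
  move=> s; rewrite cm_comp ed comp1m => ths.
  have [|u [uth thu]] := thiso d; first by lia.
  have [|v [vth thv]] := thiso (d - 1); first by lia.
  have retr : cd Z (d - 1) d \oc (v \oc s) = idm (Z d).
    have E : cd Z (d - 1) d \oc v = u \oc cd G (d - 1) d.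
      rewrite -[LHS]comp1m -uth -(compA u) (compA (cm th d)) -(cmP th).
      by rewrite -!compA thv compm1.
    by rewrite compA E -compA -ths uth.
  have suppZ2 := retraction_differential_support locZ nZd retr.
  apply: nw; exists (fun=> 0) => i j; rewrite comp0r comp0l subr0.
  have [ij|nij] := eqVneq j (i + 1); last exact: cw.1.
  have [id|nid] := eqVneq i d; first by apply: zero_codE; apply: suppX; lia.
  have [id1|nid1] := eqVneq i (d - 1); first by apply: zero_codE; apply: suppX; lia.
  by apply: zero_domE; exact: suppZ2.
pose h' i j := h i j \oc cm e i.
have ch' : cocycle h' by exact: cocycle_compr.
have nh' : ~ coboundary h'.
  move=> /(coboundary_compr th) H; apply: nw.
  apply: eq_coboundary (coboundaryB wh H) => i j.
  by rewrite /h' cm_comp compA addrK.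
have h'0 i j : i <= d - n%:Z -> h' i j = 0.
  by move=> ij; rewrite /h' e0 ?ij // comp0r.
clearbody h'.
have [E EP] := cone_ex KS.1 ch'.
have [eps [_ epsd eps0]] := split_near KS narrow d (bounded_extension E bX bG).
have zE j : d < j -> is_zero (x_mid E j).
  by move=> dj; apply: x_mid_zero; [apply: suppX; lia|exact: zG].
(* the part of the middle term that is far from degree [d], mapped to [G] *)
pose phi : chom (x_mid E) G := x_g E \oc (idm (x_mid E : CplxCat A int) - eps).
have epsE j : cm (idm (x_mid E : CplxCat A int) - eps : chom (x_mid E) (x_mid E)) j = idm _ - cm eps j.
  by [].
have phiE j : cm phi j = cm (x_g E) j \oc (idm _ - cm eps j) by [].
have phi0 j : d <= j -> cm phi j = 0.
  rewrite le_eqVlt => /orP[/eqP<-|/zE z]; last exact: zero_domE.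
  by rewrite phiE epsd subrr comp0r.
have [t tP] := exact_null_homotopy phi0 exG.
pose r j : hom (x_mid E j) (X j) :=
  x_r E j \oc (idm _ - cm eps j) - h' (j - 1) j \oc t j (j - 1).
have rP : forall i j, cd X i j \oc r i = r j \oc cd (x_mid E) i j.
  apply: cmap_adjacent => i j ij; case: (ltP j a) => ja.
    have zX : is_zero (X j) by apply: suppX; lia.
    by rewrite (zero_codE (cd X i j) zX) comp0l (zero_codE (r j) zX) comp0l.
  have ph : cm phi i = cd G (i - 1) i \oc t i (i - 1) + t j i \oc cd (x_mid E) i j.
    by rewrite ij; apply: tP; rewrite /N; lia.
  have hd : cd X i j \oc h' (i - 1) i = - (h' i j \oc cd G (i - 1) i).
    by apply/eqP; rewrite -addr_eq0; apply/eqP; exact: ch'.2.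
  have ji : j - 1 = i by lia.
  have rE : r j = x_r E j \oc (idm _ - cm eps j) - h' i j \oc t j i by rewrite /r ji.
  have ce : cd (x_mid E) i j \oc (idm _ - cm eps i) = (idm _ - cm eps j) \oc cd (x_mid E) i j.
    by rewrite compBr compBl (cmP eps) compm1 comp1m.
  rewrite rE /r compBl compBr !compA hd.
  have dr : cd X i j \oc x_r E i = x_r E j \oc cd (x_mid E) i j - h' i j \oc cm (x_g E) i.
    by rewrite x_rd EP addrK.
  rewrite dr compBl -!compA ce -phiE ph compNl opprK compDr opprD.
  by rewrite !compA addrA addrAC subrK.
pose R : chom (x_mid E) X := @CMap _ _ _ (x_mid E) X r rP.
have [|iso_rf|] := local_split1 (a := R \oc x_f E)
    (b := idm (X : CplxCat A int) - R \oc x_f E) locX.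
- by rewrite addrC subrK.
- apply: nh'; apply: eq_coboundary EP _; apply/x_f_section.
  by have [v [vl _]] := iso_rf; exists (v \oc R); rewrite -compA.
- move/cm_is_iso/(_ a) => iso_a; apply: nXa; apply: is_zero_iso0 iso_a _.
  apply: (etrans (_ : _ = idm (X a) - r a \oc cm (x_f E) a)); first by [].
  rewrite /r eps0 ?an // subr0 compm1 h'0; last by lia.
  by rewrite comp0l subr0 x_rf subrr.
Qed.

End AlmostSplit.
End WindowBelow.

(** * The common window *)

Section AlmostSplitWindow.
Variables (k : comPzRingType) (A : kcat k) (n : nat).
Implicit Types X Z : cplx A int.
Hypothesis KS : krull_schmidt A.

Hypothesis narrow : forall X, bounded X -> indec_cplx X -> narrow_cplx n X.
Hypothesis weak_kernels : has_weak_kernels A.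

Lemma almost_split_window X Z (w : forall i j, hom (Z i) (X j)) :
  bounded X -> bounded Z ->
  local_end (X : CplxCat A int) -> local_end (Z : CplxCat A int) ->
  narrow_cplx n X -> narrow_cplx n Z ->
  cocycle w -> almost_split_class (@bounded _ A) w ->
  exists p : int, forall i, ~~ (p <= i < p + n%:Z) -> is_zero (X i) /\ is_zero (Z i).
Proof.
move=> bX bZ locX locZ [x xP] [z zP] cw asw.
have [a [b [nXa nXb suppX]]] := tight_bounds bX locX.1.
have [c [d [nZc nZd suppZ]]] := tight_bounds bZ locZ.1.
have inX i : ~ is_zero (X i) -> x <= i < x + n%:Z by move=> ni; apply: contrapT => /negP/xP.
have inZ i : ~ is_zero (Z i) -> z <= i < z + n%:Z by move=> ni; apply: contrapT => /negP/zP.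
have := (inX _ nXa, inX _ nXb, inZ _ nZc, inZ _ nZd) => -[[[Ha Hb] Hc] Hd].
have ab : b - a < n%:Z by lia.
have cdn : d - c < n%:Z by lia.
have bc := window_above KS narrow bX bZ locZ cw asw nXb nZc suppX suppZ ab cdn.
have ad := window_below KS narrow weak_kernels bX bZ locX locZ cw asw nXa nZd suppX suppZ ab.
exists (Num.min a c) => i ni; split; [apply: suppX|apply: suppZ]; lia.
Qed.

End AlmostSplitWindow.

(** * Local periodic complexes are compressions *)

Section Density.
Variables (k : comPzRingType) (A : kcat k) (I : nzRingType) (n : nat).
Local Notation res := (res I).
Hypothesis KS : krull_schmidt A.
Hypothesis hfin : hom_finite A.
Hypothesis narrow : forall X : cplx A int, bounded X -> indec_cplx X -> narrow_cplx n X.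
Hypothesis res_surj : forall c : I, exists i, res i = c.
Hypothesis compressible :
  forall B : cplx A int, bounded B -> exists W, inhabited (@compression_of _ _ I B W).

(** Let [M] be nonzero in the residue class of [p]. An indecomposable summand [B] at [p]
    of the unrolling of [M], cut off at distance more than [n] from [p], does not reach
    the cuts, and so is a summand of the whole unrolling. By adjunction, the
    compression of [B] is then a summand of [M], which is local. *)
Lemma compression_dense (M : cplx A I) : local_end (M : CplxCat A I) ->
  exists B : cplx A int, [/\ bounded B, indec_cplx B & inhabited (compression_of B M)].
Proof.
move=> locM.
have [p nMp] : exists p, ~ is_zero (M (res p)).
  apply: contrapT => H; apply: locM.1; apply/cplx_is_zero => c.
  by have [p <-] := res_surj c; apply: contrapT => nM; apply: H; exists p.
have [O zO] := zero_object_ex KS.1.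
pose S : pred int := fun j => p - n%:Z <= j <= p + n%:Z.
pose U := unroll M; pose V := trunc S U zO.
pose tin := @trunc_in _ _ _ O S U; pose tpr := @trunc_pr _ _ _ O S U.
have cdV i j : cd V i j = tin j \oc cd U i j \oc tpr i by [].
have bV : bounded V by exists (p - n%:Z), (p + n%:Z) => j; exact: (trunc_out U zO).
have Sp : S p by rewrite /S; lia.
have nVp : ~ is_zero (V p) by move=> zV; apply: nMp; exact: is_zero_retract (trunc_prin O U Sp) zV.
have [B [iB [q [bB indB qi nBp]]]] := indec_summand_at KS bV nVp.
have [a aP] := narrow bB indB.
have inB : a <= p < a + n%:Z by apply: contrapT => /negP/aP.
have iotaP : forall i j, cd U i j \oc (tpr i \oc cm iB i) = (tpr j \oc cm iB j) \oc cd B i j.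
  apply: (@cmap_adjacent _ _ _ B U (fun i => tpr i \oc cm iB i)) => i j ij.
  case: (boolP (S j)) => Sj.
    rewrite -[RHS]compA -(cmP iB) cdV !compA trunc_prin // comp1m //.
  have zB : is_zero (B i) by apply: aP; move: Sj; rewrite /S; lia.
  by rewrite (zero_domE (cm iB i) zB) (zero_domE (cd B i j) zB) !comp0r.
have piP : forall i j, cd B i j \oc (cm q i \oc tin i) = (cm q j \oc tin j) \oc cd U i j.
  apply: (@cmap_adjacent _ _ _ U B (fun i => cm q i \oc tin i)) => i j ij.
  case: (boolP (S i)) => Si.
    rewrite compA (cmP q) cdV -!compA trunc_prin // compm1 //.
  have zB : is_zero (B j) by apply: aP; move: Si; rewrite /S; lia.
  by rewrite (zero_codE (cm q j) zB) (zero_codE (cd B i j) zB) !comp0l.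
pose io : chom B U := @CMap _ _ _ B U _ iotaP.
pose pi : chom U B := @CMap _ _ _ U B _ piP.
have pio : pi \oc io = idm (B : CplxCat A int).
  apply: cmext => j; apply: (etrans (_ : _ = cm q j \oc tin j \oc (tpr j \oc cm iB j))); first by [].
  rewrite -!compA (compA (tin j)) trunc_inpr // comp1m; exact: (cm_eq qi j).
have locB := indec_cplx_local hfin KS bB indB.
have [W [K]] := compressible bB.
have [h hP] := compression_lift K io; have [h' h'P] := compression_colift K pi.
have iso_hh : is_iso (h' \oc h).
  apply: (compression_endo_iso (K := K) res_surj KS.1 bB locB).
  by rewrite unroll_mapM compA h'P -compA hP.
have [c [chh hhc]] := iso_hh.
exists B; split=> //; apply: (compression_of_iso K (a := h)).
have ee : h \oc c \oc h' \oc (h \oc c \oc h') = h \oc c \oc h'.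
  by rewrite -!compA (compA h' h) (compA c) chh comp1m.
have [e0|e1] := local_idempotent locM ee; last first.
  by exists (c \oc h'); split; [rewrite -compA|rewrite compA].
case: nBp; have zW : is_zero (W : CplxCat A I).
  rewrite /is_zero -chh -[h' \oc h]comp1m -hhc.
  rewrite -!compA (compA h) (compA c) -/(comp _ _).
  by rewrite !compA -(compA _ h) -(compA _ (h \oc c)) e0 !(comp0r, comp0l).
move/cplx_is_zero: zW => /(_ (res p)) zW.
exact: is_zero_retract (cp_ci1 K p) zW.
Qed.

End Density.

(** * Shifting into the window *)

Section SequenceIsos.
Variables (k : comPzRingType) (C : kcat k).
Implicit Types E : sseq C.

Lemma sseq_iso_sym E E' : sseq_iso E E' -> sseq_iso E' E.
Proof.
move=> [a [b [c [[a' [a'a aa']] [b' [b'b bb']] [c' [c'c cc']] bf cg]]]].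
exists a', b', c'; split; [by exists a|by exists b|by exists c| |].
  by rewrite -[LHS]compm1 -aa' -!compA (compA (s_f E')) -bf !compA b'b comp1m.
by rewrite -[LHS]compm1 -bb' -!compA (compA (s_g E')) -cg !compA c'c comp1m.
Qed.

Lemma sseq_iso_trans E1 E2 E3 : sseq_iso E1 E2 -> sseq_iso E2 E3 -> sseq_iso E1 E3.
Proof.
move=> [a [b [c [ia ib ic bf cg]]]] [a' [b' [c' [ia' ib' ic' bf' cg']]]].
exists (a' \oc a), (b' \oc b), (c' \oc c); split; try exact: is_iso_comp.
  by rewrite -compA bf !compA bf'.
by rewrite -compA cg !compA cg'.
Qed.

End SequenceIsos.

Lemma map_sseq_iso (k : comPzRingType) (C D : kcat k) (Phi : kfunctor C D) (E E' : sseq C) :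
  sseq_iso E E' -> sseq_iso (map_sseq Phi E) (map_sseq Phi E').
Proof.
move=> [a [b [c [ia ib ic bf cg]]]].
have isoP X Y (f : hom X Y) : is_iso f -> is_iso (fmap Phi f).
  by move=> [g [gf fg]]; exists (fmap Phi g); rewrite -!fmapM gf fg !fmap1.
exists (fmap Phi a), (fmap Phi b), (fmap Phi c); split; try exact: isoP.
  by rewrite /= -!fmapM bf.
by rewrite /= -!fmapM cg.
Qed.

Section Shifting.
Variables (k : comPzRingType) (A : kcat k) (t : int).

Lemma shift_faithful (X Y : Cb A) (f g : hom X Y) :
  fmap (shift A t) f = fmap (shift A t) g -> f = g.
Proof.
move=> fg; apply: (@ush_faithful _ _ t (sval X) (sval Y)).
by apply: cmext => i; exact: (cm_eq fg i).
Qed.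

(** A common sign on the differentials of both complexes does not matter for chain
    maps between them. *)
Lemma shift_full (X Y : Cb A) (g : hom (shift A t X) (shift A t Y)) :
  exists f : hom X Y, fmap (shift A t) f = g.
Proof.
pose g0 : cmap (shift_cplx t (sval X)) (shift_cplx t (sval Y)) := g.
have gP i j : cd (ush_ob t (sval Y)) i j \oc cm g0 i = cm g0 j \oc cd (ush_ob t (sval X)) i j.
  have := cmP g0 i j; rewrite /= compZl compZr => /(congr1 (GRing.scale ((-1) ^+ `|t|%N))).
  by rewrite !scalerA -expr2 sqrr_sign !scale1r.
have [f fg] := @ush_full _ _ t (sval X) (sval Y) (@CMap _ _ _ (ush_ob t _) (ush_ob t _) _ gP).
by exists f; apply: cmext => i; exact: (cm_eq fg i).
Qed.

(** The signs of the two shifts cancel. *)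
Lemma shiftNK (X : cplx A int) i j :
  cd (shift_cplx t (shift_cplx (- t) X)) i j = cd X (i + t - t) (j + t - t).
Proof. by rewrite /= abszN scalerA -expr2 sqrr_sign scale1r. Qed.

Lemma shift_unshiftP (X : cplx A int) :
  forall i j, cd X i j \oc delta (cx X) (i + t - t) i =
    delta (cx X) (j + t - t) j \oc cd (shift_cplx t (shift_cplx (- t) X)) i j.
Proof.
apply: (@cmap_adjacent _ _ _ (shift_cplx t (shift_cplx (- t) X)) X
  (fun i => delta (cx X) (i + t - t) i)) => i j ij; rewrite shiftNK.
by apply: (@cd_delta _ A _ X (i + t - t) (j + t - t) i j); lia.
Qed.

Definition shift_unshift (X : cplx A int) : chom (shift_cplx t (shift_cplx (- t) X)) X :=
  @CMap _ _ _ (shift_cplx t (shift_cplx (- t) X)) X _ (shift_unshiftP X).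

Lemma shift_unshift_iso X : is_iso (shift_unshift X).
Proof.
apply: cplx_is_iso => i; exists (delta (cx X) i (i + t - t)).
have E : i + t - t = i by rewrite addrK.
split; exact: etrans (@delta_compL _ _ _ (cx X) _ _ _ _) (@delta_id _ _ _ (cx X) _).
Qed.

Lemma shift_unshift_sseq (E : sseq (Cb A)) :
  sseq_iso (map_sseq (shift A t) (map_sseq (shift A (- t)) E)) E.
Proof.
exists (shift_unshift (sval (s_fst E))), (shift_unshift (sval (s_mid E))),
  (shift_unshift (sval (s_lst E))).
have iso (X : Cb A) : is_iso (shift_unshift (sval X) : hom (shift A t (shift A (- t) X)) X).
  by have [g gP] := shift_unshift_iso (sval X); exists g.
split; try exact: iso.
  apply: cmext => i; exact: (delta_natural (cm (s_f E : cmap _ _))).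
apply: cmext => i; exact: (delta_natural (cm (s_g E : cmap _ _))).
Qed.

End Shifting.

Section MoveIntoWindow.
Variables (k : comPzRingType) (A : kcat k) (n : nat).

Definition bounded_sseq (X Z : cplx A int) (E : extension X Z) (bX : bounded X) (bZ : bounded Z) :
    sseq (Cb A) :=
  @SSeq _ (Cb A) (exist _ X bX) (exist _ (x_mid E) (bounded_extension E bX bZ)) (exist _ Z bZ)
    (x_f E) (x_g E).

Lemma bounded_sseq_almost_split X Z (E : extension X Z) (bX : bounded X) (bZ : bounded Z) :
  local_end (X : CplxCat A int) -> local_end (Z : CplxCat A int) ->
  almost_split_class (@bounded _ A) (x_cls E) -> almost_split_maps (bounded_sseq E bX bZ).
Proof.
move=> locX locZ asE; have [nE rE lE] := asE; split.
- exact: (almost_split_class_left_minimal asE bX bZ locX locZ).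
- split; first by move/x_f_section.
  move=> W h nh; apply/x_extend; exact: lE (proj2_sig W) nh.
- exact: (almost_split_class_right_minimal asE bX bZ locX locZ).
- split; first by move/x_g_retraction.
  move=> W h nh; apply/x_lift; exact: rE (proj2_sig W) nh.
Qed.

Lemma bounded_sseq_conflation X Z (E : extension X Z) (bX : bounded X) (bZ : bounded Z) :
  Cb_conflation (bounded_sseq E bX bZ).
Proof.
move=> i; split; first exact: x_gf.
by exists (x_r E i), (x_s E i); split; [exact: x_rf|exact: x_gs|exact: x_sum].
Qed.

(** Fully faithful functors reflect almost split maps; the inclusion of the window and
    the shifts are fully faithful. *)
Lemma shift_into_window X Z (E : extension X Z) (bX : bounded X) (bZ : bounded Z) (p : int) :
  (forall i, ~~ (p <= i < p + n%:Z) -> is_zero (X i) /\ is_zero (Z i)) ->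
  almost_split_maps (bounded_sseq E bX bZ) ->
  exists (t : int) (E' : sseq (C1n A n)),
    almost_split_sequence (C1n_conflation (n := n)) E' /\
    sseq_iso (map_sseq (shift A t) (map_sseq (incl (concentrated n)) E')) (bounded_sseq E bX bZ).
Proof.
move=> pP asE; pose t := p - 1; set E0 := bounded_sseq E bX bZ in asE *.
pose E1 := map_sseq (shift A t) E0.
have cX : concentrated n (s_fst E1).
  by move=> i ni; apply: (pP _ _).1; rewrite /t; lia.
have cZ : concentrated n (s_lst E1).
  by move=> i ni; apply: (pP _ _).2; rewrite /t; lia.
have cY : concentrated n (s_mid E1).
  by move=> i ni; apply: (x_mid_zero E); [exact: cX ni|exact: cZ ni].
pose E' : sseq (C1n A n) := @SSeq _ (C1n A n) (exist _ _ cX) (exist _ _ cY) (exist _ _ cZ)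
  (s_f E1) (s_g E1).
have iso : sseq_iso (map_sseq (shift A (- t)) (map_sseq (incl (concentrated n)) E')) E0.
  have := shift_unshift_sseq (- t) E0; rewrite opprK; exact.
exists (- t), E'; split=> //.
suff [lm las rm ras] : almost_split_maps E'.
  by split=> // i; exact: (bounded_sseq_conflation E bX bZ (i + t)).
apply: (@reflect_almost_split_maps _ _ _ (incl (concentrated n))).
- by [].
- by move=> U V g; exists g.
apply: (reflect_almost_split_maps (@shift_faithful _ A (- t)) (@shift_full _ A (- t))).
exact: almost_split_maps_iso (sseq_iso_sym iso) asE.
Qed.

End MoveIntoWindow.

(** * Almost split sequences of periodic complexes *)

Lemma degreewise_split_five (k : comPzRingType) (A : kcat k) (I : nzRingType)
    (S S' : sseq (CplxCat A I)) (a : hom (s_fst S) (s_fst S'))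
    (b : hom (s_mid S) (s_mid S')) (c : hom (s_lst S) (s_lst S')) :
  degreewise_split S -> degreewise_split S' ->
  b \oc s_f S = s_f S' \oc a -> c \oc s_g S = s_g S' \oc b ->
  is_iso a -> is_iso c -> is_iso b.
Proof.
move=> sS sS'; have [E SE] := extension_of_split sS; have [E' SE'] := extension_of_split sS'.
move: a b c; rewrite SE SE' /= => a b c bf cg ia ic; exact: x_five_iso bf cg ia ic.
Qed.

Section CompressionUnique.
Variables (k : comPzRingType) (A : kcat k) (I : nzRingType).

Lemma compression_unique (B : cplx A int) (W W' : cplx A I)
    (K : compression_of B W) (K' : compression_of B W') :
  exists a : chom W W', is_iso a /\ unroll_map a \oc cin K = cin K'.
Proof.
have [a aP] := compression_lift K (cin K'); have [a' a'P] := compression_lift K' (cin K).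
exists a; split=> //; exists a'; split.
  by apply: (compression_hom_eq (K := K)); rewrite unroll_mapM -compA aP a'P unroll_idm comp1m.
by apply: (compression_hom_eq (K := K')); rewrite unroll_mapM -compA a'P aP unroll_idm comp1m.
Qed.

End CompressionUnique.

Section PeriodicSequences.
Variables (k : comPzRingType) (A : kcat k) (m : nat) (m_gt1 : (1 < m)%N).
Variable addA : additive_cat A.
Local Notation res := (res 'Z_m).

Lemma compressible_Zm (B : cplx A int) : bounded B ->
  exists W : cplx A 'Z_m, inhabited (compression_of B W).
Proof.
move=> bB; exists (compr_cplx m_gt1 addA (exist _ B bB)).
by constructor; exact: (compr_compression m_gt1 addA (exist _ B bB)).
Qed.

(** The outer terms are compressions of the same complexes, which are unique; the five
    lemma takes care of the middle terms. *)
Lemma compression_sequence_iso (X0 Z0 : cplx A int) (bX : bounded X0) (bZ : bounded Z0)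
    (E0 : extension X0 Z0) (X Z : cplx A 'Z_m) (E : extension X Z)
    (K : compression_of X0 X) (KZ : compression_of Z0 Z)
    (b : chom (x_mid E0) (unroll (x_mid E))) :
  b \oc x_f E0 = unroll_map (x_f E) \oc cin K ->
  cin KZ \oc x_g E0 = unroll_map (x_g E) \oc b ->
  sseq_iso (@SSeq _ (CplxCat A 'Z_m) _ _ _ (x_f E) (x_g E))
    (map_sseq (compression m_gt1 addA) (bounded_sseq E0 bX bZ)).
Proof.
move=> bf cg; apply: sseq_iso_sym; set S := bounded_sseq E0 bX bZ.
have [a [ia aP]] := compression_unique (compr_compression m_gt1 addA (s_fst S)) K.
have [c [ic cP]] := compression_unique (compr_compression m_gt1 addA (s_lst S)) KZ.
have [h hP] := compression_lift (compr_compression m_gt1 addA (s_mid S)) b.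
have sf := compr_compression_map m_gt1 addA (s_f S).
have sg := compr_compression_map m_gt1 addA (s_g S).
have hf : h \oc fmap (compression m_gt1 addA) (s_f S) = x_f E \oc a.
  apply: (compression_hom_eq (K := compr_compression m_gt1 addA (s_fst S))).
  by rewrite !unroll_mapM -!compA aP sf compA hP.
have hg : c \oc fmap (compression m_gt1 addA) (s_g S) = x_g E \oc h.
  apply: (compression_hom_eq (K := compr_compression m_gt1 addA (s_mid S))).
  by rewrite !unroll_mapM -!compA hP sg compA cP.
exists a, h, c; split=> //.
apply: (@degreewise_split_five _ _ _ (map_sseq (compression m_gt1 addA) S)
  (@SSeq _ (CplxCat A 'Z_m) _ _ _ (x_f E) (x_g E)) a h c _ _ hf hg ia ic).
- exact: compression_conflation (bounded_sseq_conflation E0 bX bZ).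
- move=> i; split; first exact: x_gf.
  by exists (x_r E i), (x_s E i); split; [exact: x_rf|exact: x_gs|exact: x_sum].
Qed.

End PeriodicSequences.

Theorem theorem3p8
  (k : comPzRingType)
  (J : lmodType k) (hJ : minimal_injective_cogenerator J)
  (A : kcat k)
  (hfin : hom_finite A) (hKS : krull_schmidt A)
  (n : nat) (hn : (2 <= n)%N)
  (hshift : forall X : Cb A, indecomposable X ->
     exists (t : int) (Y : C1n A n),
       indecomposable Y /\ isomorphic X (shift A t (incl (concentrated n) Y)))
  (hdual : dualizing A J) (hgldim : finite_global_dimension A)
  (m : nat) (hm : (2 <= m)%N)
  (E : sseq (Cper A m))
  (hE : almost_split_sequence (Cper_conflation (m := m)) E) :
  exists (t : int) (E' : sseq (C1n A n)),
    almost_split_sequence (C1n_conflation (n := n)) E' /\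
    sseq_iso E
      (map_sseq (compression hm (proj1 hKS))
        (map_sseq (shift A t)
          (map_sseq (incl (concentrated n)) E'))).
Proof.
case: E hE => X Y Z f g [split_E _ las _ ras].
have [E1 E1E] := extension_of_split split_E; rewrite E1E in las ras *.
have asE := almost_split_class_of_sequence (fun _ => True) las ras.
have narrow := narrow_of_shift hshift.
have cmprs := compressible_Zm hm hKS.1.
have dense := compression_dense hKS hfin narrow (@res_surj m hm) cmprs.
have [X1 [bX1 iX1 [KX1]]] := dense _ (left_almost_split_local las).
have [Z0 [bZ0 iZ0 [KZ]]] := dense _ (right_almost_split_local ras).
have [q [_ [K n0]]] := nonzero_component KX1 KZ asE bZ0.
have locX1 := indec_cplx_local hfin hKS bX1 iX1.
have locZ0 := indec_cplx_local hfin hKS bZ0 iZ0.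
pose X0 := ush_ob q X1.
have locX0 : local_end (X0 : CplxCat A int).
  exact: full_faithful_local (@ush_faithful _ _ q X1 X1) (@ush_full _ _ q X1 X1) locX1.
have bX0 : bounded X0.
  by have [a [b abX]] := bX1; exists (a - q), (b - q) => i ni; apply: abX; lia.
have narX0 : narrow_cplx n X0.
  by have [a aX] := narrow _ bX1 iX1; exists (a - q) => i ni; apply: aX; lia.
have [E0 [b [asE0 bf cg]]] := component_extension hKS.1 cmprs asE bX0 bZ0 locX0.1 n0.
have [p pP] := almost_split_window hKS narrow
  (weak_kernels_of_gldim hKS.1 hgldim) bX0 bZ0 locX0 locZ0 narX0
  (narrow _ bZ0 iZ0) (x_cls_cocycle E0) asE0.
have [t [E' [asE' iso]]] := shift_into_window pP
  (bounded_sseq_almost_split bX0 bZ0 locX0 locZ0 asE0).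
exists t, E'; split=> //.
apply: sseq_iso_trans (compression_sequence_iso hm hKS.1 bX0 bZ0 bf cg) _.
exact: map_sseq_iso (sseq_iso_sym iso).
Qed.
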